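(* Let $q$ be an odd prime power. Let $\Phi$ be a positive function of $g$ and suppose that $S(\theta,\chi_D)\ll\Phi(g)$ uniformly for $\theta\in[0,1]$ and $D\in\mathbb{F}_q[x]$ monic square-free of degree $2g+1$. Let $K\ge g\log g/\Phi(g)$ be an integer. Then for $0\le\theta<1$, $$N_K(\theta,\chi_D)\ge 2g\theta+O(\Phi(g)).$$
   Context: $\chi_D(f)=(D/f)$ is the quadratic character (Jacobi symbol) on $\mathbb{F}_q[x]$; $\mathcal{L}(u,\chi_D)=\sum_{f\ \mathrm{monic}}\chi_D(f)u^{\deg f}$, a real polynomial of degree $2g$ whose zeros lie on $|u|=q^{-1/2}$. $e(x)=e^{2\pi ix}$. $\Lambda(f)=\deg P$ if $f=P^n$ with $P$ monic irreducible, $n\ge1$, else $0$; $P_K(u,\chi_D)=\exp\big(\sum_{k=1}^{K}\sum_{f\ \mathrm{monic},\ \deg f=k}\Lambda(f)\chi_D(f)u^k/k\big)$; $\mathcal{F}_K(u,\chi_D)=\tfrac12(P_K(u,\chi_D)+(qu^2)^gP_K(\overline u,\chi_D))$. $N_K(\theta,\chi_D)$ is the number of distinct zeros of $\mathcal{F}_K(u,\chi_D)$ on the arc $u=q^{-1/2}e(\phi)$, $0\le\phi\le\theta$. Let $\Gamma(\theta)$ be the positively oriented arc from $q^{-2}$ to $q^{-2}e(\theta)$ followed by the radial segment to $q^{-1/2}e(\theta)$; $\arg\mathcal{L}(q^{-1/2}e(\theta),\chi_D)$ is minus the continuous change in argument of $\mathcal{L}$ along $\Gamma(\theta)$ starting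 from $0$ (at a zero, the right limit in $\theta$), and $S(\theta,\chi_D)=\frac1\pi\arg\mathcal{L}(q^{-1/2}e(\theta),\chi_D)$. Asymptotic notation refers to $g\to\infty$ with $q$ fixed. *)

(* Defs.v *)
From HB Require Import structures.
From mathcomp Require Import all_boot all_order all_algebra all_field.
From mathcomp Require Import complex.
From mathcomp Require Import all_classical all_reals all_analysis.

Set Implicit Arguments.
Unset Strict Implicit.
Unset Printing Implicit Defensive.

Import Order.TTheory GRing.Theory Num.Theory.
Import numFieldNormedType.Exports.

Local Open Scope classical_set_scope.
Local Open Scope ring_scope.
Local Open Scope complex_scope.

Section Arithmetic.
Variable F : finFieldType.
Implicit Types D P f : {poly F}.

Definition square_free D : Prop :=
  forall p : {poly F}, (1 < size p)%N -> ~~ (p ^+ 2 %| D).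

Definition hyperelliptic (g : nat) D : Prop :=
  [/\ D \is monic, square_free D & size D = (2 * g).+2].

(* (D / P), for P monic irreducible. *)
Definition legendre D P : int :=
  if P %| D then 0
  else if `[< exists h : {poly F}, P %| h ^+ 2 - D >] then 1 else -1.

Definition multiplicity P f : nat :=
  \max_(e < size f | P ^+ e %| f) e.

(* Every divisor of f <> 0 has size at most size f, so the product runs over
   all the monic irreducible P, those not dividing f contributing 1. *)
Definition chi D f : int :=
  \prod_(P : {poly_(size f) F} | `[< monic_irreducible_poly (val P) >])
    legendre D (val P) ^+ multiplicity (val P) f.

Definition mangoldt f : nat :=
  xget 0%N [set d | exists P n, [/\ monic_irreducible_poly P, (0 < n)%N,
                                    f = P ^+ n & d = (size P).-1]].

Definition monic_deg (k : nat) : pred {poly_(k.+1) F} :=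
  [pred h : {poly_(k.+1) F} | (val h \is monic) && (size (val h) == k.+1)].

End Arithmetic.

Section Analysis.
Variables (R : realType) (F : finFieldType).
Implicit Types (D : {poly F}) (u : R[i]) (g K k n : nat) (theta : R).

Definition cis (t : R) : R[i] := cos t +i* sin t.

Definition cexp (z : R[i]) : R[i] := (expR (complex.Re z))%:C * cis (complex.Im z).

(* e(x) = exp(2 pi i x) *)
Definition e2pi (x : R) : R[i] := cis (2 * pi * x).

Definition qR : R := #|F|%:R.

(* q^(-1/2) e(x) *)
Definition critical_point (x : R) : R[i] := ((Num.sqrt qR)^-1)%:C * e2pi x.

(* The sum over all monic f, grouped by degree; for D as in [hyperelliptic g D]
   its terms vanish for n > 2g, so that it is defined for every u. *)
Definition Lchi D u : R[i] :=
  limn ([series (\sum_(h : {poly_(n.+1) F} | monic_deg h) chi D (val h))%:~R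
                * u ^+ n]_n : nat -> R[i]^o).

Definition PK K D u : R[i] :=
  cexp (\sum_(1 <= k < K.+1) \sum_(h : {poly_(k.+1) F} | monic_deg h)
          (mangoldt (val h))%:R * (chi D (val h))%:~R * u ^+ k / k%:R).

Definition FK g K D u : R[i] :=
  2^-1 * (PK K D u + (qR%:C * u ^+ 2) ^+ g * PK K D (u^*)%C).

(* Valued in \bar R: +oo if the set were infinite. *)
Definition NK g K D theta : \bar R :=
  counting [set u | (exists2 phi : R, 0 <= phi <= theta & u = critical_point phi)
                    /\ FK g K D u = 0].

(* The path Gamma(theta), on the parameter interval [0, 2]: the arc for
   t <= 1, then the radial segment. *)
Definition Gamma theta (t : R) : R[i] :=
  if t <= 1 then (qR ^- 2)%:C * e2pi (t * theta)
  else ((2 - t) * qR ^- 2 + (t - 1) * (Num.sqrt qR)^-1)%:C * e2pi theta.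

(* d is the value at b of the continuous determination on [a, b], starting
   from 0, of the argument of the nonvanishing function f. In the use below
   f a = L(q^(-2)) > 0. *)
Definition arg_change (f : R -> R[i]) (a b d : R) : Prop :=
  exists phi : R -> R,
    [/\ {within `[a, b], continuous phi}, phi a = 0,
        (forall t, a <= t <= b ->
           exists2 r : R, 0 < r & f t = r%:C * cis (phi t))
      & d = phi b].

Definition L_arg_change D theta : R :=
  xget 0 [set d | arg_change (fun t => Lchi D (Gamma theta t)) 0 2 d].

(* At a zero of L on the critical circle: the right limit in theta. *)
Definition argL D theta : R :=
  if Lchi D (critical_point theta) == 0
  then lim (- L_arg_change D x @[x --> theta^'+])
  else - L_arg_change D theta.

Definition Sfun D theta : R := argL D theta / pi.

End Analysis.

(* Main.v *)
(** Write [L(u) = \prod_w (1 - w q^(1/2) u)]. The Riemann hypothesis, obtained by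
    Stepanov's method applied to the values of [D^((q^k - 1) / 2)] at the roots of
    the primes of degree dividing [k], gives [|w| <= 1]; only this inequality is
    used, so that no functional equation is needed. Then [S(theta)] is
    [- 1 / pi] times the sum [A(y)] of the arguments of [1 - w e^(i y)],
    [y = 2 pi theta].

    Each such argument can jump down but increases at rate at most [1 / 2], so a
    bound [|A| <= M] limits the number of [w e^(i y)] within [d] of [1] to
    [O(g d + M)]. Comparing [log (1 - z)] with its Taylor polynomial of degree
    [K], whose error at [z] is at most [min (3, 2 / ((K + 1) |1 - z|))], and
    summing over dyadic distances from [h = Phi(g) / g], one finds that the
    argument [E(y)] of [P_K] at [q^(-1/2) e(theta)] is [O(Phi(g))] as soon as
    [K >= g log g / Phi(g)]. On the circle [F_K] vanishes when
    [2 g theta - E / pi] is half of an odd integer, and the intermediate value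
    theorem provides the zeros.

    The additive constants are [O(Phi(g))] because [Phi] is bounded below: for an
    irreducible [D], either some [w] lies on the circle and [A] jumps there, or
    the first Fourier coefficient of [A] is [c_1 q^(-1/2)] up to sign, with
    [c_1] a nonzero integer. *)
From HB Require Import structures.
From mathcomp Require Import all_boot all_order all_algebra all_field.
From mathcomp Require Import complex qpoly qfpoly.
From mathcomp Require Import all_classical all_reals all_analysis.
From mathcomp Require Import zify ring lra.
Require Import Defs.
Set Implicit Arguments.
Unset Strict Implicit.
Unset Printing Implicit Defensive.
Import Order.TTheory GRing.Theory Num.Theory.
Import numFieldNormedType.Exports.
Local Open Scope classical_set_scope.
Local Open Scope ring_scope.

(** * The character on monic polynomials *)

(** Stepanov's method is applied only over fields with q^(2k) elements, where the square root q^k of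
    the cardinality is an integer. This gives bounds for the even power sums of the inverse zeros,
    and those are enough to bound the squares of the inverse zeros. The inequality |w| <= 1 puts
    every w e^(iy) other than 1 in the half plane Re < 1. The principal value given by [atan] is
    therefore a continuous determination of the argument of each factor along the whole path, and no
    winding has to be followed. The hypothesis on K comes from the dyadic sum. Each of about log g
    scales contributes O(g / K), while the finest scale h contributes O(g h + Phi(g)), which makes h
    = Phi(g) / g the natural choice. The finest scale also leaves a term Phi(g) / (h K) = g / K.
    Reciprocity is used for a single purpose: to show that the coefficients of L vanish from degree
    2g + 1 on. *)

Section PolyArith.
Variable F : finFieldType.
Implicit Types (D P f g : {poly F}) (n k : nat).

(** A duplicate-free sequence in one type for all degrees, so that sums over monic polynomials can
    be reindexed by [perm_big]. *)
Definition monics n : seq {poly F} := [seq val h | h <- enum (@monic_deg F n)].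

Lemma mem_monics n f : (f \in monics n) = (f \is monic) && (size f == n.+1).
Proof.
apply/mapP/andP => [[h]|[fm /eqP sf]].
  by rewrite mem_enum => /andP[hm hs] ->.
have sf' : f \is a poly_of_size n.+1 by rewrite qualifE /= sf.
exists (Sub f sf'); last by rewrite SubK.
by rewrite mem_enum inE SubK fm sf eqxx.
Qed.

Lemma monics_uniq n : uniq (monics n).
Proof. by rewrite map_inj_uniq ?enum_uniq //; exact: val_inj. Qed.

Lemma big_monics (V : nmodType) n (G : {poly F} -> V) :
  \sum_(h : {poly_(n.+1) F} | monic_deg h) G (val h) = \sum_(h <- monics n) G h.
Proof. by rewrite big_map big_enum. Qed.

Lemma exists_irreducible_dvdp f :
  (1 < size f)%N -> exists P, monic_irreducible_poly P /\ P %| f.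
Proof.
move=> sf.
have f0 : f != 0 by rewrite -size_poly_gt0; apply: leq_trans sf.
pose Q n := `[< exists g : {poly F}, [/\ g %| f, size g = n & (1 < n)%N] >].
have exQ : exists n, Q n by exists (size f); apply/asboolP; exists f.
case: (ex_minnP exQ) => n /asboolP[g [gf sg n1]] nmin.
have g0 : g != 0 by apply: contraTneq gf => ->; rewrite dvd0p.
have girr : irreducible_poly g.
  split=> [|q sq qg]; first by rewrite sg.
  have q0 : q != 0 by apply: contraTneq qg => ->; rewrite dvd0p.
  rewrite -dvdp_size_eqp // eqn_leq dvdp_leq //= sg nmin //.
  apply/asboolP; exists q; split=> //; first exact: dvdp_trans qg gf.
  by move: sq q0; rewrite -size_poly_gt0; case: (size q) => [|[]].
exists ((lead_coef g)^-1 *: g); split; last by rewrite dvdpZl ?invr_eq0 ?lead_coef_eq0.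
have lg : (lead_coef g)^-1 != 0 by rewrite invr_eq0 lead_coef_eq0.
split; last by rewrite monicE lead_coefZ mulVf ?lead_coef_eq0.
split; first by rewrite size_scale ?girr.1.
move=> q sq; rewrite dvdpZr // => qg.
by rewrite (eqp_trans (girr.2 q sq qg)) // eqp_sym eqp_scale.
Qed.

(** Existence of a prime factorization, packaged as an induction that peels off one prime at a
    time. *)
Lemma monic_irr_ind (T : {poly F} -> Prop) :
  T 1 ->
  (forall P f, monic_irreducible_poly P -> f \is monic -> T f -> T (P * f)) ->
  forall f, f \is monic -> T f.
Proof.
move=> T1 TM f; have [n] := ubnP (size f); elim: n f => // n IH f fn fm.
have [sf|sf] := leqP (size f) 1.
  have /eqP sf1 : size f == 1%N by rewrite eqn_leq sf size_poly_gt0 monic_neq0.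
  by move: fm; have /eqP/size_poly1P[c _ ->] := sf1; rewrite monicE lead_coefC => /eqP ->.
have [P [Pirr /dvdpP[g fE]]] := exists_irreducible_dvdp sf.
have gm : g \is monic by move: fm; rewrite fE monicMr ?Pirr.2.
rewrite fE mulrC; apply: TM => //; apply: IH => //.
move: fn; rewrite fE size_monicM ?monic_neq0 ?Pirr.2 //.
have := Pirr.1.1; have := monic_neq0 gm; rewrite -size_poly_gt0.
move: (size g) (size P) => a b; lia.
Qed.

Lemma mip_neq0 P : monic_irreducible_poly P -> P != 0.
Proof. by move=> h; rewrite monic_neq0 ?h.2. Qed.

Lemma mip_coprime P Q :
  monic_irreducible_poly P -> monic_irreducible_poly Q -> P != Q -> coprimep P Q.
Proof.
move=> hP hQ; apply: contraR => /eqP nc.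
have s1 : size (gcdp P Q) != 1%N by apply/eqP.
have gP := hP.1.2 _ s1 (dvdp_gcdl _ _); have gQ := hQ.1.2 _ s1 (dvdp_gcdr _ _).
have : P %= Q by rewrite eqp_sym (eqp_trans _ gP) // eqp_sym.
by rewrite eqp_monic ?hP.2 ?hQ.2.
Qed.

(* Every exponent is at most [size f] because [P ^+ e %| f] forces [e < size f]. *)
Lemma multiplicityP P f e : (1 < size P)%N -> f != 0 ->
  (P ^+ e %| f) = (e <= multiplicity P f)%N.
Proof.
move=> sP f0.
have P0 : P != 0 by rewrite -size_poly_gt0; apply: leq_trans sP.
have lt i : P ^+ i %| f -> (i < size f)%N.
  move=> /dvdp_leq => /(_ f0); apply: leq_trans.
  have p0 : (0 < size (P ^+ i))%N by rewrite size_poly_gt0 expf_neq0.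
  by rewrite -(prednK p0) ltnS size_exp leq_pmull //; move: sP; case: size => [|[]].
have h0 : (0 < size f)%N by rewrite size_poly_gt0.
pose o0 : 'I_(size f) := Ordinal h0.
have := @eq_bigmax_cond _ [pred i : 'I_(size f) | P ^+ i %| f] (fun i => i : nat).
rewrite (cardD1 o0) inE /= expr0 dvd1p => /(_ isT) [i0]; rewrite inE => Pi0 E.
apply/idP/idP => [h|h].
  rewrite /multiplicity.
  exact: (@leq_bigmax_cond _ (fun i : 'I_(size f) => P ^+ i %| f) (fun i => i : nat) (Ordinal (lt _ h))).
apply: dvdp_trans Pi0.
by apply: dvdp_exp2l; rewrite -E.
Qed.

Lemma multiplicityM P Q f : monic_irreducible_poly P -> monic_irreducible_poly Q ->
  f != 0 -> multiplicity Q (P * f) = (multiplicity Q f + (Q == P))%N.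
Proof.
move=> hP hQ f0.
have Pf0 : P * f != 0 by rewrite mulf_neq0 // mip_neq0.
have sQ := hQ.1.1.
have E e : (e <= multiplicity Q (P * f))%N = (e <= multiplicity Q f + (Q == P))%N.
  rewrite -multiplicityP //; case: eqVneq => [->|nQP].
    case: e => [|e]; first by rewrite expr0 dvd1p.
    by rewrite exprS dvdp_mul2l ?mip_neq0 // multiplicityP ?hP.1.1 // addn1 ltnS.
  rewrite addn0 Gauss_dvdpr ?multiplicityP //.
  by rewrite coprimep_expl // mip_coprime.
by apply/eqP; rewrite eqn_leq E leqnn -E leqnn.
Qed.

Definition primes_le N : seq {poly F} :=
  [seq P <- [seq val h | h <- enum {poly_N F}] | `[< monic_irreducible_poly P >]].

Lemma mem_primes_le N P :
  (P \in primes_le N) = `[< monic_irreducible_poly P >] && (size P <= N)%N.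
Proof.
rewrite mem_filter; congr (_ && _).
apply/mapP/idP => [[h _ ->]|h]; first by have := valP h; rewrite qualifE.
have hp : P \is a poly_of_size N by rewrite qualifE.
by exists (Sub P hp); rewrite ?mem_enum ?SubK.
Qed.

Lemma primes_le_uniq N : uniq (primes_le N).
Proof. by apply: filter_uniq; rewrite map_inj_uniq ?enum_uniq //; exact: val_inj. Qed.

(** Enlarging the range of primes only adds factors with exponent 0. A common [N] lets the values at
    a product and at its factors be compared over one index set. *)
Lemma chiE D f N : f != 0 -> (size f <= N)%N ->
  chi D f = \prod_(P <- primes_le N) legendre D P ^+ multiplicity P f.
Proof.
move=> f0 fN; rewrite /chi.
transitivity (\prod_(P <- primes_le (size f)) legendre D P ^+ multiplicity P f).
  by rewrite big_filter big_map big_enum_cond.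
symmetry; rewrite (bigID (fun P => P \in primes_le (size f))) /=.
rewrite [X in _ * X]big1_seq ?mulr1; last first.
  move=> P /andP[]; rewrite !mem_primes_le => + /andP[/asboolP hP _].
  rewrite asboolT //= -ltnNge => sP.
  suff /eqP -> : multiplicity P f == 0 by rewrite expr0.
  rewrite -leqn0 leqNgt -multiplicityP ?hP.1.1 // expr1.
  by apply/negP => /dvdp_leq => /(_ f0); rewrite leqNgt sP.
rewrite -big_filter; apply: perm_big; apply: uniq_perm; rewrite ?primes_le_uniq ?(filter_uniq _ (primes_le_uniq _)) //.
move=> P; rewrite mem_filter !mem_primes_le; case: (_ <= _)%N / idP => h.
  by rewrite (leq_trans h fN) !andbT andbb.
by rewrite !andbF.
Qed.

Lemma chi1 D : chi D 1 = 1.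
Proof.
rewrite (@chiE D 1 1) ?oner_neq0 ?size_poly1 // big1_seq // => P /andP[_].
rewrite mem_primes_le => /andP[/asboolP hP _].
suff /eqP -> : multiplicity P 1 == 0 by rewrite expr0.
rewrite -leqn0 leqNgt -(@multiplicityP _ _ 1) ?hP.1.1 ?oner_neq0 //.
by rewrite expr1 dvdp1 neq_ltn hP.1.1 orbT.
Qed.

Lemma chiM_prime D P f : monic_irreducible_poly P -> f != 0 ->
  chi D (P * f) = legendre D P * chi D f.
Proof.
move=> hP f0; pose N := maxn (size (P * f)) (maxn (size P) (size f)).
rewrite !(@chiE D _ N) ?leq_max ?leqnn ?orbT ?mulf_neq0 ?(mip_neq0 hP) //.
have Pf : P \in primes_le N by rewrite mem_primes_le asboolT // !leq_max leqnn orbT.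
rewrite !(bigD1_seq P) ?primes_le_uniq //= multiplicityM // eqxx addn1 exprS -!mulrA.
congr (_ * (_ * _)); rewrite big_seq_cond [RHS]big_seq_cond; apply: eq_bigr => Q.
rewrite mem_primes_le => /andP[/andP[/asboolP hQ _] nQP].
by rewrite multiplicityM // (negbTE nQP) addn0.
Qed.

Lemma chiM D f g : f \is monic -> g != 0 -> chi D (f * g) = chi D f * chi D g.
Proof.
move=> fm g0; elim/monic_irr_ind: f / fm => [|P f hP fm IH].
  by rewrite chi1 !mul1r.
by rewrite -mulrA !(chiM_prime _ hP) ?mulf_neq0 ?(monic_neq0 fm) // IH mulrA.
Qed.

Lemma chi_prime D P : monic_irreducible_poly P -> chi D P = legendre D P.
Proof. by move=> hP; rewrite -[P]mulr1 chiM_prime ?oner_neq0 // chi1 !mulr1. Qed.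

(** [xget] could pick any prime having a power equal to [P ^+ i]; distinct monic primes are coprime,
    so that prime is [P]. *)
Lemma mangoldt_primeX P i : monic_irreducible_poly P -> (0 < i)%N ->
  mangoldt (P ^+ i) = (size P).-1.
Proof.
move=> hP i0; rewrite /mangoldt; case: xgetP => [d -> [Q [j [hQ j0 PQ ->]]]|/(_ (size P).-1)].
  suff -> : P = Q by [].
  apply/eqP/negPn/negP => nPQ; have := mip_coprime hP hQ nPQ.
  rewrite -(@coprimep_pexpl _ i) // PQ coprimep_pexpl // coprimepp.
  by rewrite gtn_eqF ?hQ.1.1.
by case; exists P, i.
Qed.

Lemma mangoldt_neq0 f : mangoldt f != 0%N ->
  exists P i, [/\ monic_irreducible_poly P, (0 < i)%N & f = P ^+ i].
Proof.
rewrite /mangoldt; case: xgetP => [d _ [P [i [hP i0 fE _]]] _|]; last by [].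
by exists P, i.
Qed.

End PolyArith.

(** * Convolution with the von Mangoldt function *)

Section Convolution.
Variable F : finFieldType.
Implicit Types (D P f g : {poly F}) (n k : nat).

Lemma monics_mul (V : nmodType) k n (d : {poly F}) (G : {poly F} -> V) :
  (k <= n)%N -> d \in monics F k ->
  \sum_(e <- monics F (n - k)) G (d * e) = \sum_(f <- monics F n | d %| f) G f.
Proof.
move=> kn; rewrite mem_monics => /andP[dm /eqP sd].
have d0 := monic_neq0 dm.
rewrite -(big_map (fun e => d * e) predT G) -[RHS]big_filter.
apply: perm_big; apply: uniq_perm; rewrite ?filter_uniq ?monics_uniq //.
  by rewrite map_inj_uniq ?monics_uniq //; exact: mulfI.
move=> f; rewrite mem_filter mem_monics; apply/mapP/andP => [[e + ->]|[df /andP[fm /eqP sf]]].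
  rewrite mem_monics => /andP[em /eqP se]; rewrite dvdp_mulr // monicMl // em.
  by rewrite size_monicM ?monic_neq0 // sd se addSn addnS /= subnKC.
have fE := divpK df; exists (f %/ d); last by rewrite mulrC.
have em : f %/ d \is monic by rewrite -(monicMr _ dm) fE.
rewrite mem_monics em /=; apply/eqP.
have := size_monicM em d0; rewrite fE sf sd addnS /=.
by move: (size _) => a; lia.
Qed.

(** The degrees start at 1: the polynomial 1 has [mangoldt] equal to 0, and the convolution sums
    begin at k = 1. *)
Fixpoint monics_le N : seq {poly F} :=
  if N is N'.+1 then monics_le N' ++ monics F N else [::].

Lemma mem_monics_le N f :
  (f \in monics_le N) = (f \is monic) && (1 < size f <= N.+1)%N.
Proof.
elim: N => [|N IH] /=; first by rewrite in_nil andbC; case: (size f) => [|[]].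
rewrite mem_cat IH mem_monics -andb_orr; congr (_ && _).
by move: (size f) => a; lia.
Qed.

Lemma monics_le_uniq N : uniq (monics_le N).
Proof.
elim: N => //= N IH; rewrite cat_uniq IH monics_uniq andbT /=.
apply/hasPn => f; rewrite mem_monics mem_monics_le => /andP[_ /eqP ->].
by rewrite ltnn andbF andbF.
Qed.

Lemma big_monics_le (V : nmodType) N (p : pred {poly F}) (G : {poly F} -> V) :
  \sum_(1 <= k < N.+1) \sum_(d <- monics F k | p d) G d = \sum_(d <- monics_le N | p d) G d.
Proof.
elim: N => [|N IH]; first by rewrite !big_nil.
by rewrite big_nat_recr //= IH big_cat.
Qed.

(** Passing from f to P f creates exactly one new prime power divisor, P to the power
    [(multiplicity P f).+1], and its weight is the degree of P. *)
Lemma sum_mangoldt N f : f \is monic -> (size f <= N.+1)%N ->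
  (\sum_(d <- monics_le N | (d %| f)%R) mangoldt d = (size f).-1)%N.
Proof.
move=> fm; elim/monic_irr_ind: f / fm => [_|P f hP fm IH sPf].
  rewrite size_poly1 big1_seq // => d /andP[]; rewrite dvdp1 mem_monics_le => /eqP ->.
  by rewrite ltnn andbF.
have f0 := monic_neq0 fm; have P0 := mip_neq0 hP; have sP := hP.1.1.
have sE : size (P * f) = ((size P).-1 + size f)%N.
  by rewrite size_monicM ?hP.2 //; move: (size P) (size f) sP => a b; lia.
have sf : (size f <= N.+1)%N.
  by move: sPf; rewrite sE; apply: leq_trans; rewrite leq_addl.
pose d0 := P ^+ (multiplicity P f).+1.
have d0P : d0 %| P * f by rewrite /d0 multiplicityP ?mulf_neq0 // multiplicityM // eqxx addn1.
have d0f : ~~ (d0 %| f) by rewrite /d0 multiplicityP // ltnn.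
have d0m : d0 \in monics_le N.
  rewrite mem_monics_le monic_exp ?hP.2 //= (leq_trans (dvdp_leq _ d0P)) ?mulf_neq0 // andbT.
  have := size_exp P (multiplicity P f).+1; rewrite mulnS /d0.
  by move: (multiplicity _ _) (size (polyseq (_ ^+ _))) (size (polyseq P)) sP => a b c; nia.
rewrite (bigID (fun d => d %| f)) /=.
rewrite (eq_bigl (fun d => d %| f)); last first.
  by move=> d; case: (boolP (d %| f)) => [h|]; rewrite ?andbF ?andbT // dvdp_mull.
rewrite IH // sE; have s0 : (0 < size f)%N by rewrite size_poly_gt0.
rewrite -[X in (_ + X)%N]big_filter (bigD1_seq d0) ?filter_uniq ?monics_le_uniq // /=; last first.
  by rewrite mem_filter d0P d0f.
rewrite mangoldt_primeX // big1_seq ?addn0.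
  by move: (size f) (size P) s0 => a b; lia.
move=> d /andP[dd0]; rewrite mem_filter => /andP[/andP[dPf ndf] _].
apply: contraNeq dd0 => /mangoldt_neq0[Q [i [hQ i0 dE]]].
move: dPf ndf; rewrite dE !multiplicityP ?mulf_neq0 ?hQ.1.1 // multiplicityM //.
case: eqVneq => [-> le|_]; last by rewrite addn0 => ->.
by rewrite /d0 -ltnNge => lt; rewrite (_ : i = (multiplicity P f).+1) //; lia.
Qed.

Variable psi : {poly F} -> int.
Hypothesis psi1 : psi 1 = 1.
Hypothesis psiM : forall f g, f \is monic -> g \is monic -> psi (f * g) = psi f * psi g.

Definition coefL n : int := \sum_(f <- monics F n) psi f.
Definition coefLambda n : int := \sum_(f <- monics F n) (mangoldt f)%:R * psi f.

Lemma monics0 : monics F 0 = [:: 1].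
Proof.
apply: perm_small_eq => //; apply: uniq_perm; rewrite ?monics_uniq // => f.
rewrite mem_monics inE; apply/andP/eqP => [[fm /size_poly1P[c _ fE]]|->]; last by rewrite monic1 size_poly1.
by move: fm; rewrite fE monicE lead_coefC => /eqP ->.
Qed.

Lemma coefL0 : coefL 0 = 1.
Proof. by rewrite /coefL monics0 big_seq1. Qed.

(** Coefficient form of u L'(u) = L(u) times the sum of the c_k u^k. The factor n is written as the
    sum of [mangoldt] over the divisors d of f, and multiplicativity splits the value at f = d e. *)
Lemma coefL_convolution n :
  n%:R * coefL n = \sum_(1 <= k < n.+1) coefLambda k * coefL (n - k).
Proof.
have -> : n%:R * coefL n = \sum_(f <- monics F n) \sum_(1 <= k < n.+1)
     \sum_(d <- monics F k | d %| f) (mangoldt d)%:R * psi f.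
  rewrite mulr_sumr; rewrite big_seq [RHS]big_seq; apply: eq_bigr => f.
  rewrite mem_monics => /andP[fm /eqP sf].
  rewrite (big_monics_le _ _ (fun d => (mangoldt d)%:R * psi f)) -mulr_suml -natr_sum.
  by rewrite sum_mangoldt ?sf.
rewrite exchange_big /=; apply: eq_big_nat => k /andP[k1 kn].
rewrite /coefLambda mulr_suml.
rewrite (eq_bigr (fun f => \sum_(d <- monics F k) (if d %| f then (mangoldt d)%:R * psi f else 0))); last first.
  by move=> f _; rewrite big_mkcond.
rewrite exchange_big /= big_seq [RHS]big_seq; apply: eq_bigr => d dk.
rewrite -big_mkcond /= -mulr_sumr -mulrA; congr (_ * _).
rewrite -(@monics_mul _ k n d psi) // mulr_sumr big_seq [RHS]big_seq.
apply: eq_bigr => e; move: dk; rewrite !mem_monics => /andP[dm _] /andP[em _].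
exact: psiM.
Qed.

Definition deg_dvd k (P : {poly F}) := ((size P).-1 %| k)%N.

Lemma psiX P i : P \is monic -> psi (P ^+ i) = psi P ^+ i.
Proof.
move=> Pm; elim: i => [|i IH]; first by rewrite !expr0.
by rewrite !exprS psiM ?monic_exp // IH.
Qed.

(** A polynomial of degree k with nonzero [mangoldt] is a power of one prime, whose degree divides k
    and fixes the exponent. *)
Lemma coefLambdaE k : (0 < k)%N ->
  coefLambda k = \sum_(P <- primes_le F k.+1 | deg_dvd k P)
     ((size P).-1)%:R * psi P ^+ (k %/ (size P).-1).
Proof.
move=> k0; rewrite /coefLambda.
pose h (P : {poly F}) := P ^+ (k %/ (size P).-1).
have hP0 (P : {poly F}) : P \in [seq P <- primes_le F k.+1 | deg_dvd k P] ->
   [/\ monic_irreducible_poly P, (0 < k %/ (size P).-1)%N & (k = k %/ (size P).-1 * (size P).-1)%N].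
  rewrite mem_filter mem_primes_le => /andP[dk /andP[/asboolP hP sP]].
  have sP1 := hP.1.1; have d0 : (0 < (size P).-1)%N by move: (size P) sP1 => a; lia.
  split; first exact: hP.
    by rewrite divn_gt0 // dvdn_leq.
  by rewrite divnK.
rewrite -[RHS]big_filter.
transitivity (\sum_(f <- [seq h P | P <- [seq P <- primes_le F k.+1 | deg_dvd k P]]) (mangoldt f)%:R * psi f); last first.
  rewrite big_map big_seq [RHS]big_seq; apply: eq_bigr => P /hP0[hP i0 kE].
  by rewrite /h mangoldt_primeX // psiX // hP.2.
rewrite (bigID (fun f => f \in [seq h P | P <- [seq P <- primes_le F k.+1 | deg_dvd k P]])) /=.
rewrite [X in _ + X]big1_seq ?addr0; last first.
  move=> f /andP[nf]; rewrite mem_monics => /andP[fm /eqP sf].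
  case: (eqVneq (mangoldt f) 0%N) => [->|/mangoldt_neq0[P [i [hP i0 fE]]]]; first by rewrite mul0r.
  have kE : (k = (size P).-1 * i)%N by have := size_exp P i; rewrite -fE sf.
  have d0 : (0 < (size P).-1)%N by move: (size P) hP.1.1 => a; lia.
  case/negP: nf; apply/mapP; exists P; last by rewrite /h {1}kE mulKn.
  rewrite mem_filter mem_primes_le asboolT //= /deg_dvd {1}kE dvdn_mulr //=.
  rewrite -(prednK (ltnW hP.1.1)) ltnS kE leq_pmulr //.
rewrite -big_filter; apply: perm_big; apply: uniq_perm.
- by rewrite filter_uniq // monics_uniq.
- rewrite map_inj_in_uniq; first by rewrite filter_uniq // primes_le_uniq.
  move=> P Q /hP0[hP i0 _] /hP0[hQ j0 _]; rewrite /h => PQ.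
  apply/eqP/negPn/negP => nPQ; have := mip_coprime hP hQ nPQ.
  rewrite -(@coprimep_pexpl _ (k %/ (size P).-1)) // PQ coprimep_pexpl // coprimepp.
  by rewrite gtn_eqF ?hQ.1.1.
move=> f; rewrite mem_filter; case: (boolP (f \in map _ _)) => //= /mapP[P /hP0[hP i0 kE] ->].
rewrite mem_monics /h monic_exp ?hP.2 //=.
have s0 : (0 < size (P ^+ (k %/ (size P).-1)))%N by rewrite size_poly_gt0 expf_neq0 // mip_neq0.
rewrite -(prednK s0) size_exp eqSS mulnC; apply/eqP; exact: esym kE.
Qed.

End Convolution.

(** * Counting primes by degree *)

Section PrimeCount.
Variable F : finFieldType.
Implicit Types (P f : {poly F}) (n k : nat).

Lemma size_monics n : size (monics F n) = (#|F| ^ n)%N.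
Proof.
pose s := [seq 'X^n + val h | h <- enum {poly_n F}].
have -> : (#|F| ^ n)%N = size s by rewrite /s size_map -cardE card_npoly.
apply: perm_size; apply: uniq_perm; rewrite ?monics_uniq //.
  by rewrite map_inj_uniq ?enum_uniq // => f g /addrI /val_inj.
move=> f; rewrite mem_monics; apply/andP/mapP => [[fm /eqP sf]|[h _ ->]].
  have hp : f - 'X^n \is a poly_of_size n.
    rewrite qualifE /=; apply/leq_sizeP => j; rewrite leq_eqVlt => /predU1P[<-|nj].
      by rewrite coefB coefXn eqxx; move: fm; rewrite monicE lead_coefE sf => /eqP ->; rewrite subrr.
    by rewrite coefB coefXn gtn_eqF // subr0 nth_default // sf.
  by exists (Sub (f - 'X^n) hp); rewrite ?mem_enum // SubK addrC subrK.
have sh : (size (val h) < size ('X^n : {poly F}))%N.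
  by rewrite size_polyXn ltnS; have := valP h; rewrite qualifE.
by rewrite monicE lead_coefDl // lead_coefXn size_polyDl // size_polyXn eqxx.
Qed.

(** For the trivial character [coefL n] is q^n, and the convolution recurrence then determines the
    c_k one after the other. *)
Lemma coefLambda_one k : (0 < k)%N -> coefLambda (fun _ : {poly F} => 1) k = (#|F| ^ k)%:R.
Proof.
have AE n : coefL (fun _ : {poly F} => 1) n = (#|F| ^ n)%:R.
  by rewrite /coefL big_const_seq count_predT size_monics iter_addr addr0.
have [n] := ubnP k; elim: n k => // n IH k kn k0.
have := @coefL_convolution F (fun _ => 1) (fun _ _ _ _ => esym (mulr1 1)) k.
rewrite AE big_nat_recr //= subnn AE mulr1 big_nat.
rewrite (eq_bigr (fun=> (#|F| ^ k)%:R)); last first.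
  move=> i /andP[i1 ik]; rewrite IH //; last exact: leq_trans ik _.
  by rewrite AE -natrM -expnD subnKC // ltnW.
rewrite -big_nat sumr_const_nat -[_ *+ (k - 1)]mulr_natl => H.
apply: (addrI ((k - 1)%:R * (#|F| ^ k)%:R)); rewrite -H.
by rewrite -{3}[(#|F| ^ k)%:R]mul1r -mulrDl natr1 subn1 prednK.
Qed.

Lemma sum_prime_deg k : (0 < k)%N ->
  (\sum_(P <- primes_le F k.+1 | deg_dvd k P) (size P).-1 = #|F| ^ k)%N.
Proof.
move=> k0; apply/eqP; rewrite -(eqr_nat int) -coefLambda_one // (@coefLambdaE F (fun=> 1)) //.
by rewrite natr_sum; apply/eqP; apply: eq_bigr => P _; rewrite expr1n mulr1.
Qed.

Lemma leq_sum_subset (T : eqType) (s1 s2 : seq T) (G : T -> nat) :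
  uniq s1 -> uniq s2 -> {subset s1 <= s2} ->
  (\sum_(x <- s1) G x <= \sum_(x <- s2) G x)%N.
Proof.
move=> u1 u2 sub; rewrite [leqRHS](bigID (fun x => x \in s1)) /=.
rewrite -[X in (_ <= X + _)%N]big_filter.
have e : perm_eq [seq x <- s2 | x \in s1] s1.
  apply: uniq_perm; rewrite ?filter_uniq // => x; rewrite mem_filter.
  by case: (boolP (x \in s1)) => // /sub ->.
by rewrite (perm_big _ e) leq_addr.
Qed.

(** Otherwise every prime counted by q^n in [sum_prime_deg] has some degree d < n. Those of degree d
    contribute at most q^d, and the q^d with 1 <= d < n add up to less than q^n. *)
Lemma exists_irreducible n : (0 < n)%N ->
  exists P : {poly F}, monic_irreducible_poly P /\ size P = n.+1.
Proof.
move=> n0; apply/not_existsP => none.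
have q1 : (1 < #|F|)%N := finNzRing_gt1 F.
have := sum_prime_deg n0.
rewrite (_ : bigop _ _ _ = \sum_(1 <= d < n) \sum_(P <- primes_le F n.+1 | deg_dvd n P && ((size P).-1 == d)) (size P).-1)%N.
  suff : (\sum_(1 <= d < n) \sum_(P <- primes_le F n.+1 | deg_dvd n P && ((size P).-1 == d)) (size P).-1 < #|F| ^ n)%N.
    by move=> /[swap] ->; rewrite ltnn.
  apply: (@leq_ltn_trans (\sum_(1 <= d < n) #|F| ^ d)%N).
    rewrite big_nat [leqRHS]big_nat; apply: leq_sum => d /andP[d0 dn].
    rewrite -sum_prime_deg // -big_filter -[leqRHS]big_filter.
    apply: leq_sum_subset; try by apply: filter_uniq; exact: primes_le_uniq.
    move=> P; rewrite mem_filter mem_primes_le => /andP[/andP[_ /eqP dE] /andP[hP _]].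
    rewrite mem_filter mem_primes_le hP /deg_dvd dE dvdnn /=; move/asboolP: hP => hP.
    by move: (size (polyseq P)) hP.1.1 dE => a; lia.
  elim: n n0 {none} => // -[_ _|n IH _]; first by rewrite big_geq // expn_gt0 ltnW.
  rewrite big_nat_recr //=; have := IH isT => lt; apply: (@leq_trans (2 * #|F| ^ n.+1)%N).
    by rewrite mul2n -addnn ltn_add2r.
  by rewrite [leqRHS]expnS leq_mul2r q1 orbT.
under [RHS]eq_bigr do rewrite big_mkcondr /=.
rewrite [RHS]exchange_big /= big_seq_cond [RHS]big_seq_cond; apply: eq_bigr => P.
rewrite mem_primes_le => /andP[/andP[/asboolP hP sP] _].
have d0 : (0 < (size P).-1)%N by move: (size (polyseq P)) hP.1.1 => a; lia.
have dn : ((size P).-1 < n)%N.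
  rewrite ltn_neqAle; apply/andP; split.
    by apply/eqP => dE; apply: (none P); split=> //; rewrite -dE prednK // ltnW // hP.1.1.
  by move: (size (polyseq P)) sP => a; lia.
rewrite (bigD1_seq (size P).-1) ?iota_uniq ?mem_index_iota ?d0 //= eqxx big1 ?addn0 //.
by move=> i; rewrite eq_sym => /negbTE ->.
Qed.
End PrimeCount.

(** * Primes and their roots *)

Section Reciprocity.
Variables (F : finFieldType) (K : closedFieldType) (phi : {rmorphism F -> K}).
Implicit Types (D P f h : {poly F}) (n k : nat).

Local Notation q := #|F|.
Local Notation "p ^i" := (map_poly phi p) (at level 2, format "p ^i").

(** Makes the power map of exponent q^k additive, through [exprDn_pchar], in any ring that receives
    F; polynomial rings over K are among them. *)
Lemma card_pchar_nat (R : nzRingType) (f : {rmorphism F -> R}) k :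
  [pchar R].-nat (q ^ k)%N.
Proof.
have [p pp pF] := finPcharP F.
have e := card_pprimeChar pF.
have -> : q = (p ^ logn p #|pPrimeCharType pF|)%N by rewrite -e.
by rewrite -expnM pnatX pnatE // (rmorph_pchar f pF).
Qed.

Lemma card_gt1 : (1 < q)%N. Proof. exact: finNzRing_gt1. Qed.

Lemma card_exp_gt0 k : (0 < q ^ k)%N. Proof. by rewrite expn_gt0 ltnW // card_gt1. Qed.

Lemma phi_frob k a : phi a ^+ (q ^ k) = phi a.
Proof.
elim: k => [|k IH]; first by rewrite expr1.
by rewrite expnS mulnC exprM IH -rmorphXn /= expf_card.
Qed.

Lemma horner_frob k (p : {poly F}) x : p^i.[x] ^+ (q ^ k) = p^i.[x ^+ (q ^ k)].
Proof.
elim/poly_ind: p => [|p c IH]; first by rewrite rmorph0 !horner0 expr0n gtn_eqF ?card_exp_gt0.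
rewrite rmorphD rmorphM /= map_polyX map_polyC /= !hornerMXaddC.
by rewrite (exprDn_pchar _ _ (card_pchar_nat phi k)) exprMn IH phi_frob.
Qed.

Lemma frob_fixed_count k (s : seq K) : (0 < k)%N -> uniq s ->
  (forall x, x \in s -> x ^+ (q ^ k) = x) -> (size s <= q ^ k)%N.
Proof.
move=> k0 us fs.
have Q1 : (1 < q ^ k)%N by rewrite -(expn0 q) ltn_exp2l // card_gt1.
have sz : size ('X^(q ^ k) - 'X : {poly K}) = (q ^ k).+1.
  by rewrite size_polyDl size_polyXn // size_polyN size_polyX ltnS.
rewrite -ltnS -sz max_poly_roots //; first by rewrite -size_poly_gt0 sz.
by apply/allP => x /fs xQ; rewrite rootE hornerD hornerN hornerXn hornerX xQ subrr.
Qed.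

Section Root.
Variables (P : {poly F}) (b : K).
Hypotheses (hP : monic_irreducible_poly P) (Pb : root P^i b).

Local Notation d := (size P).-1.

Lemma mip_deg_gt0 : (0 < d)%N.
Proof. by move: (size (polyseq P)) hP.1.1 => a; lia. Qed.

Lemma mip_root_dvdp h : root h^i b = (P %| h).
Proof.
apply/idP/idP => [hb|/dvdpP[g ->]]; last by rewrite rmorphM rootM Pb orbT.
apply: contraLR hb => nPh.
have cP : coprimep P h.
  apply: contraR nPh => /eqP s1.
  have e := hP.1.2 _ (introN eqP s1) (dvdp_gcdl _ _).
  by rewrite -(eqp_dvdl _ e) dvdp_gcdr.
by rewrite /root; apply: coprimep_root Pb; rewrite coprimep_map.
Qed.

(** In the field F[X] / P, which has q^d elements, the class of X is fixed by the power map of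
    exponent q^d. *)
Lemma mip_dvd_frob : P %| 'X^(q ^ d) - 'X.
Proof.
pose E := {poly %/ P with hP}.
have cE : #|E| = (q ^ d)%N := card_qfpoly hP.
have mkP : mk_monic P = P by rewrite /mk_monic hP.1.1 hP.2.
have e : (in_qpoly P 'X : E) ^+ (q ^ d) = in_qpoly P 'X by rewrite -cE expf_card.
have e2 : in_qpoly P ('X^(q ^ d) - 'X) = 0.
  rewrite rmorphB rmorphXn /=; apply/eqP; rewrite subr_eq0; apply/eqP; exact: e.
move/(congr1 val): e2 => /= /eqP.
by rewrite mkP -Pdiv.IdomainMonic.modpE ?hP.2.
Qed.

Lemma mip_root_frob : b ^+ (q ^ d) = b.
Proof.
have := mip_root_dvdp ('X^(q ^ d) - 'X); rewrite mip_dvd_frob.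
rewrite rmorphB /= map_polyXn map_polyX rootE hornerD hornerN hornerXn hornerX subr_eq0.
by move/eqP.
Qed.

Lemma mip_root_frob_dvd k : (d %| k)%N -> b ^+ (q ^ k) = b.
Proof.
move=> /dvdnP[i ->]; elim: i => [|i IH]; first by rewrite mul0n expn0 expr1.
by rewrite mulSn expnD exprM mip_root_frob IH.
Qed.

(** The elements of the field F(b). *)
Definition residues := [seq (val h)^i.[b] | h : {poly_d F} <- enum {poly_d F}].

Lemma residues_uniq : uniq residues.
Proof.
rewrite map_inj_in_uniq ?enum_uniq // => f g _ _ fg; apply/val_inj/eqP.
have : root (val f - val g)^i b.
  by rewrite rmorphB rootE hornerD hornerN fg subrr.
rewrite mip_root_dvdp -subr_eq0 => dv; apply/negPn/negP => n0.
have sh : (size (val f - val g)%R <= d)%N.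
  rewrite (leq_trans (size_polyD _ _)) // size_polyN geq_max.
  by have := valP f; have := valP g; rewrite !qualifE /= => -> ->.
have dP : (d < size P)%N by rewrite ltn_predL ltnW // hP.1.1.
by have := leq_trans dP (dvdp_leq n0 dv); rewrite ltnNge sh.
Qed.

Lemma residues_size : size residues = (q ^ d)%N.
Proof. by rewrite size_map -cardE card_npoly. Qed.

(** The q^d residues already exhaust the roots of X^(q^d) - X. *)
Lemma frob_fixed_residue g : g ^+ (q ^ d) = g -> exists h, g = h^i.[b].
Proof.
move=> gQ; have : g \in residues; last by case/mapP => h _ ->; exists (val h).
apply/negPn/negP => ng.
have := @frob_fixed_count d (g :: residues) mip_deg_gt0.
rewrite /= ng residues_uniq residues_size ltnn => /(_ isT).
suff H x : x \in g :: residues -> x ^+ (q ^ d) = x by move/(_ H).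
rewrite inE => /predU1P[-> //|/mapP[h _ ->]].
by rewrite horner_frob mip_root_frob.
Qed.

Lemma conjugates_uniq : uniq [seq b ^+ (q ^ i) | i <- iota 0 d].
Proof.
suff H i j : (i < j < d)%N -> b ^+ (q ^ i) != b ^+ (q ^ j).
  rewrite map_inj_in_uniq ?iota_uniq // => i j.
  rewrite !mem_iota !add0n => /andP[_ id] /andP[_ jd] e.
  case: (ltngtP i j) => // ij; first by have := H i j; rewrite ij jd e eqxx => /(_ isT).
  by have := H j i; rewrite ij id e eqxx => /(_ isT).
move=> /andP[ij jd]; apply/eqP => e.
(* Raising b^(q^i) = b^(q^j) to the power q^(d - j) gives b^(q^c) = b. Then all q^d residues would
   be roots of X^(q^c) - X, with c < d. *)
pose c := (d - (j - i))%N.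
have bc : b ^+ (q ^ c) = b.
  have -> : c = (i + (d - j))%N by rewrite /c; lia.
  by rewrite expnD exprM e -exprM -expnD subnKC ?mip_root_frob // ltnW.
have := @frob_fixed_count c residues; rewrite residues_uniq residues_size.
have c0 : (0 < c)%N by rewrite /c; lia.
suff H x : x \in residues -> x ^+ (q ^ c) = x.
  by move=> /(_ c0 isT H); rewrite leq_exp2l ?card_gt1 // /c; lia.
by move=> /mapP[h _ ->]; rewrite horner_frob bc.
Qed.

Lemma mip_conjugates : P^i = \prod_(i < d) ('X - (b ^+ (q ^ i))%:P).
Proof.
have ar : all (root P^i) [seq b ^+ (q ^ i) | i <- iota 0 d].
  apply/allP => x /mapP[i _ ->]; rewrite rootE -horner_frob.
  by rewrite (eqP Pb) expr0n gtn_eqF ?card_exp_gt0.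
have [|g] := @uniq_roots_prod_XsubC _ _ _ ar; first by rewrite uniq_rootsE conjugates_uniq.
rewrite big_map -{1}(subn0 d) big_mkord => gE.
have sG : size (\prod_(i < d) ('X - (b ^+ (q ^ i))%:P)) = d.+1.
  by rewrite size_prod_XsubC /index_enum -enumT size_enum_ord.
apply/eqP; rewrite -eqp_monic ?monic_prod_XsubC ?monic_map ?hP.2 // eqp_sym.
rewrite -dvdp_size_eqp; last by rewrite gE dvdp_mull.
by rewrite sG size_map_poly prednK // ltnW // hP.1.1.
Qed.

End Root.
End Reciprocity.

(** * Euler's criterion, reciprocity, and vanishing of the coefficients of L *)

Section EulerCriterion.
Variables (F : finFieldType) (K : closedFieldType) (phi : {rmorphism F -> K}).
Hypothesis q_odd : odd #|F|.
Implicit Types (D P f h : {poly F}) (n k : nat).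

Local Notation q := #|F|.
Local Notation "p ^i" := (map_poly phi p) (at level 2, format "p ^i").

Lemma half_card_exp d : ((q ^ d).-1)./2.*2 = (q ^ d).-1.
Proof.
have o : odd (q ^ d) by rewrite oddX q_odd orbT.
by rewrite -[RHS]odd_double_half; case: (q ^ d)%N o => //= n /negbTE ->.
Qed.

(** Raising D(b) to the sum of the q^i gives its norm to F, so this identity expresses the exponent
    of Euler's criterion through the norm. *)
Lemma half_geom d : ((\sum_(i < d) q ^ i) * (q.-1)./2 = ((q ^ d).-1)./2)%N.
Proof.
apply: double_inj; rewrite half_card_exp predn_exp mulnC doubleMl.
by have := half_card_exp 1; rewrite expn1 => ->.
Qed.

Lemma half_card_exp_gt0 d : (0 < d)%N -> (0 < ((q ^ d).-1)./2)%N.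
Proof.
move=> d0; rewrite -double_gt0 half_card_exp -subn1 subn_gt0.
by rewrite -(expn0 q) ltn_exp2l // finNzRing_gt1.
Qed.

Lemma euler_criterion P (b : K) D : monic_irreducible_poly P -> root P^i b ->
  (legendre D P)%:~R = D^i.[b] ^+ ((q ^ (size P).-1).-1)./2.
Proof.
move=> hP Pb; set d := (size P).-1; set N := _./2; set x := D^i.[b].
have d0 : (0 < d)%N := mip_deg_gt0 hP Pb.
have N0 : (0 < N)%N := half_card_exp_gt0 d0.
have N2 : (N * 2)%N = (q ^ d).-1 by rewrite muln2 half_card_exp.
rewrite /legendre -(mip_root_dvdp hP Pb) rootE -/x; case: eqVneq => [->|x0].
  by rewrite expr0n gtn_eqF.
have fx1 (y : K) : y != 0 -> y ^+ (q ^ d) = y -> y ^+ (N * 2) = 1.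
  move=> y0 yQ; apply: (mulfI y0); rewrite -exprS N2 prednK ?mulr1 //.
  exact: card_exp_gt0.
case: asboolP => [[h Ph]|nh].
  have xE : x = h^i.[b] ^+ 2.
    move: Ph; rewrite -(mip_root_dvdp hP Pb) rmorphB rmorphXn rootE hornerD hornerN.
    by rewrite horner_exp subr_eq0 => /eqP ->.
  rewrite xE -exprM mulnC fx1 //; first by move: x0; rewrite xE expf_eq0.
  by rewrite horner_frob (mip_root_frob hP Pb).
have : (x ^+ N) ^+ 2 == 1.
  by rewrite -exprM fx1 // horner_frob (mip_root_frob hP Pb).
rewrite -{1}[1](expr1n _ 2) eqf_sqr => /orP[/eqP xN|/eqP -> //]; case: nh.
(* If x^N = 1, a square root g of x in K satisfies g^(q^d) = g, so it is a residue h(b), and D is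
   congruent to h^2 modulo P. *)
have [|g] := closed_rootP ('X^2 - x%:P) _; first by rewrite size_XnsubC.
rewrite rootE hornerD hornerN hornerXn hornerC subr_eq0 => /eqP gx.
have [|h gE] := @frob_fixed_residue F K phi P b hP Pb g.
  rewrite -/d -(prednK (card_exp_gt0 F d)) -N2 exprS mulnC exprM gx xN mulr1 //.
exists h; rewrite -(mip_root_dvdp hP Pb) rmorphB rmorphXn rootE hornerD hornerN.
by rewrite horner_exp -gE gx subrr.
Qed.

Lemma legendre_range D P : legendre D P \in [:: 0; 1; -1].
Proof. by rewrite /legendre; case: ifP => // _; case: ifP. Qed.

Lemma chi_range D f : f \is monic -> chi D f \in [:: 0; 1; -1].
Proof.
move=> fm; elim/monic_irr_ind: f / fm => [|P f hP fm IH]; first by rewrite chi1.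
rewrite chiM_prime ?monic_neq0 //.
have := legendre_range D P; move: IH; rewrite !inE.
by do 2![case/or3P=> /eqP ->].
Qed.

Lemma prod_subC (s : seq K) y :
  \prod_(w <- s) (w - y) = (-1) ^+ size s * \prod_(w <- s) (y - w).
Proof.
elim: s => [|w s IH]; first by rewrite !big_nil mulr1.
by rewrite !big_cons IH exprS mulrACA mulN1r opprB.
Qed.

Section Chi.
Variables (D : {poly F}) (rD : seq K).
Hypothesis D_roots : D^i = \prod_(w <- rD) ('X - w%:P).

Definition sgnD : K := ((-1) ^+ size rD) ^+ (q.-1)./2.
(** Up to sign, the resultant of D and f raised to the power (q - 1) / 2; it depends only on f
    modulo D. *)
Definition jacobi_prod f : K := (\prod_(w <- rD) f^i.[w]) ^+ (q.-1)./2.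

Lemma sgnD_sqr : sgnD ^+ 2 = 1.
Proof. by rewrite /sgnD -!exprM -signr_odd !oddM !andbF. Qed.

Lemma jacobi_prodM f g : jacobi_prod (f * g) = jacobi_prod f * jacobi_prod g.
Proof.
rewrite /jacobi_prod -exprMn -big_split /=; congr (_ ^+ _).
by apply: eq_bigr => w _; rewrite rmorphM hornerM.
Qed.

(** Quadratic reciprocity. For a prime P with roots b^(q^i), the product of the P(w) over the roots
    w of D is, up to sign, the product of the D(b^(q^i)), a norm to which Euler's criterion
    applies. *)
Lemma chi_jacobi f : f \is monic ->
  (chi D f)%:~R = sgnD ^+ (size f).-1 * jacobi_prod f.
Proof.
move=> fm; elim/monic_irr_ind: f / fm => [|P f hP fm IH].
  rewrite chi1 size_poly1 mul1r /jacobi_prod big1 ?expr1n // => w _.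
  by rewrite rmorph1 hornerC.
have P0 := mip_neq0 hP; have f0 := monic_neq0 fm.
have -> : (size (P * f)).-1 = ((size P).-1 + (size f).-1)%N.
  rewrite size_monicM ?hP.2 //; have := hP.1.1; have := f0; rewrite -size_poly_gt0.
  by move: (size (polyseq P)) (size (polyseq f)) => a c; lia.
rewrite chiM_prime // intrM IH jacobi_prodM exprD mulrACA; congr (_ * _).
have [b Pb] : exists b, root P^i b.
  by apply/closed_rootP; rewrite size_map_poly gtn_eqF // hP.1.1.
rewrite (euler_criterion D hP Pb) /jacobi_prod; set d := (size P).-1.
suff -> : \prod_(w <- rD) P^i.[w] = ((-1) ^+ size rD) ^+ d * D^i.[b] ^+ (\sum_(i < d) q ^ i).
  rewrite exprMn -[_.[b] ^+ _ ^+ _]exprM half_geom mulrA.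
  have -> : ((-1) ^+ size rD) ^+ d ^+ (q.-1)./2 = sgnD ^+ d by rewrite /sgnD -!exprM; congr (_ ^+ _); lia.
  by rewrite -exprMn -expr2 sgnD_sqr expr1n mul1r.
under eq_bigr do rewrite (mip_conjugates hP Pb) horner_prod.
rewrite exchange_big /= -/d.
under eq_bigr => i _.
  under eq_bigr do rewrite hornerXsubC.
  rewrite prod_subC.
  have -> : \prod_(w <- rD) (b ^+ (q ^ i) - w) = D^i.[b] ^+ (q ^ i).
    rewrite horner_frob D_roots horner_prod; apply: eq_bigr => w _.
    by rewrite hornerXsubC.
  over.
by rewrite big_split /= prodr_const card_ord expr_sum.
Qed.

(* Multiplying the remainder of [f] modulo [D] by a nonresidue [a] changes the
   sign of [chi D f], because the degree of [D] is odd. *)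
Lemma coefL_chi_eq0 n : D \is monic -> odd (size D).-1 -> ((size D).-1 <= n)%N ->
  coefL (chi D) n = 0.
Proof.
move=> Dm oD Dn.
have D0 := monic_neq0 Dm.
have sr : size rD = (size D).-1.
  by have := congr1 (fun p : {poly K} => size p) D_roots; rewrite size_prod_XsubC size_map_poly => ->.
(* Otherwise all q - 1 nonzero elements would be roots of X^((q - 1) / 2) - 1. *)
have [a aN] : exists a : F, a ^+ (q.-1)./2 = -1.
  apply/not_existsP => none.
  have q2 : ((q.-1)./2 * 2)%N = q.-1 by rewrite muln2; have := half_card_exp 1; rewrite expn1.
  have h a : a != 0 :> F -> a ^+ (q.-1)./2 = 1.
    move=> a0; have : (a ^+ (q.-1)./2) ^+ 2 == 1.
      rewrite -exprM q2; apply/eqP/(mulfI a0).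
      by rewrite -exprS prednK ?mulr1 ?expf_card // ltnW // finNzRing_gt1.
    rewrite -{1}[1](expr1n _ 2) eqf_sqr => /orP[/eqP //|/eqP aN].
    by case: (none a).
  have g0 : (0 < (q.-1)./2)%N by have := @half_card_exp_gt0 1 isT; rewrite expn1.
  have := @max_poly_roots _ ('X^((q.-1)./2) - 1%:P : {poly F}) (enum (predC1 (0 : F))).
  rewrite -size_poly_gt0 size_XnsubC // enum_uniq -cardE cardC1.
  move=> /(_ isT) H; suff : (q.-1 < (q.-1)./2.+1)%N.
    by rewrite ltnS -{1}q2; move: (_./2) g0 => k; lia.
  apply: H => //; apply/allP => x; rewrite mem_enum inE => x0.
  by rewrite rootE hornerD hornerN hornerXn hornerC h // subrr.
have a0 : a != 0.
  have g0 : (0 < (q.-1)./2)%N by have := @half_card_exp_gt0 1 isT; rewrite expn1.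
  apply/eqP => a0; have := aN; rewrite a0 expr0n gtn_eqF // => /eqP.
  by rewrite eq_sym oppr_eq0 oner_eq0.
pose tw (c : F) f := (f %/ D) * D + c *: (f %% D).
have tw_mod c f : (size (c *: (f %% D))%R <= (size D).-1)%N.
  apply: leq_trans (size_scale_leq _ _) _; rewrite -ltnS prednK ?size_poly_gt0 //.
  by rewrite ltn_modp.
have twK c c' f : c * c' = 1 -> tw c (tw c' f) = f.
  move=> cc; have lt : (size (c' *: (f %% D))%R < size D)%N.
    by rewrite (leq_ltn_trans (tw_mod _ _)) // ltn_predL size_poly_gt0.
  have dv : tw c' f %/ D = f %/ D by rewrite /tw divpD mulpK // (divp_small lt) addr0.
  have md : tw c' f %% D = c' *: (f %% D) by rewrite /tw modpD modp_mull add0r (modp_small lt).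
  by rewrite {1}/tw dv md scalerA cc scale1r -divp_eq.
have twm c f : f \in monics F n -> tw c f \in monics F n.
  rewrite !mem_monics => /andP[fm /eqP sf].
  have -> : tw c f = f + (c - 1) *: (f %% D).
    by rewrite /tw {3}(divp_eq f D) scalerBl scale1r addrACA subrr addr0.
  have lt : (size ((c - 1) *: (f %% D)) < size f)%N.
    by rewrite sf ltnS (leq_trans (tw_mod _ _)).
  by rewrite monicE lead_coefDl // -monicE fm size_polyDl // sf eqxx.
(* The characteristic is odd, so 0, 1 and -1 stay distinct in K and an identity between values of
   [chi] can be read off there. *)
have two0 : (2 : K) != 0.
  have [p pp pF] := finPcharP F; have pK := rmorph_pchar phi pF.
  have p2 : p != 2%N.
    apply/eqP => p2; have := card_pchar_nat (idfun : {rmorphism F -> F}) 1.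
    by rewrite expn1 (eq_pnat _ (pcharf_eq pF)) p2 => /p_natP[[|j] qE];
       move: (finNzRing_gt1 F) q_odd; rewrite qE // oddX.
  by rewrite -[2]/(2%:R) -(dvdn_pcharf pK) dvdn_prime2.
have chi_tw f : f \in monics F n -> chi D (tw a f) = - chi D f.
  move=> fn; have fn' := twm a _ fn; move: (fn) (fn').
  rewrite !mem_monics => /andP[fm /eqP sf] /andP[tm /eqP st].
  have E : ((chi D (tw a f))%:~R : K) = - (chi D f)%:~R.
    rewrite !chi_jacobi // sf st -mulrN; congr (_ * _); rewrite /jacobi_prod.
    rewrite (eq_big_seq (fun w => phi a * f^i.[w])) => [|w wr]; last first.
      have Dw : D^i.[w] = 0 by rewrite D_roots; apply/eqP; rewrite -rootE root_prod_XsubC.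
      by rewrite [in RHS](divp_eq f D) /tw !rmorphD !rmorphM /= map_polyZ !hornerE Dw !mulr0 !add0r.
    rewrite big_split /= big_const_seq count_predT iter_mulr_1 exprMn sr -exprM mulnC exprM -rmorphXn /=.
    by rewrite aN rmorphN1 -signr_odd oD mulN1r.
  have one0 : (1 : K) != 0 := oner_neq0 K.
  have one2 : (1 : K) != -1 by rewrite -subr_eq0 opprK.
  have := chi_range D fm; have := chi_range D tm; rewrite !inE.
  move=> /or3P[] /eqP e1 /or3P[] /eqP e2; move: E; rewrite e1 e2 //= => /eqP;
  by rewrite ?rmorph0 ?rmorphN1 ?rmorph1 ?oppr0 ?opprK ?[0 == _]eq_sym ?oppr_eq0 ?(negbTE one0) ?(negbTE one2) // eq_sym (negbTE one2).
have : coefL (chi D) n = - coefL (chi D) n.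
  rewrite {1}/coefL -(perm_big _ (_ : perm_eq [seq tw a f | f <- monics F n] _)) /=; last first.
    apply: uniq_perm; rewrite ?monics_uniq //.
      rewrite map_inj_in_uniq ?monics_uniq // => f g _ _ /(congr1 (tw a^-1)).
      by rewrite !twK ?mulVf.
    move=> f; apply/mapP/idP => [[g gn ->]|fn]; first exact: twm.
    by exists (tw a^-1 f); rewrite ?twm // twK ?mulfV.
  rewrite big_map -sumrN big_seq [RHS]big_seq; apply: eq_bigr => f fn.
  exact: chi_tw.
by move/eqP; rewrite -addr_eq0 -mulr2n mulrn_eq0 => /eqP.
Qed.
End Chi.

End EulerCriterion.

(** * Stepanov's method *)

Section Stepanov.
Variable F : finFieldType.
Variables (D : {poly F}) (m : nat).


Lemma size_nderivn (R : nzRingType) (p : {poly R}) i : (size p^`N(i) <= size p - i)%N.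
Proof.
apply/leq_sizeP => j hj; rewrite coef_nderivn nth_default ?mul0rn //.
by rewrite -leq_subLR.
Qed.

(* [taylor_shift p] is [p(X + D U)], a polynomial in [U] over [F[X]]. *)
Definition taylor_shift (p : {poly F}) : {poly {poly F}} :=
  (map_poly (polyC \o polyC) p).['X%:P + D%:P * 'X].

Lemma coef_taylor_shift p i : (taylor_shift p)`_i = p^`N(i) * D ^+ i.
Proof.
rewrite /taylor_shift nderiv_taylor; last exact: mulrC.
have -> : \sum_(j < size (map_poly (polyC \o polyC : F -> {poly {poly F}}) p))
    ((map_poly (polyC \o polyC) p)^`N(j)).['X%:P] * (D%:P * 'X) ^+ j
  = \poly_(j < size p) (p^`N(j) * D ^+ j).
  rewrite poly_def size_map_inj_poly ?rmorph0 //; last by move=> x y /polyC_inj/polyC_inj.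
  apply: eq_bigr => j _; rewrite nderivn_map map_poly_comp horner_map /=.
  rewrite -/(comp_poly 'X _) comp_polyXr exprMn -rmorphXn mulrA -polyCM.
  by rewrite mul_polyC.
rewrite coef_poly; case: ltnP => // h.
by rewrite nderivn_poly0 // mul0r.
Qed.

(** A filtration by the degree in X of the coefficient of U^i. In p(X + D U) each power of U brings
    a factor D, of degree m, and costs one derivative, hence the slope m - 1. *)
Definition weight_le n (p : {poly {poly F}}) := forall i, (size (p`_i)%R <= n + i * m.-1)%N.

Lemma weight_le_leq n n' p : (n <= n')%N -> weight_le n p -> weight_le n' p.
Proof. by move=> le w i; rewrite (leq_trans (w i)) // leq_add2r. Qed.

Lemma weight_leD n p p' : weight_le n p -> weight_le n p' -> weight_le n (p + p').
Proof. by move=> w w' i; rewrite coefD (leq_trans (size_polyD _ _)) // geq_max w w'. Qed.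

Lemma weight_le_sum n (I : finType) (G : I -> {poly {poly F}}) :
  (forall i, weight_le n (G i)) -> weight_le n (\sum_i G i).
Proof.
move=> w; apply: (big_ind (weight_le n)) => //; last exact: weight_leD.
by move=> i; rewrite coef0 size_poly0.
Qed.

Lemma weight_leM n n' p p' : weight_le n.+1 p -> weight_le n'.+1 p' ->
  weight_le (n + n').+1 (p * p').
Proof.
move=> w w' i; rewrite coefM; apply: (big_ind (fun r : {poly F} => (size r <= (n + n').+1 + i * m.-1)%N)).
- by rewrite size_poly0.
- by move=> x y hx hy; rewrite (leq_trans (size_polyD _ _)) // geq_max hx hy.
move=> j _; apply: leq_trans (size_polyMleq _ _) _.
have := w j; have := w' (i - j)%N; have ji : (j <= i)%N by rewrite -ltnS.
have -> : (i * m.-1 = j * m.-1 + (i - j) * m.-1)%N by rewrite -mulnDl subnKC.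
by move: (j * _)%N ((i - j) * _)%N (size (polyseq _)) (size (polyseq _)) => a b c d; lia.
Qed.

Lemma weight_le_exp p N : weight_le 1 p -> weight_le 1 (p ^+ N).
Proof.
move=> w; elim: N => [|N IH].
  by move=> i; rewrite expr0 coef1; case: eqP => _; rewrite ?size_poly1 ?size_poly0.
by rewrite exprS; exact: (@weight_leM 0 0).
Qed.

Hypotheses (D_monic : D \is monic) (size_D : size D = m.+1).

Lemma weight_le_taylor_shift n (p : {poly F}) : (size p <= n)%N -> weight_le n (taylor_shift p).
Proof.
move=> sp i; rewrite coef_taylor_shift; case: (ltnP i (size p)) => [ip|ip]; last first.
  by rewrite nderivn_poly0 // mul0r size_poly0.
have key (a b c d : nat) : (0 < b)%N -> b.-1 = (m * i)%N -> (a <= (c + b).-1)%N ->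
    (c <= d - i)%N -> (i < d)%N -> (d <= n)%N -> (a <= n + i * m.-1)%N.
  by case: m => [|m']; rewrite ?mulSn ?[(i * _)%N]mulnC /=; lia.
apply: key (size_polyMleq _ _) (size_nderivn p i) ip sp.
  by rewrite size_poly_gt0 monic_neq0 // monic_exp.
by rewrite size_exp size_D.
Qed.

(** The quotient of D(X + D U) by D(X). All its powers satisfy [weight_le 1], so the large exponent
    N does not enlarge the linear system. *)
Definition unit_part : {poly {poly F}} :=
  \poly_(i < size D) (if i is i'.+1 then D^`N(i) * D ^+ i' else 1).

Lemma taylor_shift_self : taylor_shift D = D%:P * unit_part.
Proof.
apply/polyP => i; rewrite coef_taylor_shift coefCM coef_poly.
case: ltnP => [_|h]; last by rewrite nderivn_poly0 // mul0r mulr0.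
by case: i => [|i]; rewrite ?nderivn0 ?mulr1 // exprS mulrCA.
Qed.

Lemma weight_le_unit_part : weight_le 1 unit_part.
Proof.
move=> [|i]; rewrite coef_poly size_D /=; first by rewrite size_poly1.
case: ltnP => [im|_]; last by rewrite size_poly0.
have key (a b c : nat) : (0 < b)%N -> b.-1 = (m * i)%N -> (a <= (c + b).-1)%N ->
    (c <= m.+1 - i.+1)%N -> (a <= 1 + i.+1 * m.-1)%N.
  by case: m im => [//|m'] im; rewrite !mulSn /= mulnC; lia.
apply: key (size_polyMleq _ _) _.
- by rewrite size_poly_gt0 monic_neq0 // monic_exp.
- by rewrite size_exp size_D.
by rewrite -size_D; exact: size_nderivn.
Qed.

End Stepanov.

(** * The auxiliary polynomial and its zeros of high order *)

Section StepanovMain.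
Variables (F : finFieldType) (K : closedFieldType) (phi : {rmorphism F -> K}).
Variables (D : {poly F}) (g k e J l : nat) (a : F).
Local Notation m := (2 * g).+1.
Hypotheses (D_monic : D \is monic) (size_D : size D = m.+1).
Local Notation q := #|F|.
Local Notation Q := (q ^ k)%N.
Local Notation "p ^i" := (map_poly phi p) (at level 2, format "p ^i").
Hypotheses (QE : Q = (2 * e + m)%N) (l_le : (l <= Q)%N) (a0 : a != 0) (e_gt0 : (0 < e)%N).
Local Notation B := (e + J + l * m.-1)%N.
Hypothesis unknowns_gt : (l * B < 2 * (J * e))%N.
Local Notation N := (Q.-1)./2.

(** A polynomial in X and X^Q, of degree below e in the first and below J in the second. A pair of
    them has 2 J e coefficients, to be compared with l B linear conditions. *)
Definition sparse (M : 'M[F]_(J, e)) : {poly F} :=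
  \sum_(j < J) rVpoly (row j M) * 'X^(j * Q).

Lemma e_lt_Q : (e < Q)%N. Proof. by rewrite QE; lia. Qed.

Lemma coef_sparse_neq0 M n : (sparse M)`_n != 0 -> (n %% Q < e)%N.
Proof.
rewrite /sparse coef_sum; apply: contraNT => he; rewrite big1 // => j _.
rewrite coefMXn; case: ltnP => // jn; rewrite nth_default //.
apply: leq_trans (size_poly _ _) _; apply: (@leq_trans (n %% Q)); first by rewrite leqNgt.
by rewrite -{1}(subnK jn) addnC modnMDl leq_mod.
Qed.

Lemma sparse_eq0 M : sparse M = 0 -> M = 0.
Proof.
move=> M0; apply/matrixP => j i; rewrite mxE.
have := congr1 (fun p : {poly F} => p`_(j * Q + i)%N) M0.
rewrite coef0 coef_sum (bigD1 j) //= coefMXn ltnNge leq_addr /= addKn coef_rVpoly_ord mxE.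
rewrite big1 ?addr0 // => j' jj'; rewrite coefMXn; case: ltnP => // le.
rewrite nth_default //; apply: leq_trans (size_poly _ _) _.
have eQ := e_lt_Q; have ie := ltn_ord i.
have lt : (j' < j)%N.
  rewrite ltn_neqAle; apply/andP; split; first by apply: contraNneq jj' => /val_inj ->.
  by rewrite leqNgt; apply/negP => jj; move: le jj eQ ie; move: Q (nat_of_ord i) (nat_of_ord j) (nat_of_ord j') => *; nia.
move: lt eQ; move: Q (nat_of_ord i) (nat_of_ord j) (nat_of_ord j') => *; nia.
Qed.

Lemma size_sparse M : (size (sparse M) <= J * Q)%N.
Proof.
apply: (leq_trans (size_sum _ _ _)); apply/bigmax_leqP => j _.
apply: leq_trans (size_polyMleq _ _) _; rewrite size_polyXn addnS /=.
have := size_poly e (fun i => if insub i is Some o then row j M 0 o else 0).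
rewrite -/(rVpoly (row j M)) => h; have jJ := ltn_ord j; have eQ := e_lt_Q.
apply: (@leq_trans (j.+1 * Q)%N); last by rewrite leq_mul2r jJ orbT.
by rewrite mulSn leq_add2r (leq_trans h) // ltnW.
Qed.

Definition stepanov_poly (M : 'M[F]_(J, e) * 'M[F]_(J, e)) : {poly F} :=
  sparse M.1 + D ^+ N * sparse M.2.

Lemma Q_odd : (N * 2 = Q.-1)%N.
Proof. by rewrite QE muln2 /=; lia. Qed.

(** Modulo Q the exponents occurring in [sparse] lie in [0, e). Since D^N has degree m N = g Q + e,
    the leading exponent of the second term falls in [e, 2e), so it cannot be cancelled. This is the
    reason for taking Q = 2e + m. *)
Lemma stepanov_poly_eq0 M : stepanov_poly M = 0 -> M = 0.
Proof.
case: M => M1 M2; rewrite /stepanov_poly /= => h0.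
have D0 := monic_neq0 D_monic.
have s20 : sparse M2 = 0.
  apply/eqP/negPn/negP => s2; pose n := (size (sparse M2)).-1.
  have n2 : (n %% Q < e)%N.
    by apply: (@coef_sparse_neq0 M2); rewrite -lead_coefE lead_coef_eq0.
  have DN : (D ^+ N) \is monic by rewrite monic_exp.
  have sDN : size (D ^+ N * sparse M2) = (m * N + n).+1.
    rewrite size_monicM // -(prednK (n := size (sparse M2))) ?size_poly_gt0 // -/n addnS /=.
    have := size_exp D N; rewrite size_D /= => <-.
    by rewrite -addSn prednK // size_poly_gt0 monic_neq0.
  have sE : sparse M1 = - (D ^+ N * sparse M2) by apply/eqP; rewrite -addr_eq0 h0.
  have n1 : ((m * N + n) %% Q < e)%N.
    apply: (@coef_sparse_neq0 M1); rewrite sE coefN oppr_eq0.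
    have -> : (m * N + n)%N = (size (D ^+ N * sparse M2)).-1 by rewrite sDN.
    by rewrite -lead_coefE lead_coef_eq0 mulf_neq0 // monic_neq0.
  have mN : (m * N = g * Q + e)%N by have := Q_odd; have := QE; nia.
  move: n1; rewrite mN -addnA modnMDl -modnDmr modn_small; first by rewrite ltnNge leq_addr.
  by rewrite QE; move: n2; rewrite QE; lia.
by move: h0; rewrite s20 mulr0 addr0 => /sparse_eq0 ->; rewrite (sparse_eq0 s20).
Qed.

Lemma size_stepanov_poly M : (size (stepanov_poly M) <= m * N + J * Q + 1)%N.
Proof.
rewrite (leq_trans (size_polyD _ _)) // geq_max; apply/andP; split.
  by rewrite (leq_trans (size_sparse _)) // addnAC leq_addl.
rewrite (leq_trans (size_polyMleq _ _)) //.
have := size_sparse M.2; have := size_exp D N; rewrite size_D /=.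
have : (0 < size (D ^+ N))%N by rewrite size_poly_gt0 monic_neq0 // monic_exp.
by move: (size _) (size _) (m * N)%N (J * Q)%N => x y u v; lia.
Qed.

(* The part of the Taylor expansion of [stepanov_poly M] at a point [b] with
   [b ^+ Q = b] and [D(b) ^+ N = a] that does not involve [U ^+ Q], with [b]
   kept as a variable. *)
Definition condition (M : 'M[F]_(J, e) * 'M[F]_(J, e)) : {poly {poly F}} :=
  \sum_(j < J) (taylor_shift D (rVpoly (row j M.1))
     + a%:P%:P * taylor_shift D (rVpoly (row j M.2)) * unit_part D ^+ N) * ('X^j)%:P.

Lemma size_rVpoly_row (M : 'M[F]_(J, e)) j : (size (rVpoly (row j M)) <= e)%N.
Proof. exact: size_poly. Qed.

Lemma conditionB M M' : condition (M - M') = condition M - condition M'.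
Proof.
rewrite /condition -sumrB; apply: eq_bigr => j _.
have tB p r : taylor_shift D (p - r) = taylor_shift D p - taylor_shift D r.
  by rewrite /taylor_shift rmorphB hornerD hornerN.
have -> : (M - M').1 = M.1 - M'.1 by [].
have -> : (M - M').2 = M.2 - M'.2 by [].
have rB (A A' : 'M[F]_(J, e)) : rVpoly (row j (A - A')) = rVpoly (row j A) - rVpoly (row j A').
  by rewrite linearB /= linearB.
by rewrite !rB !tB -mulrBl; congr (_ * _); ring.
Qed.

Lemma weight_le_condition M : weight_le m (e + J) (condition M).
Proof.
apply: weight_le_sum => j; apply: (@weight_le_leq _ _ (e.-1 + j).+1).
  by have := ltn_ord j; move: (nat_of_ord j) e_gt0 => i; lia.
have wT (p : {poly F}) : (size p <= e)%N -> weight_le m e.-1.+1 (taylor_shift D p).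
  by move=> sp; rewrite prednK //; apply: weight_le_taylor_shift.
apply: weight_leM; last first.
  move=> [|i]; rewrite coefC /= ?size_poly0 // size_polyXn //.
  by rewrite mul0n addn0.
apply: weight_leD; first by apply: wT; exact: size_rVpoly_row.
rewrite -[e.-1]addn0; apply: weight_leM; last first.
  by apply: weight_le_exp; exact: (weight_le_unit_part D_monic size_D).
rewrite -[e.-1]add0n; apply: weight_leM; last by apply: wT; exact: size_rVpoly_row.
move=> [|i]; rewrite coefC /= ?size_poly0 //.
by rewrite (leq_trans (size_polyC_leq1 _)).
Qed.

(** Pigeonhole over the finite field: two pairs of matrices have the same conditions, and their
    difference is a solution. *)
Lemma exists_stepanov_poly :
  exists M, M <> 0 /\ forall i, (i < l)%N -> (condition M)`_i = 0.
Proof.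
pose f M : 'M[F]_(l, B) := \matrix_(i, b) ((condition M)`_i)`_b.
have : ~ injective f.
  move=> /leq_card; rewrite card_prod !card_mx -expnD leqNgt.
  rewrite ltn_exp2l ?finNzRing_gt1 //.
  by rewrite addnn -mul2n unknowns_gt.
move=> /existsNP[M /existsNP[M' /not_implyP[fM /eqP MM']]].
exists (M - M'); split; first by apply/eqP; rewrite subr_eq0.
move=> i il; apply/polyP => b; rewrite coef0; case: (ltnP b B) => bB; last first.
  rewrite nth_default // (leq_trans _ bB) // (leq_trans (weight_le_condition _ _)) //.
  by rewrite leq_add2l leq_mul2r ltnW // orbT.
have := congr1 (fun A : 'M[F]_(l, B) => A (Ordinal il) (Ordinal bB)) fM.
by rewrite !mxE /= conditionB !coefB => ->; rewrite subrr.
Qed.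

Section Vanishing.
Variables (M : 'M[F]_(J, e) * 'M[F]_(J, e)) (b : K).
Hypotheses (cM : forall i, (i < l)%N -> (condition M)`_i = 0).
Hypotheses (bQ : b ^+ Q = b) (bD : D^i.[b] ^+ N = phi a).

Let c := D^i.[b].
Let t : {poly K} := b%:P + c *: 'X.
Let ev : {rmorphism {poly {poly F}} -> {poly K}} :=
  map_poly (horner_eval b \o map_poly phi).

Lemma c_neq0 : c != 0.
Proof.
apply/eqP => c0; have := bD; rewrite -/c c0 expr0n.
have -> : (N == 0)%N = false by apply/negbTE; have := QE; have := e_gt0; lia.
by move/eqP; rewrite eq_sym fmorph_eq0 (negbTE a0).
Qed.

Lemma ev_taylor_shift p : ev (taylor_shift D p) = p^i \Po t.
Proof.
rewrite /taylor_shift -horner_map /=.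
have -> : ev ('X%:P + D%:P * 'X) = t.
  rewrite /ev rmorphD rmorphM /= !map_polyC map_polyX /= !horner_evalE map_polyX hornerX.
  by rewrite mul_polyC.
rewrite /comp_poly -map_poly_comp -[in RHS]map_poly_comp; congr (_.[_]).
apply: eq_map_poly => x /=.
by rewrite map_polyC /= horner_evalE map_polyC hornerC.
Qed.

(** Put X = b + c U with c = D(b). Then X^Q = b + c^Q U^Q is congruent to b modulo U^l because l <=
    Q, and D^N becomes a times the N-th power of the unit part. So the polynomial agrees modulo U^l
    with the condition evaluated at b. *)
Lemma dvdp_Xl_comp : 'X^l %| (stepanov_poly M)^i \Po t.
Proof.
have tQ : t ^+ Q = b%:P + (c ^+ Q) *: 'X^Q.
  rewrite /t (exprDn_pchar _ _ (card_pchar_nat (polyC \o phi : {rmorphism F -> {poly K}}) k)).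
  by rewrite -rmorphXn /= bQ exprZn.
pose E := ev (unit_part D).
have DE : D^i \Po t = c *: E.
  rewrite -ev_taylor_shift taylor_shift_self rmorphM /= map_polyC /= horner_evalE.
  by rewrite mul_polyC.
have evc : ev (condition M) = \sum_(j < J) ((rVpoly (row j M.1))^i \Po t
    + (phi a)%:P * ((rVpoly (row j M.2))^i \Po t) * E ^+ N) * (b ^+ j)%:P.
  rewrite /condition rmorph_sum; apply: eq_bigr => j _.
  rewrite rmorphM rmorphD !rmorphM rmorphXn !ev_taylor_shift -/E.
  rewrite /ev /= !map_polyC /= !horner_evalE map_polyC map_polyXn hornerXn.
  by rewrite hornerC.
have d1 : 'X^l %| ev (condition M).
  rewrite -[ev _](poly_take_drop l) (_ : take_poly l _ = 0) ?add0r ?dvdp_mull //.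
  apply/polyP => i; rewrite coef0 coef_take_poly; case: ltnP => // il.
  by rewrite coef_map cM //= horner_evalE map_poly0 horner0.
have cE : (stepanov_poly M)^i \Po t = \sum_(j < J) ((rVpoly (row j M.1))^i \Po t
    + (phi a)%:P * ((rVpoly (row j M.2))^i \Po t) * E ^+ N) * (t ^+ Q) ^+ j.
  have compM (p r : {poly K}) : (p * r) \Po t = (p \Po t) * (r \Po t) by exact: rmorphM.
  have compS (G : 'I_J -> {poly K}) : (\sum_j G j) \Po t = \sum_j (G j \Po t) by exact: rmorph_sum.
  rewrite /stepanov_poly /sparse rmorphD rmorphM rmorphXn !rmorph_sum /= comp_polyD compM !compS.
  have -> : (D^i ^+ N) \Po t = (phi a)%:P * E ^+ N.
    by rewrite -[LHS]/(comp_poly t (D^i ^+ N)) rmorphXn /= DE exprZn bD -mul_polyC.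
  rewrite mulr_sumr -big_split /=; apply: eq_bigr => j _.
  rewrite !rmorphM /= !map_polyXn !comp_Xn_poly mulnC exprM.
  by ring.
rewrite -[X in _ %| X](subrK (ev (condition M))) dvdp_add // cE evc -sumrB.
apply: (big_ind (fun p : {poly K} => 'X^l %| p)) => [||j _]; first exact: dvdp0.
  exact: dvdp_add.
rewrite -mulrBr dvdp_mull //.
rewrite rmorphXn /= subrXX dvdp_mulr // tQ addrC addKr.
by rewrite dvdpZr ?expf_neq0 ?c_neq0 // dvdp_exp2l.
Qed.

Lemma dvdp_XsubC_exp : ('X - b%:P) ^+ l %| (stepanov_poly M)^i.
Proof.
pose s : {poly K} := c^-1 *: ('X - b%:P).
have ts : t \Po s = 'X.
  rewrite /t comp_polyD comp_polyC comp_polyZ comp_polyX /s scalerA.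
  by rewrite mulfV ?c_neq0 // scale1r addrC subrK.
have /dvdpP[w wE] := dvdp_Xl_comp.
have := congr1 (fun p => p \Po s) wE.
rewrite /= -comp_polyA ts comp_polyXr comp_polyM comp_Xn_poly /s exprZn => ->.
by rewrite dvdp_mull // dvdpZr // expf_neq0 // invr_eq0 c_neq0.
Qed.
End Vanishing.

Lemma stepanov (s : seq K) : uniq s ->
  (forall b, b \in s -> b ^+ Q = b /\ D^i.[b] ^+ N = phi a) ->
  (l * size s <= m * N + J * Q)%N.
Proof.
move=> us hs; have [M [M0 cM]] := exists_stepanov_poly.
have h0 : (stepanov_poly M)^i != 0.
  by rewrite map_poly_eq0; apply/eqP => /stepanov_poly_eq0.
have dv : \prod_(b <- s) ('X - b%:P) ^+ l %| (stepanov_poly M)^i.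
  have {}hs b : b \in s -> ('X - b%:P) ^+ l %| (stepanov_poly M)^i.
    by move=> /hs[bQ bD]; apply: dvdp_XsubC_exp.
  elim: s us hs => [|b s IH] /=; first by rewrite big_nil dvd1p.
  move=> /andP[bs us] hs; rewrite big_cons Gauss_dvdp.
    rewrite hs ?mem_head // IH // => b' b's; apply: hs.
    by rewrite inE b's orbT.
  rewrite big_seq; apply: (big_ind (fun p => coprimep (('X - b%:P) ^+ l) p)).
  - exact: coprimep1.
  - by move=> x y; rewrite coprimepMr => -> ->.
  move=> b' b's; apply/coprimep_expl/coprimep_expr.
  by rewrite coprimep_XsubC root_XsubC; apply: contraNneq bs => <-.
have := dvdp_leq h0 dv; rewrite size_map_poly.
have -> : size (\prod_(b <- s) ('X - b%:P) ^+ l) = (l * size s).+1.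
  rewrite prodrXl; have := size_exp (\prod_(b <- s) ('X - b%:P)) l.
  rewrite size_prod_XsubC /= mulnC => <-.
  by rewrite prednK // size_poly_gt0 monic_neq0 // monic_exp // monic_prod_XsubC.
have := size_stepanov_poly M.
by move: (l * _)%N (m * N)%N (J * Q)%N (size (polyseq _)) => u v w x; lia.
Qed.

End StepanovMain.

(** * The bound for the prime sums of the character *)

Section WeilBound.
Variables (F : finFieldType).
Hypothesis q_odd : odd #|F|.
Local Notation q := #|F|.

(** Distinct primes have disjoint sets of roots, each with as many elements as the degree, so a sum
    of degrees becomes a number of points. *)
Lemma roots_of_primes (K : closedFieldType) (phi : {rmorphism F -> K}) (ps : seq {poly F}) :
  uniq ps -> (forall P, P \in ps -> monic_irreducible_poly P) ->
  exists s : seq K, [/\ uniq s, size s = (\sum_(P <- ps) (size P).-1)%N &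
    forall b, b \in s -> exists2 P, P \in ps & root (map_poly phi P) b].
Proof.
elim: ps => [|P ps IH] /=; first by exists [::]; rewrite big_nil.
move=> /andP[nP ups] hps; have [|s [us ss hs]] := IH ups.
  by move=> P' h; apply: hps; rewrite inE h orbT.
have hP : monic_irreducible_poly P by apply: hps; rewrite mem_head.
have [b Pb] : exists b, root (map_poly phi P) b.
  by apply/closed_rootP; rewrite size_map_poly gtn_eqF // hP.1.1.
have cr c : c \in [seq b ^+ (q ^ i) | i <- iota 0 (size P).-1] -> root (map_poly phi P) c.
  move=> /mapP[i _ ->]; rewrite rootE -horner_frob (eqP Pb) expr0n gtn_eqF //.
  by rewrite expn_gt0 ltnW // finNzRing_gt1.
exists ([seq b ^+ (q ^ i) | i <- iota 0 (size P).-1] ++ s); split.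
- rewrite cat_uniq (conjugates_uniq hP Pb) us andbT /=.
  apply/hasPn => c /hs[P' P's P'c]; apply/negP => /cr Pc.
  have hP' : monic_irreducible_poly P' by apply: hps; rewrite inE P's orbT.
  have PP' : P %| P' by rewrite -(mip_root_dvdp hP Pc).
  have /eqP e : P == P'.
    by rewrite -eqp_monic ?hP.2 ?hP'.2 // hP'.1.2 // gtn_eqF // hP.1.1.
  by move: nP; rewrite e P's.
- by rewrite size_cat size_map size_iota big_cons ss.
move=> c; rewrite mem_cat => /orP[/cr Pc|/hs[P' h P'c]].
  by exists P; rewrite ?mem_head.
by exists P'; rewrite // inE h orbT.
Qed.

Lemma odd_geom_sum n r : odd n -> odd (\sum_(i < r) n ^ i) = odd r.
Proof.
move=> on; elim: r => [|r IH]; first by rewrite big_ord0.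
by rewrite big_ord_recr /= oddD IH oddX on orbT addbT.
Qed.

Lemma half_pred_exp n r : odd n ->
  (((n ^ r).-1)./2 = (n.-1)./2 * \sum_(i < r) n ^ i)%N.
Proof.
move=> on; have D2 j : odd j -> (j.-1)./2.*2 = j.-1.
  by case: j => //= j /negbTE oj; rewrite -[RHS]odd_double_half oj.
by apply: double_inj; rewrite doubleMl !D2 ?predn_exp // oddX on orbT.
Qed.

Lemma exp_sign_odd (R : nzRingType) (x : int) (a b : nat) :
  x \in [:: 1; -1] -> odd a = odd b -> (x%:~R : R) ^+ a = (x ^+ b)%:~R.
Proof.
rewrite !inE => /orP[] /eqP -> ab; first by rewrite !expr1n.
by rewrite rmorphXn rmorphN1 -signr_odd ab signr_odd.
Qed.

Variables (D : {poly F}) (g : nat).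
Local Notation m := (2 * g).+1.
Hypotheses (D_monic : D \is monic) (size_D : size D = m.+1).

(** For k > 0, the number of elements of the field with q^k elements at which the quadratic
    character of D is x, grouped by minimal polynomial. *)
Definition prime_weight k (x : int) : nat :=
  (\sum_(P <- primes_le F k.+1 | deg_dvd k P && (chi D P ^+ (k %/ (size P).-1) == x)) (size P).-1)%N.

Lemma prime_weight_le_aux (K : closedFieldType) (phi : {rmorphism F -> K}) k x : (0 < k)%N ->
  exists s : seq K, [/\ uniq s, size s = prime_weight k x & forall b, b \in s ->
    exists P, [/\ monic_irreducible_poly P, root (map_poly phi P) b, deg_dvd k P,
      (0 < k %/ (size P).-1)%N & legendre D P ^+ (k %/ (size P).-1) = x]].
Proof.
move=> k0; pose ps := [seq P <- primes_le F k.+1 | deg_dvd k P && (chi D P ^+ (k %/ (size P).-1) == x)].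
have [||s [us ss hs]] := @roots_of_primes K phi ps.
- by apply: filter_uniq; exact: primes_le_uniq.
- by move=> P; rewrite mem_filter mem_primes_le => /andP[_ /andP[/asboolP]].
exists s; split=> //; first by rewrite ss big_filter.
move=> b /hs[P]; rewrite mem_filter mem_primes_le.
move=> /andP[/andP[dP /eqP xE] /andP[/asboolP hP _]] Pb.
exists P; split=> //; last by rewrite -chi_prime.
have d0 : (0 < (size P).-1)%N by have := hP.1.1; case: size => [|[]].
by rewrite divn_gt0 // dvdn_leq.
Qed.

Lemma prime_weight_stepanov k (x : int) : x \in [:: 1; -1] -> (0 < k)%N ->
  (5 * m <= q ^ k)%N ->
  (2 * prime_weight (2 * k) x <= q ^ (2 * k) + 5 * m * q ^ k)%N.
Proof.
move=> xpm k0 mk.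
have [K [phi _]] := countable_algebraic_closure F.
have k20 : (0 < 2 * k)%N by rewrite muln_gt0.
have [s [us ss hs]] := @prime_weight_le_aux K phi (2 * k) x k20.
set S := (q ^ k)%N in mk *; pose Q := (q ^ (2 * k))%N.
have QE : Q = (S * S)%N by rewrite /Q mul2n -addnn expnD.
pose e := (Q.-1./2 - g)%N.
have Qo : odd Q by rewrite oddX q_odd orbT.
have Qe : Q = (2 * e + m)%N.
  have : (m <= Q)%N by rewrite QE; nia.
  have : Q = (Q.-1./2 * 2).+1.
    by rewrite muln2; have := half_card_exp q_odd (2 * k); rewrite -/Q => ->; rewrite prednK // QE; nia.
  by rewrite /e; lia.
have a0 : (x%:~R : F) != 0.
  by move: xpm; rewrite !inE => /orP[] /eqP ->; rewrite ?rmorph1 ?rmorphN1 ?oppr_eq0 oner_neq0.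
have e0 : (0 < e)%N by move: Qe; rewrite QE; nia.
(* With S = q^k the order is l = 2S, and J exceeds l / 2 by 4m to pay for the l^2 (m - 1) additional
   conditions; 5m <= S leaves enough room. Dividing l |s| <= m N + J Q by S gives the claim. *)
have := @stepanov F K phi D g (2 * k) e (S + 4 * m) (2 * S) x%:~R D_monic size_D Qe _ a0 e0 _ s us _.
rewrite -/Q ss.
have h1 : (2 * S <= Q)%N by rewrite QE; nia.
have h2 : (2 * S * (e + (S + 4 * m) + 2 * S * m.-1) < 2 * ((S + 4 * m) * e))%N.
  have : (2 * e + m = S * S)%N by rewrite -QE.
  rewrite /= => E; have : (8 * m * e = 4 * m * (S * S) - 4 * m * m)%N by rewrite -E; nia.
  nia.
have h3 b : b \in s -> b ^+ (q ^ (2 * k)) = b /\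
    (map_poly phi D).[b] ^+ ((q ^ (2 * k)).-1)./2 = phi x%:~R.
  move=> /hs[P [hP Pb dP r0 xE]]; split; first exact: (mip_root_frob_dvd hP Pb dP).
  have lpm : legendre D P \in [:: 1; -1].
    have := legendre_range D P; rewrite !inE => /or3P[] /eqP lE; rewrite lE //.
    by move: xpm; rewrite -xE lE expr0n gtn_eqF.
  have qd : odd (q ^ (size P).-1) by rewrite oddX q_odd orbT.
  (* With d the degree of P and r = 2k / d, the exponent is (q^d - 1) / 2 times a sum of r odd
     terms, which has the parity of r. So D(b) is sent to the r-th power of the Legendre symbol. *)
  rewrite -(divnK dP) mulnC expnM half_pred_exp // exprM -(euler_criterion q_odd D hP Pb).
  by rewrite (@exp_sign_odd _ _ _ (2 * k %/ (size P).-1)) ?odd_geom_sum // xE rmorph_int.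
move=> /(_ h1 h2 h3); rewrite -/Q.
have : (Q.-1./2 * 2 <= Q)%N by lia.
move: (prime_weight _ _) => w.
have S0 : (0 < S)%N by lia.
rewrite QE => h4 h5; rewrite -(leq_pmul2l S0); nia.
Qed.

(** The primes counted here divide D, so their roots are roots of D. *)
Lemma prime_weight0_le k : (0 < k)%N -> (prime_weight k 0 <= m)%N.
Proof.
move=> k0; have [K [phi _]] := countable_algebraic_closure F.
have [s [us <- hs]] := @prime_weight_le_aux K phi k 0 k0.
rewrite -ltnS -size_D -(size_map_poly phi); apply: max_poly_roots => //.
  by rewrite map_poly_eq0 monic_neq0.
apply/allP => b /hs[P [hP Pb dP r0 /eqP]].
rewrite expf_eq0 r0 /= /legendre (mip_root_dvdp hP Pb).
by case: ifP => // _; case: ifP.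
Qed.

Lemma coefLambda_chi_split k : (0 < k)%N ->
  coefLambda (chi D) k = (prime_weight k 1)%:R - (prime_weight k (-1))%:R /\
  (prime_weight k 0 + prime_weight k 1 + prime_weight k (-1) = q ^ k)%N.
Proof.
move=> k0.
have chi3 (P : {poly F}) : P \in primes_le F k.+1 ->
    chi D P ^+ (k %/ (size P).-1) \in [:: 0; 1; -1].
  rewrite mem_primes_le => /andP[/asboolP hP _].
  move: (chi_range D hP.2); rewrite !inE => /or3P[] /eqP ->.
  - by rewrite expr0n; case: (_ %/ _ == _)%N; rewrite ?eqxx ?orbT.
  - by rewrite expr1n eqxx orbT.
  by rewrite -signr_odd; case: odd; rewrite ?expr0 ?expr1 ?eqxx ?orbT.
have pw x : (prime_weight k x = \sum_(P <- primes_le F k.+1 | deg_dvd k P)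
   (if chi D P ^+ (k %/ (size P).-1) == x then (size P).-1 else 0))%N.
  by rewrite /prime_weight big_mkcondr.
split.
  rewrite coefLambdaE //; [|exact: chi1|by move=> f h fm hm; apply: chiM; rewrite ?monic_neq0].
  rewrite !pw !natr_sum -sumrB big_seq_cond [RHS]big_seq_cond; apply: eq_bigr => P /andP[/chi3].
  by rewrite !inE => /or3P[] /eqP -> _; rewrite /= ?mulr0 ?mulr1 ?mulrN1 ?subr0 ?sub0r.
rewrite -sum_prime_deg // !pw -!big_split /= big_seq_cond [RHS]big_seq_cond.
apply: eq_bigr => P /andP[/chi3].
by rewrite !inE => /or3P[] /eqP -> _ /=; rewrite ?addn0.
Qed.

(** Stepanov's method bounds each sign from above only. Since the weights of 0, 1 and -1 add up to
    q^(2k), an upper bound for one sign is a lower bound for the other. *)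
Lemma coefLambda_chi_bound k : (0 < k)%N -> (5 * m <= q ^ k)%N ->
  `|coefLambda (chi D) (2 * k)| <= (6 * m * q ^ k)%:R.
Proof.
move=> k0 mk; have k20 : (0 < 2 * k)%N by rewrite muln_gt0.
have [-> E] := coefLambda_chi_split k20.
have := @prime_weight_stepanov k 1 isT k0 mk; have := @prime_weight_stepanov k (-1) isT k0 mk.
have := prime_weight0_le k20; move: E.
move: (prime_weight _ 0) (prime_weight _ 1) (prime_weight _ (-1)) (q ^ (2 * k))%N => a b c Q.
have : (5 * m * q ^ k + m <= 6 * m * q ^ k)%N by nia.
move: (5 * m * q ^ k)%N (6 * m * q ^ k)%N => u v; rewrite ler_norml; lia.
Qed.

Lemma coefL_chi_vanish n : (m <= n)%N -> coefL (chi D) n = 0.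
Proof.
move=> mn; have [K [phi _]] := countable_algebraic_closure F.
have [r rE] := closed_field_poly_normal (map_poly phi D).
apply: (@coefL_chi_eq0 F K phi q_odd D r); rewrite ?size_D //=; last by rewrite oddM.
by rewrite rE lead_coef_map (eqP D_monic) rmorph1 scale1r.
Qed.

End WeilBound.

(** * Power sums of the inverse zeros *)

Section PowerSums.
Variable C : numFieldType.
Implicit Types (al : seq C) (p : {poly C}).

Definition power_sum al k : C := \sum_(x <- al) x ^+ k.
Definition recip_poly al : {poly C} := \prod_(x <- al) (1 - x *: 'X).

(** For L = [recip_poly al], the expansion of - X L' / L in power sums, truncated after degree N. *)
Lemma recip_poly_logderiv al N : exists w : {poly C},
  'X * (recip_poly al)^`() + recip_poly al * (\sum_(1 <= k < N.+1) power_sum al k *: 'X^k)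
  = 'X^(N.+1) * w.
Proof.
elim: al => [|x al [w IH]].
  exists 0; rewrite /recip_poly big_nil derivC mulr0 add0r mul1r mulr0.
  by apply: big1 => k _; rewrite /power_sum big_nil scale0r.
have geom : (1 - x *: 'X) * (\sum_(1 <= k < N.+1) x ^+ k *: 'X^k) = x *: 'X - (x *: 'X) ^+ N.+1.
  elim: {w IH} N => [|N IH]; first by rewrite big_geq // mulr0 expr1 subrr.
  rewrite big_nat_recr //= mulrDr IH -exprZn mulrBl mul1r -exprS addrA subrK //.
exists ((1 - x *: 'X) * w - recip_poly al * (x ^+ N.+1)%:P).
have -> : recip_poly (x :: al) = (1 - x *: 'X) * recip_poly al by rewrite /recip_poly big_cons.
have -> : \sum_(1 <= k < N.+1) power_sum (x :: al) k *: 'X^k =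
    \sum_(1 <= k < N.+1) x ^+ k *: 'X^k + \sum_(1 <= k < N.+1) power_sum al k *: 'X^k.
  by rewrite -big_split /=; apply: eq_bigr => k _; rewrite -scalerDl /power_sum big_cons.
rewrite derivM derivB derivC derivZ derivX sub0r.
move: IH geom; set L := recip_poly al; set T := \sum_(_ <= _ < _) power_sum _ _ *: _.
set G := \sum_(_ <= _ < _) _; set L' := L^`() => IH geom.
transitivity ((1 - x *: 'X) * ('X * L' + L * T) + L * ((1 - x *: 'X) * G - x *: 'X)).
  by rewrite -!mul_polyC; ring.
by rewrite IH geom exprZn -!mul_polyC; ring.
Qed.

(** Newton's identities: as A_0 = 1 the recurrence determines the c_k, and the opposites of the
    power sums satisfy it. *)
Lemma newton_unique al (A c : nat -> C) : A 0%N = 1 ->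
  (forall n, n%:R * A n = \sum_(1 <= k < n.+1) c k * A (n - k)%N) ->
  (forall n, A n = (recip_poly al)`_n) ->
  forall k, (0 < k)%N -> c k = - power_sum al k.
Proof.
move=> A0 Ac AE k; have [n] := ubnP k; elim: n k => // n IH k kn k0.
have [w /(congr1 (fun p : {poly C} => p`_k))] := recip_poly_logderiv al k.
rewrite coefXnM ltnS leqnn coefD coefXM gtn_eqF // coef_deriv prednK // -AE -mulr_natl Ac.
rewrite mulrC coefM => /eqP; rewrite addr_eq0 => /eqP.
have -> : \sum_(i < k.+1) (\sum_(1 <= j < k.+1) power_sum al j *: 'X^j)`_i * (recip_poly al)`_(k - i)
   = \sum_(1 <= i < k.+1) power_sum al i * A (k - i)%N.
  rewrite -(big_mkord xpredT (fun i => (\sum_(1 <= j < k.+1) power_sum al j *: 'X^j)`_i * (recip_poly al)`_(k - i))).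
  have cE i : (\sum_(1 <= j < k.+1) power_sum al j *: 'X^j)`_i = if (0 < i < k.+1)%N then power_sum al i else 0.
    rewrite coef_sum; case: ifP => [ik|nik].
      rewrite (bigD1_seq i) ?mem_index_iota ?iota_uniq //= coefZ coefXn eqxx mulr1 big1 ?addr0 // => j ji.
      by rewrite coefZ coefXn eq_sym (negbTE ji) mulr0.
    rewrite big1_seq // => j /andP[_]; rewrite mem_index_iota => jk.
    rewrite coefZ coefXn; case: eqVneq => [e|_]; last by rewrite mulr0.
    by move: nik; rewrite e jk.
  rewrite big_ltn // cE /= mul0r add0r big_nat [RHS]big_nat; apply: eq_bigr => i ik.
  by rewrite cE ik AE.
rewrite !big_nat_recr //= subnn A0 !mulr1 -sumrN big_nat.
rewrite (eq_bigr (fun i => - (power_sum al i * A (k - i)%N))); last first.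
  move=> i /andP[i0 ik]; rewrite IH ?mulNr //; exact: leq_trans ik _.
by rewrite -big_nat opprD -sumrN => /addrI ->; rewrite /power_sum sumrN.
Qed.

End PowerSums.

Lemma recip_poly_factor (C : closedFieldType) (p : {poly C}) : p`_0 = 1 ->
  exists al : seq C, size al = (size p).-1 /\ p = \prod_(x <- al) (1 - x *: 'X).
Proof.
move=> p0; have [r rE] := closed_field_poly_normal p.
have lc0 : lead_coef p != 0.
  by rewrite lead_coef_eq0; apply: contra_eq_neq p0 => ->; rewrite coef0 eq_sym oner_neq0.
exists [seq z^-1 | z <- r]; split.
  by rewrite size_map rE size_scale // size_prod_XsubC.
have r0 z : z \in r -> z != 0.
  move=> zr; apply: contra_eq_neq p0 => z0; rewrite -horner_coef0 rE hornerZ.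
  suff -> : (\prod_(z <- r) ('X - z%:P)).[0] = 0 by rewrite mulr0 eq_sym oner_neq0.
  by apply/eqP; rewrite -rootE root_prod_XsubC -z0.
have E : \prod_(z <- r) ('X - z%:P) = (\prod_(z <- r) (- z)) *: \prod_(x <- [seq z^-1 | z <- r]) (1 - x *: 'X).
  rewrite big_map -mul_polyC rmorph_prod -big_split /=.
  rewrite big_seq [RHS]big_seq; apply: eq_bigr => z zr.
  by rewrite mul_polyC scalerBr scalerA mulNr mulfV ?r0 // scaleN1r opprK alg_polyC polyCN addrC.
have e1 : lead_coef p * \prod_(z <- r) (- z) = 1.
  rewrite -[RHS]p0 -[in RHS]horner_coef0 [in RHS]rE hornerZ horner_prod; congr (_ * _).
  by apply: eq_bigr => z _; rewrite hornerXsubC sub0r.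
by rewrite {1}rE E scalerA e1 scale1r.
Qed.

Lemma bernoulli_le (R : realDomainType) (x : R) n : 0 <= x -> 1 + n%:R * x <= (1 + x) ^+ n.
Proof.
move=> x0; elim: n => [|n IH]; first by rewrite mul0r addr0 expr0.
rewrite exprS; apply: le_trans (ler_wpM2l _ IH); last by rewrite addr_ge0.
have -> : (1 + x) * (1 + n%:R * x) = 1 + n.+1%:R * x + n%:R * x * x by rewrite -natr1; ring.
by rewrite lerDl !mulr_ge0.
Qed.

Lemma exp_domination (R : archiRealFieldType) (x rho c B : R) k0 : 0 < rho -> 0 < c ->
  (forall k, (k0 <= k)%N -> c * x ^+ k <= B * rho ^+ k) -> x <= rho.
Proof.
move=> rho0 c0 H; rewrite leNgt; apply/negP => xrho.
pose y := x / rho - 1.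
have y0 : 0 < y by rewrite subr_gt0 ltr_pdivlMr // mul1r.
have yE : x = (1 + y) * rho by rewrite /y subrKC divfK // gt_eqF.
have Hy k : (k0 <= k)%N -> c * (1 + k%:R * y) <= B.
  move=> /H; rewrite yE exprMn mulrA ler_pM2r ?exprn_gt0 //; apply: le_trans.
  by rewrite ler_pM2l // bernoulli_le // ltW.
pose k := (k0 + Num.bound (B / (c * y)))%N.
have := Hy k (leq_addr _ _); apply/negP; rewrite -ltNge.
have : B / (c * y) < k%:R.
  have [B0|B0] := leP 0 (B / (c * y)); last by apply: lt_le_trans B0 _.
  by rewrite (lt_le_trans (archi_boundP B0)) // ler_nat leq_addl.
rewrite ltr_pdivrMr ?mulr_gt0 // => h; apply: lt_trans h _.
have -> : c * (1 + k%:R * y) = k%:R * (c * y) + c by ring.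
by rewrite ltrDl.
Qed.

Section RootBound.
Variable R : realType.
Local Notation C := R[i]%C.

(** Weighting the even power sums with the coefficients of a polynomial Q that vanishes at the other
    squares leaves b^k Q(b), times a positive multiplicity. This isolates b = x^2, and
    [exp_domination] compares the growth rates. *)
Lemma power_sum_bound (al : seq C) (B rho : R) k0 : 0 < rho ->
  (forall k, (k0 <= k)%N -> `|power_sum al (2 * k)| <= (B * rho ^+ k)%:C%C) ->
  forall x, x \in al -> `|x| ^+ 2 <= rho%:C%C.
Proof.
move=> rho0 H x xal; pose s := [seq y ^+ 2 | y <- al]; pose b := x ^+ 2.
have bs : b \in s by apply/mapP; exists x.
pose Q : {poly C} := \prod_(y <- [seq y <- undup s | y != b]) ('X - y%:P).
have Qb : Q.[b] != 0.
  by rewrite -rootE root_prod_XsubC mem_filter eqxx.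
have Qy y : y \in s -> y != b -> Q.[y] = 0.
  move=> ys yb; apply/eqP; rewrite -rootE root_prod_XsubC mem_filter yb mem_undup //.
have key k : \sum_(i < size Q) Q`_i * power_sum al (2 * (k + i)) = (b ^+ k * Q.[b]) *+ count_mem b s.
  have psE j : power_sum al (2 * j) = \sum_(y <- s) y ^+ j.
    by rewrite /power_sum big_map; apply: eq_bigr => y _; rewrite exprM.
  transitivity (\sum_(y <- s) y ^+ k * Q.[y]).
    under eq_bigr do rewrite psE mulr_sumr.
    rewrite exchange_big /=; apply: eq_bigr => y _.
    rewrite horner_coef mulr_sumr; apply: eq_bigr => i _.
    by rewrite exprD mulrCA.
  rewrite (bigID (fun y => y == b)) /= [X in _ + X]big1_seq ?addr0.
    rewrite (eq_bigr (fun=> b ^+ k * Q.[b])) => [|y /eqP -> //].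
    by rewrite big_const_seq iter_addr_0.
  by move=> y /andP[yb ys]; rewrite Qy ?mulr0.
pose c : R := complex.Re `|Q.[b]|.
have cE : `|Q.[b]| = c%:C%C by rewrite /c RRe_real // normr_real.
pose X : R := complex.Re `|b|.
have XE : `|b| = X%:C%C by rewrite /X RRe_real // normr_real.
pose T : R := \sum_(i < size Q) complex.Re `|Q`_i| * rho ^+ i.
have main k : (k0 <= k)%N -> c * X ^+ k <= (T * B) * rho ^+ k.
  move=> kk; rewrite -lecR rmorphM rmorphXn /= -cE -XE.
  apply: (@le_trans _ _ `|(b ^+ k * Q.[b]) *+ count_mem b s|).
    rewrite [leRHS]normrMn [X in _ <= X *+ _]normrM [X in _ <= X * _ *+ _]normrX.
    rewrite mulrC -{1}[_ * _]mulr1n ler_wpMn2l ?mulr_ge0 ?exprn_ge0 //.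
    by rewrite -has_count has_pred1.
  rewrite -key; apply: le_trans (ler_norm_sum _ _ _) _.
  rewrite /T -mulrA mulr_suml rmorph_sum; apply: ler_sum => i _ /=.
  rewrite normrM; have qE : `|Q`_i| = (complex.Re `|Q`_i|)%:C%C.
    by rewrite RRe_real // normr_real.
  rewrite {1}qE -mulrA rmorphM; apply: ler_wpM2l; first by rewrite -qE.
  apply: le_trans (H _ _) _; first exact: leq_trans kk (leq_addr _ _).
  by rewrite lecR exprD [leRHS](_ : _ = B * (rho ^+ k * rho ^+ i)) //; ring.
have c0 : 0 < c by rewrite -ltcR -cE normr_gt0.
rewrite -normrX -/b XE lecR; exact: exp_domination rho0 c0 main.
Qed.

End RootBound.

(** * The argument of [1 - z] *)

Section Arg.
Variable R : realType.
Implicit Types (z : R[i]) (a b t x y s : R) (K k n : nat).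
Local Open Scope complex_scope.

(** The principal argument of 1 - z when Re z < 1. At z = 1 the division by 0 gives the value 0. *)
Definition arg1m z : R := atan (- complex.Im z / (1 - complex.Re z)).

Lemma sin_atan x : sin (atan x) = x / Num.sqrt (1 + x ^+ 2) :> R.
Proof.
have c0 : cos (atan x) != 0.
  by rewrite gt_eqF // cos_gt0_pihalf // atan_gtNpi2 atan_ltpi2.
by rewrite -{2}(atanK x) /tan -cos_atan divfK.
Qed.

Lemma Re_lt1 z : `|z| <= 1 -> z != 1 -> complex.Re z < 1.
Proof.
case: z => a b; rewrite normc_def lecE /= => /andP[_ h] n1.
have h2 : a ^+ 2 + b ^+ 2 <= 1.
  have := lerXn2r 2 _ _ h; rewrite !nnegrE sqrtr_ge0 ler01 sqr_sqrtr ?expr1n; first by apply.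
  by rewrite addr_ge0 // sqr_ge0.
rewrite ltNge; apply/negP => a1; move/eqP: n1; apply.
have b0 : b = 0 by apply/eqP; rewrite -sqrf_eq0 eq_le sqr_ge0 andbT; nra.
by rewrite b0; congr (_ +i* _); apply/le_anti; rewrite a1 andbT; nra.
Qed.

Lemma arg1m_polar z : complex.Re z < 1 ->
  exists2 r : R, 0 < r & 1 - z = r%:C * cis (arg1m z).
Proof.
case: z => a b /= a1; rewrite /arg1m /=; set x := - b / (1 - a).
have p0 : 0 < 1 - a by rewrite subr_gt0.
have s0 : 0 < Num.sqrt (1 + x ^+ 2) by rewrite sqrtr_gt0 ltr_pwDl // sqr_ge0.
exists ((1 - a) * Num.sqrt (1 + x ^+ 2)); first exact: mulr_gt0.
rewrite /cis cos_atan sin_atan; simpc; congr (_ +i* _).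
  by rewrite mulfK // gt_eqF.
by move: (gt_eqF s0) (gt_eqF p0); rewrite /x => h1 h2; field; rewrite h1 h2.
Qed.

Lemma is_derive_atan_ratio (P N : R -> R) x (p n : R) : 0 < P x ->
  is_derive x 1 P p -> is_derive x 1 N n ->
  is_derive x 1 (fun x => atan (- N x / P x)) (- (n * P x - N x * p) / (P x ^+ 2 + N x ^+ 2)).
Proof.
move=> P0 dP dN.
have Pn0 : P x != 0 by rewrite gt_eqF.
have dV : is_derive x 1 (fun x => (P x)^-1) (- P x ^- 2 *: p) := is_deriveV Pn0 dP.
have dM : is_derive x 1 (fun x => - N x / P x) (- N x *: (- P x ^- 2 *: p) + (P x)^-1 *: (- n)).
  exact: is_deriveM (is_deriveN dN) dV.
have := is_derive1_comp (is_derive1_atan _) dM.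
move=> /is_derive_eq; apply.
rewrite /GRing.scale /=; field.
by rewrite Pn0 /= gt_eqF // ltr_pwDl ?sqr_ge0 // exprn_gt0.
Qed.

Lemma is_derive_expr t n : is_derive t 1 (fun x : R => x ^+ n) (n%:R * t ^+ n.-1).
Proof.
have := is_deriveX n (is_derive_id t (1 : R)).
rewrite (_ : id ^+ n = fun x : R => x ^+ n); last exact: exprfctE.
by move=> /is_derive_eq; apply; rewrite /GRing.scale /= mulr1.
Qed.

Lemma is_derive_scaled_expr (c : R) t n :
  is_derive t 1 (fun x : R => c * x ^+ n) (c * (n%:R * t ^+ n.-1)).
Proof.
have := is_deriveM (is_derive_cst c t 1) (is_derive_expr t n).
by move=> /is_derive_eq; apply; rewrite /GRing.scale /= mulr0 addr0.
Qed.

Lemma derive_dominated (f g f' g' : R -> R) x y : x <= y ->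
  (forall t, x <= t <= y -> is_derive t 1 f (f' t)) ->
  (forall t, x <= t <= y -> is_derive t 1 g (g' t)) ->
  (forall t, x <= t <= y -> f' t <= g' t) -> f y - f x <= g y - g x.
Proof.
move=> xy df dg fg.
have dgf t : x <= t <= y -> is_derive t 1 (g - f) (g' t - f' t).
  by move=> h; apply: is_deriveB; [exact: dg|exact: df].
have cgf : {within `[x, y], continuous (g - f)}.
  apply: derivable_within_continuous => t; rewrite in_itv /= => h.
  exact: (@ex_derive _ _ _ _ _ _ _ (dgf t h)).
have [|c] := @MVT_segment R (g - f) (fun t => g' t - f' t) x y xy _ cgf.
  by move=> t; rewrite in_itv /= => /andP[h1 h2]; apply: dgf; rewrite !ltW.
rewrite in_itv /= => h e.
have : 0 <= (g - f) y - (g - f) x by rewrite e mulr_ge0 ?subr_ge0 ?fg.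
by rewrite !fctE; lra.
Qed.

Lemma normc_ge_Im z : `|complex.Im z|%:C <= `|z|.
Proof.
case: z => a b; rewrite normc_def lecR /= -sqrtr_sqr ler_sqrt ?lerDr ?sqr_ge0 //.
by rewrite addr_ge0 ?sqr_ge0.
Qed.

Definition nrm z : R := complex.Re `|z|.

Lemma nrmE z : `|z| = (nrm z)%:C.
Proof. by rewrite /nrm RRe_real // normr_real. Qed.

Lemma nrm_ge0 z : 0 <= nrm z. Proof. by rewrite -ler0c -nrmE. Qed.

Lemma nrmM z w : nrm (z * w) = nrm z * nrm w.
Proof. by apply: complexI; rewrite rmorphM /= -!nrmE normrM. Qed.

Lemma nrmX z n : nrm (z ^+ n) = nrm z ^+ n.
Proof. by apply: complexI; rewrite rmorphXn /= -!nrmE normrX. Qed.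

Lemma nrmV z : nrm z^-1 = (nrm z)^-1.
Proof. by apply: complexI; rewrite fmorphV /= -!nrmE normfV. Qed.

Lemma nrmN z : nrm (- z) = nrm z.
Proof. by apply: complexI; rewrite -!nrmE normrN. Qed.

Lemma nrmD z w : nrm (z + w) <= nrm z + nrm w.
Proof. by rewrite -lecR rmorphD /= -!nrmE ler_normD. Qed.

Lemma nrmR x : nrm x%:C = `|x|.
Proof. by rewrite /nrm normc_def /= expr0n addr0 sqrtr_sqr. Qed.

Lemma nrm_eq0 z : (nrm z == 0) = (z == 0).
Proof. by rewrite -(inj_eq (@complexI R)) -nrmE rmorph0 normr_eq0. Qed.

Lemma nrm_Im z : `|complex.Im z| <= nrm z.
Proof. by rewrite -lecR -nrmE normc_ge_Im. Qed.

Lemma nrm_Re z : `|complex.Re z| <= nrm z.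
Proof. by rewrite -lecR -nrmE normc_ge_Re. Qed.

Lemma nrm1 : nrm 1 = 1. Proof. by rewrite (nrmR 1) normr1. Qed.

Lemma ImD z w : complex.Im (z + w) = complex.Im z + complex.Im w.
Proof. by case: z w => [? ?] []. Qed.

Lemma ImN z : complex.Im (- z) = - complex.Im z.
Proof. by case: z. Qed.

Lemma Im_sum (I : Type) (r : seq I) (p : pred I) (G : I -> R[i]) :
  complex.Im (\sum_(i <- r | p i) G i) = \sum_(i <- r | p i) complex.Im (G i).
Proof. by apply: (big_morph _ ImD). Qed.

Lemma Im_real_mul x z : complex.Im (x%:C * z) = x * complex.Im z.
Proof. by case: z => a b; simpc. Qed.

Section Tail.
Variables (z : R[i]) (K : nat).
Hypotheses (z_le1 : nrm z <= 1) (z_neq1 : z != 1).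
Let a := complex.Re z.
Let b := complex.Im z.
Let delta := nrm (1 - z).

Lemma delta_gt0 : 0 < delta.
Proof. by rewrite lt_neqAle nrm_ge0 andbT eq_sym nrm_eq0 subr_eq0 eq_sym. Qed.

Lemma Re_z_lt1 : a < 1. Proof. by apply: Re_lt1 => //; rewrite nrmE lecR. Qed.

Lemma one_sub_Re_gt0 t : 0 <= t <= 1 -> 0 < 1 - t * a.
Proof.
move=> /andP[t0 t1]; have h := Re_z_lt1.
have -> : 1 - t * a = (1 - t) + t * (1 - a) by ring.
have [->|t1'] := eqVneq t 1; first by rewrite subrr add0r mul1r subr_gt0.
by rewrite ltr_wpDr ?mulr_ge0 ?subr_ge0 ?(ltW h) // subr_gt0 lt_neqAle t1' t1.
Qed.

Lemma is_derive_affine (c d t : R) : is_derive t 1 (fun t => c + t * d) d.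
Proof.
have := is_deriveD (is_derive_cst c t 1) (is_deriveM (is_derive_id t 1) (is_derive_cst d t 1)).
by move=> /is_derive_eq; apply; rewrite /GRing.scale /= mulr0 mulr1 !add0r.
Qed.

Lemma Im_div_one_sub t : 0 <= t <= 1 ->
  complex.Im (z / (1 - t%:C * z)) = b / ((1 - t * a) ^+ 2 + (t * b) ^+ 2).
Proof.
move=> ht; have P0 := one_sub_Re_gt0 ht; move: P0; rewrite /a /b.
case: z => x y /= P0.
have n0 : (1 - t * x) ^+ 2 + (t * y) ^+ 2 != 0.
  by rewrite gt_eqF // ltr_pwDl ?sqr_ge0 // exprn_gt0.
simpc => /=; rewrite sqrrN; field.
exact: n0.
Qed.

Lemma geometric_partial t : 1 - t%:C * z != 0 ->
  - (z * (t%:C * z) ^+ K) / (1 - t%:C * z) =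
  - (z / (1 - t%:C * z)) + \sum_(1 <= k < K.+1) (t ^+ k.-1)%:C * z ^+ k.
Proof.
move=> w0; apply: (mulIf w0); rewrite mulrDl divfK // mulNr divfK //.
elim: K => [|n IH]; first by rewrite big_geq // mul0r addr0 expr0 mulr1.
rewrite big_nat_recr //= mulrDl addrA -IH exprMn rmorphXn /= !exprS exprMn.
by ring.
Qed.

Definition partial_arg t := \sum_(1 <= k < K.+1) t ^+ k * (complex.Im (z ^+ k) / k%:R).

Lemma is_derive_partial_arg t :
  is_derive t 1 partial_arg (\sum_(1 <= k < K.+1) t ^+ k.-1 * complex.Im (z ^+ k)).
Proof.
rewrite /partial_arg; elim: K => [|n IH].
  rewrite big_geq // (_ : (fun _ => _) = cst 0); first exact: is_derive_cst.
  by apply/funext => x; rewrite big_geq.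
rewrite big_nat_recr //=.
rewrite (_ : (fun _ => _) = (fun t => \sum_(1 <= k < n.+1) t ^+ k * (complex.Im (z ^+ k) / k%:R)) +
    (fun t => (complex.Im (z ^+ n.+1) / n.+1%:R) * t ^+ n.+1)); last first.
  by apply/funext => x; rewrite big_nat_recr //= [X in _ + X]mulrC.
apply: is_deriveD; have := is_derive_scaled_expr (complex.Im (z ^+ n.+1) / n.+1%:R) t n.+1.
by move=> /is_derive_eq; apply => /=; field; rewrite ?natr1 ?nat1r pnatr_eq0.
Qed.

(** |1 - t z| is at least |1 - z| - (1 - t) and at least 1 - t; averaging eliminates t. *)
Lemma one_sub_scaled_ge t : 0 <= t <= 1 -> delta / 2 <= nrm (1 - t%:C * z).
Proof.
move=> /andP[t0 t1].
have h1 : delta <= nrm (1 - t%:C * z) + (1 - t).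
  have -> : 1 - t = nrm ((1 - t)%:C) by rewrite nrmR ger0_norm // subr_ge0.
  apply: le_trans (_ : nrm (1 - t%:C * z) + nrm ((t - 1)%:C * z) <= _).
    by rewrite (le_trans _ (nrmD _ _)) // /delta rmorphB rmorph1 mulrBl mul1r addrA subrK.
  rewrite lerD2l nrmM !nrmR distrC ler_piMr //.
have h2 : 1 <= nrm (1 - t%:C * z) + t.
  rewrite -[X in X <= _]nrm1; apply: le_trans (_ : nrm (1 - t%:C * z) + nrm (t%:C * z) <= _).
    by rewrite (le_trans _ (nrmD _ _)) // subrK.
  by rewrite lerD2l nrmM nrmR ger0_norm // ler_piMr.
lra.
Qed.

(** Replacing z by t z, the derivative in t is - Im (z (t z)^K / (1 - t z)), at most 2 t^K / |1 - z|
    in absolute value; integrate over [0, 1]. *)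
Lemma arg1m_tail : `|arg1m z + \sum_(1 <= k < K.+1) complex.Im (z ^+ k) / k%:R|
  <= 2 / (K.+1%:R * delta).
Proof.
pose f t := atan (- (t * b) / (1 - t * a)) + partial_arg t.
pose f' t := complex.Im (- (z * (t%:C * z) ^+ K) / (1 - t%:C * z)).
pose g t := 2 / (K.+1%:R * delta) * t ^+ K.+1.
pose g' t := 2 / delta * t ^+ K.
have d0 := delta_gt0.
have df t : 0 <= t <= 1 -> is_derive t 1 f (f' t).
  move=> ht; have P0 := one_sub_Re_gt0 ht.
  have dN : is_derive t 1 (fun t => t * b) b.
    by have := is_derive_affine 0 b t; under eq_fun do rewrite add0r.
  have dP : is_derive t 1 (fun t => 1 - t * a) (- a).
    by have := is_derive_affine 1 (- a) t; under eq_fun do rewrite mulrN.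
  have := is_deriveD (@is_derive_atan_ratio (fun t => 1 - t * a) (fun t => t * b) t _ _ P0 dP dN) (is_derive_partial_arg t).
  move=> /is_derive_eq; apply; rewrite /f' geometric_partial; last first.
    by rewrite -nrm_eq0 gt_eqF // (lt_le_trans _ (one_sub_scaled_ge ht)) // divr_gt0.
  rewrite ImD ImN Im_sum Im_div_one_sub //.
  congr (_ + _); last by apply: eq_bigr => k _; rewrite Im_real_mul.
  by rewrite -[RHS]mulNr; congr (_ / _); ring.
have dg t : is_derive t 1 g (g' t).
  have := is_derive_scaled_expr (2 / (K.+1%:R * delta)) t K.+1.
  move=> /is_derive_eq; apply; rewrite /g' /=.
  by field; rewrite gt_eqF //= ?natr1 ?nat1r pnatr_eq0.
have fg t : 0 <= t <= 1 -> `|f' t| <= g' t.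
  move=> ht; have /andP[t0 t1] := ht; apply: le_trans (nrm_Im _) _.
  have h := one_sub_scaled_ge ht.
  rewrite nrmM nrmN nrmM nrmX nrmM nrmV nrmR ger0_norm // exprMn /g'.
  have h2 : (nrm (1 - t%:C * z))^-1 <= 2 / delta.
    by rewrite -[2 / delta]invrK lef_pV2 ?posrE ?invr_gt0 ?divr_gt0 // ?invf_div // (lt_le_trans _ h) // divr_gt0.
  rewrite [leRHS]mulrC; apply: ler_pM => //.
  - by rewrite mulr_ge0 ?nrm_ge0 // mulr_ge0 ?exprn_ge0 ?nrm_ge0.
  - by rewrite invr_ge0 nrm_ge0.
  - by rewrite mulrCA ler_piMr ?exprn_ge0 // -exprS exprn_ile1 // nrm_ge0.
have f0 : f 0 = 0.
  rewrite /f mul0r oppr0 mul0r atan0 add0r /partial_arg big_nat big1 // => k /andP[k0 _].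
  by rewrite expr0n gtn_eqF // mul0r.
have f1 : f 1 = arg1m z + \sum_(1 <= k < K.+1) complex.Im (z ^+ k) / k%:R.
  rewrite /f !mul1r /partial_arg; congr (_ + _).
  by apply: eq_bigr => k _; rewrite expr1n mul1r.
have g01 : g 1 - g 0 = 2 / (K.+1%:R * delta).
  by rewrite /g expr1n expr0n /= mulr0 subr0 mulr1.
rewrite -f1 -g01 -[f 1]subr0 -[X in f 1 - X]f0 ler_norml; apply/andP; split.
  rewrite lerNl; have -> : - (f 1 - f 0) = (- f) 1 - (- f) 0 by rewrite !fctE; ring.
  apply: (derive_dominated (f' := fun t => - f' t) (g' := g')) => // t ht.
    exact: is_deriveN (df t ht).
  by rewrite (le_trans (ler_norm _)) // normrN fg.
apply: (@derive_dominated f g f' g' 0 1) => // t ht.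
by rewrite (le_trans (ler_norm _)) // fg.
Qed.
End Tail.

End Arg.

(** * Variation of the argument under rotation *)

Section Rotation.
Variable R : realType.
Implicit Types (z : R[i]) (a b t x y s d : R) (K k n : nat).
Local Open Scope complex_scope.

Lemma nrm_one_subX z k : nrm z <= 1 -> nrm (1 - z ^+ k) <= k%:R * nrm (1 - z).
Proof.
move=> z1; elim: k => [|k IH]; first by rewrite expr0 subrr mul0r (nrmR 0) normr0.
have -> : 1 - z ^+ k.+1 = (1 - z) + z * (1 - z ^+ k) by rewrite exprS; ring.
apply: le_trans (nrmD _ _) _; rewrite -nat1r mulrDl mul1r lerD2l nrmM.
by apply: le_trans IH; rewrite ler_piMl ?nrm_ge0.
Qed.

(** If (K + 1) |1 - z| >= 1 the tail bound gives 2. Otherwise |Im z^k| <= |1 - z^k| <= k |1 - z|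
    bounds the sum by 1, and the argument is below pi / 2 < 2. *)
Lemma arg1m_tail_le3 z K : nrm z <= 1 -> z != 1 ->
  `|arg1m z + \sum_(1 <= k < K.+1) complex.Im (z ^+ k) / k%:R| <= 3.
Proof.
move=> z1 zn1; set d := nrm (1 - z).
have d0 : 0 < d := delta_gt0 zn1.
have [h|h] := leP 1 (K.+1%:R * d).
  apply: le_trans (arg1m_tail K z1 zn1) _; rewrite -/d.
  by rewrite ler_pdivrMr ?(lt_le_trans ltr01) //; lra.
apply: le_trans (ler_normD _ _) _.
have h1 : `|arg1m z| <= 2.
  rewrite /arg1m; set x := _ / _; have := atan_gtNpi2 x; have := atan_ltpi2 x.
  by have := @pihalf_lt2 R; rewrite ler_norml => ? ? ?; apply/andP; split; lra.
suff : `|\sum_(1 <= k < K.+1) complex.Im (z ^+ k) / k%:R| <= 1 by lra.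
apply: le_trans (ler_norm_sum _ _ _) _; apply: le_trans (ltW h).
apply: (@le_trans _ _ (\sum_(1 <= k < K.+1) d)).
  rewrite big_nat [leRHS]big_nat; apply: ler_sum => k /andP[k0 _].
  have kp : 0 < k%:R :> R by rewrite ltr0n.
  rewrite normrM normfV (ger0_norm (ltW kp)) ler_pdivrMr // mulrC.
  apply: le_trans (nrm_one_subX k z1); rewrite -nrmN opprB.
  apply: le_trans (nrm_Im _); rewrite ImD ImN /= oppr0 addr0 //.
by rewrite sumr_const_nat subSS subn0 -[d *+ _]mulr_natl ler_pM2r // ler_nat.
Qed.

Lemma cisD x y : cis (x + y) = cis x * cis y.
Proof. by rewrite /cis cosD sinD; simpc; congr (_ +i* _); ring. Qed.

Lemma cis0 : cis 0 = 1 :> R[i]. Proof. by rewrite /cis cos0 sin0. Qed.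

Lemma nrm_cis x : nrm (cis x) = 1.
Proof. by rewrite /nrm normc_def /= cos2Dsin2 sqrtr1. Qed.

Lemma cisX x n : cis x ^+ n = cis (n%:R * x).
Proof.
elim: n => [|n IH]; first by rewrite mul0r cis0.
by rewrite exprS IH -cisD -nat1r mulrDl mul1r.
Qed.

Lemma is_derive_rotate_Re z y :
  is_derive y 1 (fun y => complex.Re (z * cis y)) (- complex.Im (z * cis y)).
Proof.
case: z => a b; rewrite /cis /=.
rewrite (_ : (fun y => _) = (fun y => a * cos y - b * sin y)); last by apply/funext => x; simpc.
have h1 := is_deriveM (is_derive_cst a y 1) (is_derive_cos y).
have h2 := is_deriveM (is_derive_cst b y 1) (is_derive_sin y).
have := is_deriveB h1 h2; move=> /is_derive_eq; apply.
by rewrite /GRing.scale /=; ring.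
Qed.

Lemma is_derive_rotate_Im z y :
  is_derive y 1 (fun y => complex.Im (z * cis y)) (complex.Re (z * cis y)).
Proof.
case: z => a b; rewrite /cis /=.
rewrite (_ : (fun y => _) = (fun y => a * sin y + b * cos y)); last by apply/funext => x; simpc.
have h1 := is_deriveM (is_derive_cst a y 1) (is_derive_sin y).
have h2 := is_deriveM (is_derive_cst b y 1) (is_derive_cos y).
have := is_deriveD h1 h2; move=> /is_derive_eq; apply.
by rewrite /GRing.scale /=; ring.
Qed.

Lemma nrm_sqr z : nrm z ^+ 2 = complex.Re z ^+ 2 + complex.Im z ^+ 2.
Proof.
rewrite /nrm normc_def /= sqr_sqrtr // addr_ge0 ?sqr_ge0 //.
Qed.

(** With w = z e^(ix) the derivative in x is 1 - Re (1 / (1 - w)), and Re (1 / (1 - w)) >= 1/2 in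
    the unit disc. *)
Lemma arg1m_rotate_lt1 z y : nrm z < 1 -> 0 <= y -> arg1m (z * cis y) - arg1m z <= y / 2.
Proof.
move=> z1 y0.
pose N x := complex.Im (z * cis x); pose P x : R := 1 - complex.Re (z * cis x).
have P0 x : 0 < P x.
  rewrite subr_gt0; apply: le_lt_trans (ler_norm _) _; apply: le_lt_trans (nrm_Re _) _.
  by rewrite nrmM nrm_cis mulr1.
have dN x : is_derive x 1 N (complex.Re (z * cis x)) := is_derive_rotate_Im z x.
have dP x : is_derive x 1 P (N x).
  have := is_deriveB (is_derive_cst (1 : R) x 1) (is_derive_rotate_Re z x).
  by move=> /is_derive_eq; apply; rewrite sub0r opprK.
pose f' x := - (complex.Re (z * cis x) * P x - N x * N x) / (P x ^+ 2 + N x ^+ 2).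
have df x : is_derive x 1 (fun x => atan (- N x / P x)) (f' x) := is_derive_atan_ratio (P0 x) (dP x) (dN x).
have := @derive_dominated R (fun x => atan (- N x / P x)) (fun x => 0 + x * 2^-1) f' (fun=> 2^-1) 0 y y0.
have -> : atan (- N 0 / P 0) = arg1m z by rewrite /arg1m /N /P cis0 mulr1.
rewrite !add0r mul0r subr0 => H.
apply: (H (fun t _ => df t) (fun t _ => is_derive_affine _ _ t)) => t _.
rewrite /f'; have PN : 0 < P t ^+ 2 + N t ^+ 2.
  by rewrite ltr_pwDl ?sqr_ge0 // exprn_gt0.
rewrite ler_pdivrMr //.
have : complex.Re (z * cis t) ^+ 2 + N t ^+ 2 <= 1.
  by rewrite -nrm_sqr nrmM nrm_cis mulr1 expr_le1 ?nrm_ge0 // ltW.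
rewrite /P; move: (N t) (complex.Re _) => u v; nra.
Qed.

Lemma arg1m_scaled_cvg z : nrm z <= 1 -> z != 1 ->
  arg1m (t%:C * z) @[t --> 1^'-] --> arg1m z.
Proof.
move=> z1 zn1.
have E t : arg1m (t%:C * z) = atan (- (t * complex.Im z) / (1 - t * complex.Re z)).
  by rewrite /arg1m; case: z {z1 zn1} => a b /=; simpc.
under eq_fun do rewrite E.
have -> : arg1m z = atan (- (1 * complex.Im z) / (1 - 1 * complex.Re z)) by rewrite !mul1r.
apply: cvg_at_left_filter; apply: differentiable_continuous.
apply/derivable1_diffP.
have P0 : 0 < 1 - 1 * complex.Re z by rewrite mul1r subr_gt0 Re_lt1 // nrmE lecR.
have dP : is_derive (1 : R) 1 (fun t => 1 - t * complex.Re z) (- complex.Re z).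
  by have := is_derive_affine 1 (- complex.Re z) (1 : R); under eq_fun do rewrite mulrN.
have dN : is_derive (1 : R) 1 (fun t => t * complex.Im z) (complex.Im z).
  by have := is_derive_affine 0 (complex.Im z) (1 : R); under eq_fun do rewrite add0r.
have := @is_derive_atan_ratio R (fun t => 1 - t * complex.Re z) (fun t => t * complex.Im z) 1 _ _ P0 dP dN.
by move=> h; exact: ex_derive.
Qed.

(** The rotation may pass through 1, where the argument jumps. Replacing z by t z and letting t tend
    to 1 from the left carries the inequality across the jump. *)
Lemma arg1m_rotate z y : nrm z <= 1 -> z != 1 -> z * cis y != 1 -> 0 <= y ->
  arg1m (z * cis y) - arg1m z <= y / 2.
Proof.
move=> z1 zn1 zy1 y0.
have c1 := arg1m_scaled_cvg z1 zn1.
have c2 : arg1m (t%:C * (z * cis y)) @[t --> 1^'-] --> arg1m (z * cis y).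
  by apply: arg1m_scaled_cvg => //; rewrite nrmM nrm_cis mulr1.
apply: (cvgr_to_le (cvgB c2 c1)).
near=> t.
suff : arg1m (t%:C * z * cis y) - arg1m (t%:C * z) <= y / 2 by rewrite -mulrA.
apply: arg1m_rotate_lt1 => //.
rewrite nrmM nrmR; have t0 : 0 < t by near: t; apply: nbhs_left_gt.
have t1 : t < 1 by near: t; exact: nbhs_left_lt.
by rewrite gtr0_norm //; apply: le_lt_trans t1; rewrite ler_piMr // ltW.
Unshelve. all: by end_near.
Qed.

Lemma sin_le_id y : 0 <= y -> sin y <= y.
Proof.
move=> y0; have := @derive_dominated R sin (fun x => 0 + x * 1) cos (fun=> 1) 0 y y0.
rewrite sin0 !add0r mul0r !subr0 mulr1 => H.
apply: (H (fun t _ => is_derive_sin t) (fun t _ => is_derive_affine _ _ t)) => t _.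
exact: cos_le1.
Qed.

Lemma cos_ge_quadratic y : 0 <= y -> 1 - y ^+ 2 / 2 <= cos y.
Proof.
move=> y0; have := @derive_dominated R (- cos) (fun x => 2^-1 * x ^+ 2) sin (fun x => 2^-1 * (2%:R * x ^+ 1)) 0 y y0.
rewrite !fctE cos0 expr0n mulr0 subr0 => H.
have {H} : - cos y + 1 <= 2^-1 * y ^+ 2.
  rewrite -[X in _ + X]opprK.
  have dc t : is_derive t 1 (- cos) (sin t) by have := is_deriveN (is_derive_cos t); rewrite opprK.
  apply: (H (fun t _ => dc t) (fun t _ => is_derive_scaled_expr _ _ _)).
  by move=> t /andP[t0 _]; rewrite expr1 mulrA mulVf ?mul1r ?sin_le_id.
lra.
Qed.

Lemma sin_ge_half y : 0 <= y <= 1 -> y / 2 <= sin y.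
Proof.
move=> /andP[y0 y1].
have := @derive_dominated R (fun x => 0 + x * 2^-1) sin (fun=> 2^-1) cos 0 y y0.
rewrite sin0 !add0r mul0r !subr0 => H.
apply: (H (fun t _ => is_derive_affine _ _ t) (fun t _ => is_derive_sin t)).
by move=> t /andP[t0 ty]; have := cos_ge_quadratic t0; nra.
Qed.

(* Near [z = 1] the argument of [1 - z] turns by a definite amount while [z]
   is rotated through an angle comparable to [|1 - z|]. *)
Definition turn_const : R := 2 * atan (1 / 3).

Lemma turn_const_gt0 : 0 < turn_const.
Proof. by rewrite mulr_gt0 // -(@atan0 R) lt_atan // divr_gt0. Qed.

Lemma arg1m_past z y d : 0 < d -> nrm z <= 1 -> nrm (1 - z) <= d ->
  8 * d <= y <= 16 * d -> 16 * d <= 1 -> z * cis y != 1 ->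
  arg1m (z * cis y) <= - atan (1 / 3).
Proof.
move=> d0 z1 zd /andP[yl yu] d1 zn1.
have w1 : nrm (z * cis y) <= 1 by rewrite nrmM nrm_cis mulr1.
have rl1 : complex.Re (z * cis y) < 1 by apply: Re_lt1 => //; rewrite nrmE lecR.
rewrite -atanN /arg1m; apply: le_atan.
rewrite ler_pdivrMr ?subr_gt0 // mulNr lerN2.
move: zd rl1; have := nrm_Re (1 - z); have := nrm_Im (1 - z); case: z z1 {zn1 w1} => a b _ /=.
rewrite /cis; simpc => /= hb ha zd rl1.
have y01 : 0 <= y <= 1 by lra.
have hs := sin_ge_half y01; have hs1 := sin_le1 y; have hc1 := cos_le1 y.
have y0 : 0 <= y by lra.
have hc := cos_ge_quadratic y0.
have e := cos2Dsin2 y.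
move: hb ha; rewrite !ler_norml => /andP[hb1 hb2] /andP[ha1 ha2].
have c0 : 2^-1 <= cos y by nra.
have b1 : b <= d by lra.
have b2 : - d <= b by lra.
have a1 : 1 - d <= a by lra.
have a2 : a <= 1 + d by lra.
set S := sin y in hs hs1 e *; set c := cos y in hc1 e c0 *.
have S4 : 4 * d <= S by lra.
(* Since d <= S / 4, the imaginary part is at least 5S / 8 and 1 minus the real part is at most 3S /
   2; the ratio 5/12 exceeds 1/3. *)
have h1 : 5 / 8 * S <= a * S + b * c by nra.
have h2 : 1 - (a * c - b * S) <= 3 / 2 * S by nra.
lra.
Qed.

Lemma arg1m_conj z : arg1m z^* = - arg1m z.
Proof. by case: z => a b; rewrite /arg1m /= -atanN mulNr. Qed.

Lemma nrm_conj z : nrm z^* = nrm z.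
Proof. by rewrite /nrm normcJ. Qed.

Lemma cis_conj x : (cis x)^* = cis (- x).
Proof. by rewrite /cis /= cosN sinN. Qed.

Lemma arg1m_before z y d : 0 < d -> nrm z <= 1 -> nrm (1 - z) <= d ->
  8 * d <= y <= 16 * d -> 16 * d <= 1 -> z * cis (- y) != 1 ->
  atan (1 / 3) <= arg1m (z * cis (- y)).
Proof.
move=> d0 z1 zd hy d1 zn1.
have e : z * cis (- y) = (z^* * cis y)^* by rewrite -cis_conj -{1}(conjcK z) -rmorphM.
rewrite e arg1m_conj lerNr; apply: (arg1m_past d0) => //; first by rewrite nrm_conj.
  by rewrite -(conjc1 R) -rmorphB nrm_conj.
by apply: contraNneq zn1; rewrite e => ->; rewrite conjc1.
Qed.



Lemma cis_eq1 x : -(2 * pi) < x < 2 * pi -> cis x = 1 -> x = 0.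
Proof.
move=> /andP[xl xu] []; have -> : x = (x / 2) *+ 2 by rewrite -mulr_natr divfK.
rewrite cos_mulr2n => c1 _; have s0 : sin (x / 2) = 0.
  by apply/eqP; rewrite -sqrf_eq0 sin2cos2; apply/eqP; move: c1; rewrite -mulr_natr; lra.
have [x0|x0|->] := ltgtP (x / 2) 0; last by rewrite mul0rn.
  have : 0 < sin (- (x / 2)) by apply: sin_gt0_pi; apply/andP; split; lra.
  by rewrite sinN s0 oppr0 ltxx.
have : 0 < sin (x / 2) by apply: sin_gt0_pi; apply/andP; split; lra.
by rewrite s0 ltxx.
Qed.

Lemma cis_neq0 x : cis x != 0 :> R[i].
Proof. by rewrite -nrm_eq0 nrm_cis oner_eq0. Qed.

Lemma cis_inj x y : -(2 * pi) < x - y < 2 * pi -> cis x = cis y -> x = y.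
Proof.
move=> h e; apply/eqP; rewrite -subr_eq0; apply/eqP; apply: cis_eq1 => //.
apply: (mulIf (cis_neq0 y)); rewrite -cisD subrK mul1r //.
Qed.

End Rotation.

(** * Zeros near a point of the circle, and the dyadic sum *)

Section ZerosNearPoint.
Variable R : realType.
Variable ws : seq R[i].
Hypothesis ws_le1 : forall w, w \in ws -> nrm w <= 1.
Implicit Types (w : R[i]) (y d h : R) (K : nat).
Local Open Scope complex_scope.
Local Notation n := (size ws).

Definition total_arg y : R := \sum_(w <- ws) arg1m (w * cis y).
Definition regular y := all (fun w => w * cis y != 1) ws.

(** In an interval shorter than 2 pi each nonzero w excludes at most one angle, so one of n + 1
    sample points is regular. *)
Lemma exists_regular (u v : R) : u < v -> v - u < 2 * pi ->
  exists y, [/\ u < y, y < v & regular y].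
Proof.
move=> uv vu; apply/not_existsP => none.
pose x (i : 'I_n.+1) : R := u + (v - u) * (i.+1%:R / n.+2%:R).
have n2 : 0 < n.+2%:R :> R by rewrite ltr0n.
have frac (i : 'I_n.+1) : 0 < (i.+1%:R / n.+2%:R : R) < 1.
  by rewrite divr_gt0 ?ltr0n //= ltr_pdivrMr // mul1r ltr_nat ltnS ltn_ord.
have xin i : u < x i /\ x i < v.
  have /andP[f0 f1] := frac i; have p : 0 < v - u by rewrite subr_gt0.
  rewrite /x; move: (_ / _) f0 f1 => r r0 r1.
  have q0 : 0 < (v - u) * r by rewrite mulr_gt0.
  have q1 : 0 < (v - u) * (1 - r) by rewrite mulr_gt0 // subr_gt0.
  by split; lra.
have bad i : exists j : 'I_n, nth 0 ws j * cis (x i) = 1.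
  have [ux xv] := xin i; have /negP : ~ regular (x i) by move=> r; apply: (none (x i)).
  move=> /allPn[w /(nthP 0)[j jn <-]]; rewrite negbK => /eqP e.
  by exists (Ordinal jn).
have [f fP] := choice bad.
have : ~ injective f by move=> /leq_card; rewrite !card_ord ltnn.
apply => i j fij.
have w0 : nth 0 ws (f i) != 0.
  by apply/eqP => e; have := fP i; rewrite e mul0r => /esym/eqP; rewrite oner_eq0.
have e : cis (x i) = cis (x j) by apply: (mulfI w0); rewrite fP fij fP.
have [a1 a2] := xin i; have [b1 b2] := xin j.
have xe : x i = x j by apply: cis_inj e; apply/andP; split; lra.
apply/val_inj; move: xe; rewrite /x => /addrI/mulfI.
rewrite gt_eqF ?subr_gt0 // => /(_ isT) /(mulIf _).
rewrite invr_eq0 gt_eqF // => /(_ isT)/eqP.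
by rewrite eqr_nat eqSS => /eqP.
Qed.

Variable M : R.
Hypothesis total_arg_le : forall y, regular y -> `|total_arg y| <= M.

Lemma M_ge0 : 0 <= M.
Proof.
have p0 := @pi_gt0 R.
have [||y [_ _ ry]] := @exists_regular 0 1; rewrite ?ltr01 ?subr0 //.
  by have := @pi_ge2 R; lra.
exact: le_trans (total_arg_le ry).
Qed.

Definition near_count y d := count (fun w => nrm (1 - w * cis y) <= d) ws.

(* Rotating [w * cis y] by [t] lowers [arg1m] by at least [- t / 2]; crossing [1]
   costs a further [turn_const], and the total change is at most [2 * M]. *)
Lemma near_count_small y d : 0 < d -> 16 * d <= 1 ->
  (near_count y d)%:R * turn_const R <= 16 * n%:R * d + 2 * M.
Proof.
move=> d0 d1.
have p2 := @pi_ge2 R.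
have [||a' [a1 a2 ra]] := @exists_regular (y - 16 * d) (y - 8 * d); [lra|lra|].
have [||b' [b1 b2 rb]] := @exists_regular (y + 8 * d) (y + 16 * d); [lra|lra|].
pose W w := (b' - a') / 2 - (arg1m (w * cis b') - arg1m (w * cis a')).
have sumW : \sum_(w <- ws) W w = n%:R * ((b' - a') / 2) - (total_arg b' - total_arg a').
  rewrite /total_arg -sumrB [LHS]sumrB; congr (_ - _).
  by rewrite big_const_seq count_predT iter_addr_0 mulr_natl.
have W0 w : w \in ws -> 0 <= W w.
  move=> wws; rewrite subr_ge0.
  have e : w * cis b' = w * cis a' * cis (b' - a') by rewrite -mulrA -cisD addrC subrK.
  rewrite e; apply: arg1m_rotate; rewrite -?e ?(allP ra) ?(allP rb) //.
    by rewrite nrmM nrm_cis mulr1 ws_le1.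
  by rewrite subr_ge0; lra.
have Wc w : w \in ws -> nrm (1 - w * cis y) <= d -> turn_const R <= W w.
  move=> wws wd.
  have w1 : nrm (w * cis y) <= 1 by rewrite nrmM nrm_cis mulr1 ws_le1.
  have eb : w * cis b' = w * cis y * cis (b' - y) by rewrite -mulrA -cisD addrC subrK.
  have ea : w * cis a' = w * cis y * cis (- (y - a')) by rewrite -mulrA -cisD opprB addrC subrK.
  have h1 : arg1m (w * cis b') <= - atan (1 / 3).
    rewrite eb; apply: (arg1m_past d0) => //; last by rewrite -eb (allP rb).
    by apply/andP; split; lra.
  have h2 : atan (1 / 3) <= arg1m (w * cis a').
    rewrite ea; apply: (arg1m_before d0) => //; last by rewrite -ea (allP ra).
    by apply/andP; split; lra.
  by rewrite /W /turn_const; lra.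
have le1 : (near_count y d)%:R * turn_const R <= \sum_(w <- ws) W w.
  rewrite [leRHS](bigID (fun w => nrm (1 - w * cis y) <= d)) /=.
  apply: (@le_trans _ _ (\sum_(w <- ws | nrm (1 - w * cis y) <= d) W w)); last first.
    by rewrite lerDl big_seq_cond sumr_ge0 // => w /andP[/W0].
  apply: (@le_trans _ _ (\sum_(w <- ws | nrm (1 - w * cis y) <= d) turn_const R)).
    by rewrite big_const_seq iter_addr_0 mulr_natl.
  by rewrite big_seq_cond [leRHS]big_seq_cond; apply: ler_sum => w /andP[]; exact: Wc.
apply: le_trans le1 _; rewrite sumW.
have := total_arg_le ra; have := total_arg_le rb.
rewrite !ler_norml => /andP[? ?] /andP[? ?].
have : n%:R * ((b' - a') / 2) <= n%:R * (16 * d) by rewrite ler_wpM2l //; lra.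
lra.
Qed.

(** The first 16 covers d > 1/16, where the count is at most n <= 16 n d; the second term comes from
    dividing [near_count_small] by [turn_const]. *)
Definition count_const : R := 16 + 16 / turn_const R.

Lemma count_const_gt0 : 0 < count_const.
Proof. by rewrite addr_gt0 // divr_gt0 // turn_const_gt0. Qed.

Lemma near_count_le y d : 0 < d ->
  (near_count y d)%:R <= count_const * (n%:R * d + M).
Proof.
move=> d0; have t0 := turn_const_gt0 R; have M0 := M_ge0.
have nd0 : 0 <= n%:R * d by rewrite mulr_ge0 // ltW.
have c0 : 0 <= 16 / turn_const R by rewrite divr_ge0 // ltW.
have [h|h] := leP (16 * d) 1.
  have := near_count_small y d0 h; rewrite -ler_pdivlMr // => /le_trans; apply.
  rewrite /count_const; have v0 : 0 <= (turn_const R)^-1 by rewrite invr_ge0 ltW.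
  have vM := mulr_ge0 v0 M0; rewrite -[16 * n%:R * d]mulrA.
  by move: (n%:R * d) (_^-1) nd0 v0 vM => X v X0 v0 vM; nra.
have le : (near_count y d)%:R <= n%:R :> R by rewrite ler_nat count_size.
apply: (le_trans le); apply: (@le_trans _ _ (16 * (n%:R * d))).
  by rewrite mulrCA ler_peMr // ltW.
rewrite /count_const; apply: ler_pM => //; first by rewrite lerDl.
by rewrite lerDl.
Qed.

(* The scale is split dyadically: beyond [2 ^ i * h] each term is at most
   [2 / ((K + 1) 2 ^ i h)]. *)
Lemma dyadic_bound (x h t : R) K I : 0 < h -> 0 < t -> t <= 2 ^+ I * h ->
  x <= 3 -> x <= 2 / (K.+1%:R * t) ->
  x <= 3 * (t <= h)%R%:R +
    \sum_(i < I) (t <= 2 ^+ i.+1 * h)%R%:R * (2 / (K.+1%:R * (2 ^+ i * h))).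
Proof.
move=> h0 t0 tI x3 xt.
have S0 (m : nat) : 0 <= \sum_(i < m) (t <= 2 ^+ i.+1 * h)%R%:R * (2 / (K.+1%:R * (2 ^+ i * h))).
  by apply: sumr_ge0 => i _; rewrite mulr_ge0 // divr_ge0 // !mulr_ge0 // ?exprn_ge0 // ltW.
case: (leP t h) => [_|ht]; first by rewrite mulr1 ler_wpDr.
rewrite mulr0 add0r; elim: I tI => [|I IH] tI; first by move: ht; rewrite ltNge -[h]mul1r tI.
rewrite big_ord_recr /=; case: (leP t (2 ^+ I * h)) => [/IH le|lt].
  by rewrite ler_wpDr // mulr_ge0 // divr_ge0 // !mulr_ge0 // ?exprn_ge0 // ltW.
rewrite tI mul1r; apply: (ler_wpDl (S0 I)); apply: le_trans xt _.
rewrite ler_pM2l // lef_pV2 ?posrE ?mulr_gt0 ?exprn_gt0 //.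
by rewrite ler_pM2l // ltW.
Qed.

(** Within 2^(i+1) h of 1 there are O(n 2^i h + M) points, each of weight 2 / ((K + 1) 2^i h). Every
    scale thus costs O(n / K), and the terms in M form a geometric series. The condition
    [2 <= 2 ^+ I * h] makes the last scale reach the whole disc. *)
Lemma sum_tail_le y h K I : regular y -> 0 < h -> 2 <= 2 ^+ I * h ->
  \sum_(w <- ws) `|arg1m (w * cis y) + \sum_(1 <= k < K.+1) complex.Im ((w * cis y) ^+ k) / k%:R|
  <= count_const * (3 * (n%:R * h + M) + (4 * n%:R * I%:R + 4 * M / h) / K.+1%:R).
Proof.
move=> ry h0 hI.
have K0 : 0 < K.+1%:R :> R by rewrite ltr0n.
apply: (@le_trans _ _ (\sum_(w <- ws) (3 * (nrm (1 - w * cis y) <= h)%R%:R +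
    \sum_(i < I) (nrm (1 - w * cis y) <= 2 ^+ i.+1 * h)%R%:R * (2 / (K.+1%:R * (2 ^+ i * h)))))).
  rewrite big_seq [leRHS]big_seq; apply: ler_sum => w wws.
  have w1 : nrm (w * cis y) <= 1 by rewrite nrmM nrm_cis mulr1 ws_le1.
  have wn1 : w * cis y != 1 by rewrite (allP ry).
  apply: dyadic_bound => //; [exact: delta_gt0| |exact: arg1m_tail_le3|exact: arg1m_tail].
  apply: le_trans hI; apply: le_trans (nrmD _ _) _; rewrite nrmN nrm1.
  by move: w1; lra.
rewrite big_split /= exchange_big /= -mulr_sumr.
have cntE d : \sum_(w <- ws) (nrm (1 - w * cis y) <= d)%R%:R = (near_count y d)%:R :> R.
  rewrite /near_count -sum1_count natr_sum [RHS]big_mkcond /=.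
  by apply: eq_bigr => w _; case: (_ <= _).
under eq_bigr do rewrite -mulr_suml cntE.
rewrite cntE mulrDr lerD //.
  by rewrite mulrCA ler_wpM2l // near_count_le.
apply: (@le_trans _ _ (\sum_(i < I) count_const * ((4 * n%:R + 2 * M / h * 2 ^- i) / K.+1%:R))).
  apply: ler_sum => i _; have p2 : 0 < 2 ^+ i :> R by rewrite exprn_gt0.
  have q0 : 0 <= 2 / (K.+1%:R * (2 ^+ i * h)) by rewrite divr_ge0 // !mulr_ge0 // ltW.
  apply: le_trans (ler_wpM2r q0 (near_count_le y (_ : 0 < 2 ^+ i.+1 * h))) _.
    by rewrite mulr_gt0 // exprn_gt0.
  rewrite -[leLHS]mulrA exprS ler_wpM2l ?(ltW count_const_gt0) // le_eqVlt; apply/orP; left; apply/eqP.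
  by field; rewrite !gt_eqF.
rewrite -mulr_sumr ler_wpM2l ?(ltW count_const_gt0) // -mulr_suml ler_wpM2r ?invr_ge0 ?(ltW K0) //.
rewrite big_split /= sumr_const card_ord -[_ *+ I]mulr_natr lerD2l -mulr_sumr.
have M0 := M_ge0; have -> : 4 * M / h = 2 * M / h * 2 by field; rewrite gt_eqF.
apply: ler_wpM2l; first by rewrite !mulr_ge0 // invr_ge0 ltW.
have : \sum_(i < I) 2 ^- i = 2 - 2 ^- I * 2 :> R.
  elim: (I) => [|J IH]; first by rewrite big_ord0 expr0 invr1 mul1r subrr.
  by rewrite big_ord_recr /= IH exprS; field; rewrite gt_eqF // exprn_gt0.
by move=> ->; rewrite gerBl mulr_ge0 // invr_ge0 exprn_ge0.
Qed.

Lemma partial_sum_le y h K I : regular y -> 0 < h -> 2 <= 2 ^+ I * h ->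
  `|\sum_(w <- ws) \sum_(1 <= k < K.+1) complex.Im ((w * cis y) ^+ k) / k%:R|
  <= M + count_const * (3 * (n%:R * h + M) + (4 * n%:R * I%:R + 4 * M / h) / K.+1%:R).
Proof.
move=> ry h0 hI.
have -> : \sum_(w <- ws) \sum_(1 <= k < K.+1) complex.Im ((w * cis y) ^+ k) / k%:R
  = \sum_(w <- ws) (arg1m (w * cis y) + \sum_(1 <= k < K.+1) complex.Im ((w * cis y) ^+ k) / k%:R)
    - total_arg y.
  by rewrite big_split /= addrC -/(total_arg y) addrK.
apply: le_trans (ler_normB _ _) _; rewrite addrC lerD //; first exact: total_arg_le.
by apply: le_trans (ler_norm_sum _ _ _) _; exact: sum_tail_le.
Qed.

End ZerosNearPoint.

(** * The factorization of [Lchi] *)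

Section LStructure.
Variables (R : realType) (F : finFieldType).
Hypothesis q_odd : odd #|F|.
Local Open Scope complex_scope.
Local Notation qR := (qR R F).

Definition Lpoly (D : {poly F}) (m : nat) : {poly R[i]} :=
  \poly_(n < m) (coefL (chi D) n)%:~R.

Variables (g : nat) (D : {poly F}).
Hypothesis hD : hyperelliptic g D.
Local Notation m := (2 * g).+1.

Lemma coef_Lpoly n : (Lpoly D m)`_n = (coefL (chi D) n)%:~R.
Proof.
have [Dm _ sD] := hD; rewrite coef_poly; case: ltnP => // mn.
by rewrite (@coefL_chi_vanish F q_odd D g).
Qed.

Lemma Lchi_horner u : Lchi D u = (Lpoly D m).[u].
Proof.
rewrite /Lchi; apply: (@lim_near_cst R[i]^o (@norm_hausdorff _ R[i]^o)).
exists m => // N /= mN.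
rewrite /series /= horner_poly.
rewrite (big_cat_nat _ (n := m)) //= [X in _ + X]big_nat [X in _ + X]big1 ?addr0; last first.
  move=> n /andP[mn _]; rewrite big_monics -/(coefL (chi D) n).
  by rewrite -coef_Lpoly nth_default ?mul0r // (leq_trans (size_poly _ _)).
rewrite big_mkord; apply: eq_bigr => n _.
by rewrite big_monics.
Qed.

Lemma qR_gt0 : 0 < qR. Proof. by rewrite ltr0n ltnW // finNzRing_gt1. Qed.

Lemma sqrt_qR_gt0 : 0 < Num.sqrt qR. Proof. by rewrite sqrtr_gt0 qR_gt0. Qed.

(** The w are the inverse zeros divided by sqrt q. The last clause compares the logarithmic
    derivatives of the series over primes and of the product over zeros. *)
Lemma L_structure : exists ws : seq R[i],
  [/\ (size ws <= 2 * g)%N, (forall w, w \in ws -> nrm w <= 1),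
      (forall u, Lchi D u = \prod_(w <- ws) (1 - w * ((Num.sqrt qR)%:C * u)))
    & (forall k, (0 < k)%N ->
        (coefLambda (chi D) k)%:~R = - ((Num.sqrt qR) ^+ k)%:C * power_sum ws k)].
Proof.
have [Dm _ sD] := hD.
have psiM f h : f \is monic -> h \is monic -> chi D (f * h) = chi D f * chi D h.
  by move=> fm hm; rewrite chiM ?monic_neq0.
have A0 : (Lpoly D m)`_0 = 1 by rewrite coef_Lpoly coefL0 // chi1.
have [al [sal LE]] := recip_poly_factor A0.
have cE k : (0 < k)%N -> (coefLambda (chi D) k)%:~R = - power_sum al k :> R[i].
  move=> k0; apply: (@newton_unique _ al (fun n => (coefL (chi D) n)%:~R)
     (fun n => (coefLambda (chi D) n)%:~R)) => //.
  - by rewrite coefL0 // chi1.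
  - move=> n; have := congr1 (fun z : int => z%:~R : R[i]) (coefL_convolution psiM n).
    rewrite /= rmorphM rmorph_nat => ->; rewrite rmorph_sum.
    by apply: eq_bigr => i _; rewrite rmorphM.
  by move=> n; rewrite -coef_Lpoly LE.
have s0 := sqrt_qR_gt0.
have q0 := qR_gt0.
have nal x : x \in al -> nrm x <= Num.sqrt qR.
  move=> xal.
  have : `|x| ^+ 2 <= qR%:C.
    apply: (@power_sum_bound R al (6 * m%:R) qR (5 * m)) => // k km.
    have k0 : (0 < k)%N by apply: leq_trans km; rewrite muln_gt0.
    have mk : (5 * m <= #|F| ^ k)%N.
      by rewrite (leq_trans km) // ltnW // ltn_expl // finNzRing_gt1.
    rewrite -normrN -cE ?muln_gt0 // -intr_norm.
    have := coefLambda_chi_bound q_odd Dm sD k0 mk; rewrite -(ler_int R[i]) => h.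
    apply: le_trans h _; rewrite le_eqVlt; apply/orP; left; apply/eqP.
    have -> : 6 * m%:R * qR ^+ k = (6 * m * #|F| ^ k)%:R :> R by rewrite !natrM natrX.
    by rewrite !rmorph_nat.
  rewrite nrmE -rmorphXn /= lecR -{1}(sqr_sqrtr (ltW q0)).
  by rewrite ler_pXn2r // nnegrE ?nrm_ge0 // ltW.
exists [seq x * (Num.sqrt qR)^-1%:C | x <- al].
have sn0 : (Num.sqrt qR)%:C != 0 by rewrite (inj_eq (@complexI R) _ 0) gt_eqF.
split.
- rewrite size_map sal; have := size_poly m (fun n => (coefL (chi D) n)%:~R : R[i]).
  by rewrite -/(Lpoly D m); case: size.
- move=> w /mapP[x xal ->]; rewrite nrmM nrmR ger0_norm ?invr_ge0 ?(ltW s0) //.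
  by rewrite ler_pdivrMr // mul1r nal.
- move=> u; rewrite Lchi_horner LE horner_prod big_map; apply: eq_bigr => x _.
  by rewrite hornerD hornerN hornerZ hornerX hornerC fmorphV /= -mulrA mulKf.
move=> k k0; rewrite cE // mulNr; congr (- _).
rewrite /power_sum big_map mulr_sumr; apply: eq_bigr => x _.
by rewrite exprMn mulrCA rmorphXn fmorphV /= exprVn mulfV ?mulr1 // expf_neq0.
Qed.

End LStructure.

(** * [Sfun] as a sum over the zeros *)

Section ArgChange.
Variable R : realType.
Local Open Scope complex_scope.
Implicit Types (w z : R[i]) (t x y theta : R).

Lemma cos_lt1 x : 0 < x <= pi -> cos x < 1.
Proof.
move=> /andP[x0 xpi]; rewrite -(cos0 R) ltr_cos ?in_itv /= ?lexx ?pi_ge0 //.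
by rewrite (ltW x0).
Qed.

(** If two determinations differed at b, their difference would by continuity take a value in (0,
    pi], where [cis] is not 1. *)
Lemma phase_unique (f : R -> R[i]) a b d1 d2 : a <= b ->
  arg_change f a b d1 -> arg_change f a b d2 -> d1 = d2.
Proof.
move=> ab [p1 [c1 s1 f1 ->]] [p2 [c2 s2 f2 ->]].
suff le (u v : R -> R) : {within `[a, b], continuous u} -> {within `[a, b], continuous v} ->
    u a = 0 -> v a = 0 ->
    (forall t, a <= t <= b -> exists2 r : R, 0 < r & f t = r%:C * cis (u t)) ->
    (forall t, a <= t <= b -> exists2 r : R, 0 < r & f t = r%:C * cis (v t)) -> u b <= v b.
  by apply/le_anti/andP; split; apply: le.
move=> cu cv u0 v0 fu fv; rewrite leNgt; apply/negP => lt.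
have ch : {within `[a, b], continuous (u \- v)} by move=> x; apply: continuousB; [exact: cu|exact: cv].
pose m := Num.min (u b - v b) pi.
have p0 := @pi_gt0 R.
have m0 : 0 < m <= pi by rewrite lt_min subr_gt0 lt p0 ge_min lexx orbT.
have [|c] := @IVT R (u \- v) a b m ab ch.
  rewrite /= u0 v0 subrr; have /andP[h _] := m0; apply/andP; split.
    by rewrite ge_min (ltW h).
  by rewrite le_max; apply/orP; right; rewrite /m ge_min lexx.
rewrite in_itv /= => hc hm.
have [r r0 e1] := fu c hc; have [r' r0' e2] := fv c hc.
have := e1; rewrite e2 => e.
have rr : r' = r.
  have := congr1 (@nrm R) e; rewrite !nrmM !nrm_cis !mulr1 !nrmR !gtr0_norm //.
have r0C : r%:C != 0 by rewrite (inj_eq (@complexI R) _ 0) gt_eqF.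
have {}e : cis (v c) = cis (u c) by apply: (mulfI r0C); rewrite -e rr.
have : cis m = 1.
  by rewrite -hm -(mulfV (cis_neq0 (v c))) {1}e; apply: (mulIf (cis_neq0 (v c)));
     rewrite -cisD subrK mulrAC e mulfK ?cis_neq0.
by rewrite /cis => -[h _]; have := cos_lt1 m0; rewrite h ltxx.
Qed.

Lemma prod_one_sub_polar (s : seq R[i]) : (forall z, z \in s -> complex.Re z < 1) ->
  exists2 r : R, 0 < r & \prod_(z <- s) (1 - z) = r%:C * cis (\sum_(z <- s) arg1m z).
Proof.
elim: s => [|z s IH] h; first by exists 1 => //; rewrite !big_nil cis0 mulr1.
have [|r r0 e] := IH; first by move=> z' hz; apply: h; rewrite inE hz orbT.
have [|r' r0' e'] := @arg1m_polar R z; first by apply: h; rewrite mem_head.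
exists (r' * r); first exact: mulr_gt0.
by rewrite !big_cons e e' cisD rmorphM /= mulrACA.
Qed.

(** Provides the initial value of the phase. The power sums being real, the Taylor polynomials at a
    real point contribute nothing in total, and their errors are O(1 / K). *)
Lemma total_arg_real_eq0 (ws : seq R[i]) x : 0 <= x < 1 ->
  (forall w, w \in ws -> nrm w <= 1) ->
  (forall k, (0 < k)%N -> complex.Im (power_sum ws k) = 0) ->
  \sum_(w <- ws) arg1m (w * x%:C) = 0.
Proof.
move=> /andP[x0 x1] ws1 ps0.
have wx w : w \in ws -> nrm (w * x%:C) <= x.
  by move=> /ws1 w1; rewrite nrmM nrmR ger0_norm // ler_piMl.
have small w : w \in ws -> nrm (w * x%:C) <= 1 by move=> /wx h; rewrite (le_trans h) // ltW.
have neq w : w \in ws -> w * x%:C != 1.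
  move=> /wx h; apply/eqP => e; move: h; rewrite e nrm1; lra.
have dl w : w \in ws -> 1 - x <= nrm (1 - w * x%:C).
  move=> /wx h; have := nrmD (1 - w * x%:C) (w * x%:C); rewrite subrK nrm1; lra.
have bound K : `|\sum_(w <- ws) arg1m (w * x%:C)| * K.+1%:R <= (size ws)%:R * (2 / (1 - x)).
  have K0 : 0 < K.+1%:R :> R by rewrite ltr0n.
  rewrite -ler_pdivlMr //.
  have -> : \sum_(w <- ws) arg1m (w * x%:C) = \sum_(w <- ws) (arg1m (w * x%:C) +
     \sum_(1 <= k < K.+1) complex.Im ((w * x%:C) ^+ k) / k%:R).
    rewrite big_split /= exchange_big /= [X in _ + X]big_nat [X in _ + X]big1 ?addr0 // => k /andP[k0 _].
    rewrite -mulr_suml -Im_sum (_ : \sum_(w <- ws) (w * x%:C) ^+ k = (x ^+ k)%:C * power_sum ws k).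
      by rewrite Im_real_mul ps0 // mulr0 mul0r.
    by rewrite /power_sum mulr_sumr; apply: eq_bigr => w _; rewrite exprMn mulrC rmorphXn.
  apply: le_trans (ler_norm_sum _ _ _) _.
  apply: (@le_trans _ _ (\sum_(w <- ws) (2 / (1 - x) / K.+1%:R))).
    rewrite big_seq [leRHS]big_seq; apply: ler_sum => w wws.
    apply: le_trans (arg1m_tail K (small w wws) (neq w wws)) _.
    rewrite -mulrA -invfM ler_pM2l // lef_pV2 ?posrE ?mulr_gt0 ?subr_gt0 ?delta_gt0 ?neq // mulrC.
    by rewrite ler_pM2l // dl.
  by rewrite big_const_seq count_predT iter_addr_0 -[_ *+ size ws]mulr_natl mulrA.
set S := \sum_(w <- ws) _ in bound *; apply/eqP; rewrite -normr_eq0; apply/eqP/le_anti.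
rewrite normr_ge0 andbT leNgt; apply/negP => S0.
pose B := (size ws)%:R * (2 / (1 - x)) / `|S|.
have B0 : 0 <= B by rewrite !mulr_ge0 // ?invr_ge0 ?subr_ge0 // ltW.
have := bound (Num.bound B); rewrite mulrC -ler_pdivlMr // -/B; apply/negP; rewrite -ltNge.
by apply: lt_le_trans (archi_boundP B0) _; rewrite ler_nat.
Qed.

End ArgChange.

Section LArgument.
Variables (R : realType) (F : finFieldType) (D : {poly F}) (ws : seq R[i]).
Local Open Scope complex_scope.
Implicit Types (t x y theta : R).
Local Notation qR := (qR R F).
Local Notation sq := (Num.sqrt qR).
Hypothesis ws_le1 : forall w, w \in ws -> nrm w <= 1.
Hypothesis Lprod : forall u, Lchi D u = \prod_(w <- ws) (1 - w * (sq%:C * u)).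
Hypothesis power_sum_real : forall k, (0 < k)%N -> complex.Im (power_sum ws k) = 0.

Lemma qR_gt1 : 1 < qR.
Proof. by rewrite /Defs.qR ltr1n finNzRing_gt1. Qed.

Lemma sq_gt1 : 1 < sq.
Proof.
have h : 0 < qR := lt_trans ltr01 qR_gt1.
by rewrite -sqrtr1 (ltr_sqrt _ h) qR_gt1.
Qed.

Lemma sq_gt0 : 0 < sq. Proof. exact: lt_trans ltr01 sq_gt1. Qed.

Lemma sq_scaled_critical theta : sq%:C * critical_point F theta = cis (2 * pi * theta).
Proof.
rewrite /critical_point /e2pi mulrA -rmorphM /= mulfV ?mul1r //.
by rewrite gt_eqF // sq_gt0.
Qed.

Lemma Lchi_critical theta :
  Lchi D (critical_point F theta) = \prod_(w <- ws) (1 - w * cis (2 * pi * theta)).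
Proof. by rewrite Lprod sq_scaled_critical. Qed.

Lemma regularE theta : regular ws (2 * pi * theta) = (Lchi D (critical_point F theta) != 0).
Proof.
rewrite Lchi_critical prodf_seq_neq0 /regular; apply: eq_all => w /=.
by rewrite subr_eq0 eq_sym.
Qed.

Section Path.
Variable theta : R.
Hypothesis reg : regular ws (2 * pi * theta).

(** Clamped by min and max so that the path is continuous on the whole line, while it agrees with
    [Gamma] scaled by sqrt q on [0, 2]. *)
Let radius t : R := sq * (qR ^- 2 + Num.min (Num.max 0 (t - 1)) 1 * (sq^-1 - qR ^- 2)).
Let angle t : R := 2 * pi * (Num.min t 1 * theta).
Let path t : R[i] := (radius t)%:C * cis (angle t).

Lemma sq_scaled_Gamma t : 0 <= t <= 2 -> sq%:C * Gamma F theta t = path t.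
Proof.
move=> /andP[t0 t2]; rewrite /Gamma /path /radius /angle /e2pi.
case: (leP t 1) => t1.
  rewrite [LHS]mulrA -rmorphM /=; congr (_%:C * cis _).
  by rewrite max_l ?subr_le0 // min_l // mul0r addr0.
rewrite [LHS]mulrA -rmorphM /=; congr (_%:C * cis _); last by rewrite mul1r.
rewrite max_r ?subr_ge0 ?(ltW t1) // min_l; first by ring.
by lra.
Qed.

Lemma radius_bounds t : 0 <= radius t <= 1 /\ (t < 2 -> radius t < 1).
Proof.
have s1 := sq_gt1; have s0 := sq_gt0.
have q1 := qR_gt1; have q0 : 0 < qR by apply: lt_trans q1.
have sE : sq * sq = qR by rewrite -expr2 sqr_sqrtr // ltW.
set c := Num.min (Num.max 0 (t - 1)) 1.
have c01 : 0 <= c <= 1 by rewrite /c le_min le_max ge_min !lexx ler01 ?orbT.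
have e1 : sq * qR ^- 2 < 1.
  have a : sq < qR by rewrite -[ltRHS]sE ltr_pMr.
  have b : qR < qR ^+ 2 by rewrite expr2 ltr_pMr.
  by rewrite ltr_pdivrMr ?exprn_gt0 // mul1r (lt_trans a).
have e0 : 0 < sq * qR ^- 2 by rewrite mulr_gt0 // invr_gt0 exprn_gt0.
have E : radius t = sq * qR ^- 2 + c * (1 - sq * qR ^- 2).
  rewrite /radius -/c; have : sq * sq^-1 = 1 by rewrite mulfV // gt_eqF.
  move: (qR ^- 2) (sq^-1) => a b h.
  have -> : sq * (a + c * (b - a)) = sq * a + c * (sq * b - sq * a) by ring.
  by rewrite h.
rewrite E; move: c01 => /andP[c0 c1]; split; first by nra.
move=> t2; have : c < 1 by rewrite /c gt_min gt_max ltr01 /=; apply/orP; left; lra.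
nra.
Qed.

Lemma radius_ge2 t : 2 <= t -> path t = cis (2 * pi * theta).
Proof.
move=> t2; rewrite /path /radius /angle max_r ?min_r; [|lra..].
rewrite !mul1r addrC subrK mulfV ?mul1r //.
by rewrite gt_eqF // sq_gt0.
Qed.

Lemma Re_path_lt1 w t : w \in ws -> complex.Re (w * path t) < 1.
Proof.
move=> wws; have w1 := ws_le1 wws.
have [t2|t2] := leP 2 t.
  rewrite radius_ge2 //; apply: Re_lt1; last exact: (allP reg).
  by rewrite nrmE lecR nrmM nrm_cis mulr1.
have [/andP[r0 r1] r1'] := radius_bounds t; have {}r1' := r1' t2.
apply: le_lt_trans (ler_norm _) _; apply: le_lt_trans (nrm_Re _) _.
rewrite /path !nrmM nrm_cis mulr1 nrmR ger0_norm //.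
by apply: le_lt_trans r1'; rewrite ler_piMl.
Qed.

Lemma radius_continuous : continuous radius.
Proof.
move=> t; rewrite /radius; apply: cvgM; first exact: cvg_cst.
apply: cvgD; first exact: cvg_cst; apply: cvgM; last exact: cvg_cst.
apply: (@continuous_min R R (fun t => Num.max 0 (t - 1)) (fun=> 1) t); last exact: cvg_cst.
apply: (@continuous_max R R (fun=> 0) (fun t => t - 1) t); first exact: cvg_cst.
by apply: cvgB; [exact: cvg_id|exact: cvg_cst].
Qed.

Lemma angle_continuous : continuous angle.
Proof.
move=> t; rewrite /angle; apply: cvgM; first exact: cvg_cst.
apply: cvgM; last exact: cvg_cst.
by apply: (@continuous_min R R id (fun=> 1) t); [exact: cvg_id|exact: cvg_cst].
Qed.

Lemma arg1m_path_continuous w : w \in ws -> continuous (fun t => arg1m (w * path t)).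
Proof.
move=> wws t; have h := Re_path_lt1 t wws.
have cc : cos (angle x) @[x --> t] --> cos (angle t).
  by apply: continuous_comp; [exact: angle_continuous|exact: continuous_cos].
have cs : sin (angle x) @[x --> t] --> sin (angle t).
  by apply: continuous_comp; [exact: angle_continuous|exact: continuous_sin].
have cr : radius x @[x --> t] --> radius t by exact: radius_continuous.
pose re x := radius x * (complex.Re w * cos (angle x) - complex.Im w * sin (angle x)).
pose im x := radius x * (complex.Re w * sin (angle x) + complex.Im w * cos (angle x)).
have reE x : complex.Re (w * path x) = re x.
  by rewrite /re /path /cis; case: (w) => a b; simpc => /=; ring.
have imE x : complex.Im (w * path x) = im x.
  by rewrite /im /path /cis; case: (w) => a b; simpc => /=; ring.
have E : (fun x => arg1m (w * path x)) = (fun x => atan (- im x / (1 - re x))).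
  by apply/funext => x; rewrite /arg1m reE imE.
rewrite E; apply: (@continuous_comp _ _ _ (fun x => - im x / (1 - re x)) (@atan R)).
  apply: cvgM.
    apply: cvgN; apply: cvgM => //; apply: cvgD; apply: cvgM => //; exact: cvg_cst.
  apply: cvgV; first by rewrite gt_eqF // subr_gt0 -reE.
  apply: cvgB; first exact: cvg_cst.
  apply: cvgM => //; apply: cvgB; apply: cvgM => //; exact: cvg_cst.
exact: continuous_atan.
Qed.

(** The sum of the principal arguments is itself a continuous determination, since Re (w u) stays
    below 1 for u on the scaled path up to its endpoint; by uniqueness it is the one selected by
    [xget]. *)
Lemma L_arg_changeE : L_arg_change D theta = total_arg ws (2 * pi * theta).
Proof.
have le02 : (0 : R) <= 2 by [].
pose phase t := \sum_(w <- ws) arg1m (w * path t).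
suff H : arg_change (fun t => Lchi D (Gamma F theta t)) 0 2 (total_arg ws (2 * pi * theta)).
  rewrite /L_arg_change; case: xgetP => [d _ hd|/(_ _ H) //].
  exact: phase_unique le02 hd H.
exists phase; split.
- have -> : phase = fun t => \sum_(w <- ws | w \in ws) arg1m (w * path t).
    by apply/funext => t; rewrite /phase big_seq.
  apply: continuous_subspaceT => t.
  apply: (@cvg_big R^o _ _ _ _ add_continuous).
  by move=> w wws; exact: arg1m_path_continuous.
- have [/andP[r0 _] r1] := radius_bounds 0; have r01 : 0 <= radius 0 < 1.
    by rewrite r0 r1.
  rewrite -[RHS](total_arg_real_eq0 r01 ws_le1 power_sum_real) /phase; apply: eq_bigr => w _.
  have a0 : angle 0 = 0 by rewrite /angle (min_l ler01) mul0r mulr0.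
  by rewrite /path a0 cis0 mulr1.
- move=> t ht; have [|r r0 e] := @prod_one_sub_polar R [seq w * path t | w <- ws].
    by move=> z /mapP[w wws ->]; exact: Re_path_lt1.
  exists r => //; move: e; rewrite !big_map => <-.
  by rewrite Lprod; apply: eq_bigr => w _; rewrite sq_scaled_Gamma.
by rewrite /phase /total_arg radius_ge2.
Qed.

End Path.

Lemma SfunE theta : regular ws (2 * pi * theta) ->
  Sfun D theta = - total_arg ws (2 * pi * theta) / pi.
Proof.
move=> reg; rewrite /Sfun /argL; move: (reg); rewrite regularE => /negbTE ->.
by rewrite L_arg_changeE.
Qed.

(* The bound on [S] is only used away from the zeros, where [S] is continuous. *)
Lemma total_arg_le_of_Sfun (B : R) : (forall theta : R, 0 <= theta <= 1 -> `|Sfun D theta| <= B) ->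
  forall y, regular ws y -> `|total_arg ws y| <= B * pi.
Proof.
move=> SB y ry; have p0 := @pi_gt0 R.
pose x := y / (2 * pi); pose theta := x - (Num.floor x)%:~R.
have tx : 0 <= theta <= 1.
  rewrite /theta subr_ge0 ge_floor /=.
  by have := lt_succ_floor x; rewrite lerBlDr intrD addrC => /ltW.
have ye : cis y = cis (2 * pi * theta).
  have -> : y = 2 * pi * theta + 2 * pi * (Num.floor x)%:~R.
    by rewrite -mulrDr subrK /x mulrC divfK // mulf_neq0 // gt_eqF.
  have per (z : int) : cis (2 * pi * z%:~R) = 1 :> R[i].
    have c2 : cis (2 * pi) = 1 :> R[i].
      by rewrite [2 * _]mulr_natl /cis cos2pi sin2pi.
    have pos n : cis (2 * pi * n%:R) = 1 :> R[i] by rewrite mulrC -cisX c2 expr1n.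
    case: z => n; first exact: pos.
    rewrite NegzE rmorphN /= mulrN; apply: (mulIf (cis_neq0 (2 * pi * n.+1%:R))).
    by rewrite -cisD addNr cis0 pos mulr1.
  by rewrite cisD per mulr1.
have tE : total_arg ws y = total_arg ws (2 * pi * theta) by rewrite /total_arg ye.
have rt : regular ws (2 * pi * theta) by move: ry; rewrite /regular ye.
have := SB theta tx; rewrite SfunE // tE normrM normrN (gtr0_norm (_ : 0 < pi^-1)) ?invr_gt0 //.
by rewrite ler_pdivrMr.
Qed.

End LArgument.

(** * A lower bound for [Sfun] *)

Section FourierLower.
Variable R : realType.
Variable ws : seq R[i].
Local Open Scope complex_scope.
Implicit Types (w : R[i]) (y d : R) (K N : nat).
Hypothesis ws_le1 : forall w, w \in ws -> nrm w <= 1.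
Hypothesis power_sum_real : forall k, (0 < k)%N -> complex.Im (power_sum ws k) = 0.
Variable M : R.
Hypothesis total_arg_le : forall y, regular ws y -> `|total_arg ws y| <= M.

Lemma unit_cis w : nrm w = 1 -> exists y, w * cis y = 1.
Proof.
move=> w1; have : complex.Re w ^+ 2 + complex.Im w ^+ 2 = 1 by rewrite -nrm_sqr w1 expr1n.
have := nrm_Re w; rewrite w1 ler_norml; case: w w1 => a b w1 /= ha e.
pose y := acos a; have ca : cos y = a by rewrite acosK // in_itv.
have sa : sin y = Num.sqrt (b ^+ 2) by rewrite sin_acos //; congr Num.sqrt; lra.
rewrite sqrtr_sqr in sa.
have cc x : cis x * cis (- x) = 1 :> R[i] by rewrite -cisD subrr cis0.
case: (leP 0 b) => b0; [exists (- y)|exists y].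
  have -> : a +i* b = cis y by rewrite /cis ca sa ger0_norm.
  exact: cc.
have -> : a +i* b = cis (- y) by rewrite /cis cosN sinN ca sa ltr0_norm // opprK.
by rewrite mulrC cc.
Qed.

(** At the angle of a zero on the circle [near_count] is at least 1 at every scale. In
    [near_count_small] a d with 16 n d at most half of [turn_const] leaves only M on the right. *)
Lemma turn_le_of_unit w : w \in ws -> nrm w = 1 -> turn_const R <= 4 * M.
Proof.
move=> wws /unit_cis[y wy].
have t0 := turn_const_gt0 R.
pose n := size ws.
have n0 : 0 <= n%:R :> R by [].
pose d := Num.min (1 / 16) (turn_const R / (32 * (n%:R + 1))).
have p : 0 < 32 * (n%:R + 1) :> R by rewrite mulr_gt0 // ltr_wpDl.
have d0 : 0 < d by rewrite lt_min !divr_gt0.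
have d1 : 16 * d <= 1.
  have : d <= 1 / 16 by rewrite ge_min lexx.
  lra.
have d2 : 32 * (n%:R + 1) * d <= turn_const R.
  have : d <= turn_const R / (32 * (n%:R + 1)) by rewrite ge_min lexx orbT.
  by rewrite ler_pdivlMr // mulrC.
have := @near_count_small R ws ws_le1 M total_arg_le y d d0 d1; rewrite -/n.
have c1 : 1 <= (near_count ws y d)%:R :> R.
  rewrite ler1n /near_count -has_count; apply/hasP; exists w => //.
  by rewrite wy subrr (nrmR 0) normr0 ltW.
have h2 := ler_peMl (ltW t0) c1 => h.
have e1 : 32 * (n%:R + 1) * d = 32 * (n%:R * d) + 32 * d by ring.
have e2 : 16 * n%:R * d = 16 * (n%:R * d) by ring.
by move: d2 h h2; rewrite e1 e2; move: (n%:R * d) (_ * turn_const R) => u v; lra.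
Qed.

Lemma sum_cis_eq0 N j : (0 < j < N)%N -> \sum_(l < N) cis (2 * pi * j%:R / N%:R * l%:R) = 0 :> R[i].
Proof.
move=> /andP[j0 jN]; set x := 2 * pi * j%:R / N%:R.
have N0 : 0 < N%:R :> R by rewrite ltr0n (leq_trans _ jN).
have j0' : 0 < j%:R :> R by rewrite ltr0n.
have p0 := @pi_gt0 R.
have c1 : cis x != 1 :> R[i].
  apply/eqP => /cis_eq1; have x0 : 0 < x by rewrite divr_gt0 ?mulr_gt0.
  have xu : x < 2 * pi by rewrite ltr_pdivrMr // ltr_pM2l ?mulr_gt0 // ltr_nat.
  have xr : - (2 * pi) < x < 2 * pi by apply/andP; split=> //; lra.
  by move=> /(_ xr) xe; move: x0; rewrite xe ltxx.
have xN : cis x ^+ N = 1 :> R[i].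
  rewrite cisX /x mulrC divfK ?gt_eqF // mulrC -cisX.
  by rewrite [2 * _]mulr_natl /cis cos2pi sin2pi expr1n.
apply: (@mulfI _ (1 - cis x)); first by rewrite subr_eq0 eq_sym.
rewrite mulr0 -[RHS](subrr 1) -[X in _ = 1 - X]xN -[in RHS](expr1n _ N) subrXX; congr (_ * _).
by apply: eq_bigr => l _; rewrite expr1n mul1r cisX mulrC.
Qed.

Lemma sum_cos N j : (j < N)%N -> \sum_(l < N) cos (2 * pi * j%:R / N%:R * l%:R) = (N * (j == 0))%:R :> R.
Proof.
case: j => [|j] jN.
  rewrite eqxx muln1 (eq_bigr (fun=> 1)) => [|l _]; last by rewrite mulr0 !mul0r cos0.
  by rewrite sumr_const card_ord.
rewrite muln0 -[RHS](_ : complex.Re (0 : R[i]) = 0) // -(sum_cis_eq0 (N := N) (j := j.+1)) //.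
have Re_sum : forall (I : finType) (G : I -> R[i]), complex.Re (\sum_i G i) = \sum_i complex.Re (G i).
  by move=> I G; apply: (big_morph (fun z : R[i] => complex.Re z)) => // [[? ?] [? ?]].
by rewrite Re_sum.
Qed.

(* With no zero on the circle the partial sums of [total_arg] converge uniformly,
   and the first sine coefficient is read off at the [N]-th roots of unity. *)
Lemma first_coefficient_le : (forall w, w \in ws -> nrm w < 1) -> nrm (power_sum ws 1) <= 2 * M.
Proof.
move=> ws1; pose n := size ws.
have [e e0 he] : exists2 e : R, 0 < e & forall w, w \in ws -> e <= 1 - nrm w.
  elim: (ws) ws1 => [|w s IH] h; first by exists 1.
  have [|e e0 he] := IH; first by move=> v vs; apply: h; rewrite inE vs orbT.
  have w1 := h w (mem_head _ _).
  exists (Num.min e (1 - nrm w)); first by rewrite lt_min e0 subr_gt0.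
  move=> v; rewrite inE => /predU1P[->|/he h']; first by rewrite ge_min lexx orbT.
  by rewrite ge_min h'.
have wy w y : w \in ws -> nrm (w * cis y) = nrm w by rewrite nrmM nrm_cis mulr1.
have reg y : regular ws y.
  apply/allP => w wws; apply/eqP => e1; have := ws1 w wws.
  by rewrite -(wy w y wws) e1 nrm1 ltxx.
have dl w y : w \in ws -> e <= nrm (1 - w * cis y).
  move=> wws; have := nrmD (1 - w * cis y) (w * cis y); rewrite subrK nrm1 wy //.
  by have := he w wws; lra.
pose r k := complex.Re (power_sum ws k).
have rE k : (0 < k)%N -> power_sum ws k = (r k)%:C.
  by move=> k0; rewrite /r {1}[power_sum ws k]complexE power_sum_real // mulr0 addr0.
pose h K y := \sum_(1 <= k < K.+1) r k / k%:R * sin (k%:R * y).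
have hE K y : h K y = \sum_(w <- ws) \sum_(1 <= k < K.+1) complex.Im ((w * cis y) ^+ k) / k%:R.
  rewrite exchange_big /= /h [LHS]big_nat [RHS]big_nat; apply: eq_bigr => k /andP[k0 _].
  rewrite -mulr_suml -Im_sum (_ : \sum_(w <- ws) (w * cis y) ^+ k = power_sum ws k * cis (k%:R * y)).
    by rewrite rE // Im_real_mul /= mulrAC.
  by rewrite /power_sum mulr_suml; apply: eq_bigr => w _; rewrite exprMn cisX.
have hle K y : `|h K y| <= M + n%:R * (2 / (K.+1%:R * e)).
  have -> : h K y = \sum_(w <- ws) (arg1m (w * cis y) + \sum_(1 <= k < K.+1) complex.Im ((w * cis y) ^+ k) / k%:R)
    - total_arg ws y.
    by rewrite hE big_split /= addrC -/(total_arg ws y) addrK.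
  apply: le_trans (ler_normB _ _) _; rewrite addrC lerD //; first exact: total_arg_le.
  apply: le_trans (ler_norm_sum _ _ _) _.
  apply: (@le_trans _ _ (\sum_(w <- ws) 2 / (K.+1%:R * e))); last first.
    by rewrite big_const_seq count_predT iter_addr_0 -[_ *+ size ws]mulr_natl.
  rewrite big_seq [leRHS]big_seq; apply: ler_sum => w wws.
  have w1 : nrm (w * cis y) <= 1 by rewrite wy // ws_le1.
  have wn : w * cis y != 1 by rewrite (allP (reg y)).
  apply: le_trans (arg1m_tail K w1 wn) _.
  by rewrite ler_pM2l // lef_pV2 ?posrE ?mulr_gt0 ?delta_gt0 // ler_pM2l // dl.
have main K : (0 < K)%N -> `|r 1| <= 2 * (M + n%:R * (2 / (K.+1%:R * e))).
  (* The product sin (k y) sin y is a difference of cosines of frequencies k - 1 and k + 1, and N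
     exceeds k + 1 for all k <= K, so there is no aliasing. *)
  move=> K0; pose N := K.+2; have N0 : 0 < N%:R :> R by rewrite ltr0n.
  pose y (l : 'I_N) : R := 2 * pi / N%:R * l%:R.
  have key : \sum_(l < N) h K (y l) * sin (y l) = r 1 * (N%:R / 2).
    rewrite /h; under eq_bigr do rewrite mulr_suml.
    have sk k : (0 < k < K.+1)%N -> \sum_(l < N) r k / k%:R * sin (k%:R * y l) * sin (y l) =
        r k / k%:R * ((N * (k == 1%N))%:R / 2).
      move=> /andP[k0 kK]; rewrite -(eq_bigr _ (fun _ _ => mulrA _ _ _)) -mulr_sumr; congr (_ * _).
      have kE : (k.-1 == 0%N) = (k == 1%N) by case: (k) k0 => [|[]].
      have l1 : (k.-1 < N)%N by rewrite /N; lia.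
      have l2 : (k.+1 < N)%N by rewrite /N; lia.
      have -> : (N * (k == 1%N))%:R / 2 = ((N * (k.-1 == 0%N))%:R - (N * (k.+1 == 0%N))%:R) / 2 :> R.
        by rewrite kE muln0 subr0.
      rewrite -(sum_cos l1) -(sum_cos l2) -sumrB mulr_suml; apply: eq_bigr => l _.
      have -> : 2 * pi * k.-1%:R / N%:R * l%:R = k%:R * y l - y l.
        by rewrite /y -{2}(prednK k0) -natr1; ring.
      have -> : 2 * pi * k.+1%:R / N%:R * l%:R = k%:R * y l + y l.
        by rewrite /y -natr1; ring.
      by rewrite cosB cosD; field.
    rewrite exchange_big /= big_ltn // sk // divr1 muln1.
    rewrite [X in _ + X]big_nat [X in _ + X]big1 ?addr0 // => k /andP[k1 kK].
    by rewrite sk ?(ltn_trans _ k1) // (gtn_eqF k1) muln0 mul0r mulr0.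
  have : `|r 1 * (N%:R / 2)| <= N%:R * (M + n%:R * (2 / (K.+1%:R * e))).
    rewrite -key; apply: le_trans (ler_norm_sum _ _ _) _.
    apply: (@le_trans _ _ (\sum_(l < N) (M + n%:R * (2 / (K.+1%:R * e))))).
      apply: ler_sum => l _; rewrite normrM; apply: le_trans (hle K (y l)).
      by rewrite ler_piMr // sin_max.
    by rewrite sumr_const card_ord -[_ *+ _]mulr_natl.
  rewrite normrM (ger0_norm (_ : 0 <= N%:R / 2)) ?divr_ge0 // mulrCA ler_pM2l //.
  by rewrite ler_pdivrMr // mulrC.
have -> : nrm (power_sum ws 1) = `|r 1| by rewrite rE // nrmR.
rewrite leNgt; apply/negP => lt.
pose gap := `|r 1| - 2 * M; have gap0 : 0 < gap by rewrite subr_gt0.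
have b0 : 0 <= 4 * n%:R / (e * gap) by rewrite divr_ge0 // mulr_ge0 // ltW.
pose K := (Num.bound (4 * n%:R / (e * gap))).+1.
have := main K isT; apply/negP; rewrite -ltNge.
have : 4 * n%:R / (e * gap) < K.+1%:R.
  apply: lt_le_trans (archi_boundP b0) _; rewrite ler_nat; lia.
have K0 : 0 < K.+1%:R :> R by rewrite ltr0n.
rewrite ltr_pdivrMr ?mulr_gt0 // => h1.
have -> : 2 * (M + n%:R * (2 / (K.+1%:R * e))) = 2 * M + 4 * n%:R / (K.+1%:R * e).
  by field; rewrite !gt_eqF.
rewrite -ltrBrDl ltr_pdivrMr ?mulr_gt0 // -/gap.
by apply: lt_le_trans h1 _; rewrite le_eqVlt; apply/orP; left; apply/eqP; ring.
Qed.

End FourierLower.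

Section SLower.
Variables (R : realType) (F : finFieldType).
Hypothesis q_odd : odd #|F|.
Local Open Scope complex_scope.
Local Notation sq := (Num.sqrt (qR R F)).

Lemma hyperelliptic_irreducible (P : {poly F}) g :
  monic_irreducible_poly P -> size P = (2 * g).+2 -> hyperelliptic g P.
Proof.
move=> hP sP; split=> //; first exact: hP.2.
move=> p p1; apply/negP => pP.
have e : p %= P by apply: hP.1.2; [rewrite gtn_eqF|apply: dvdp_trans pP; rewrite exprS dvdp_mulr].
have := dvdp_leq (mip_neq0 hP) pP; rewrite -(eqp_size e) leqNgt expr2 size_mul.
  by move: (size (polyseq p)) p1 => a; lia.
all: by rewrite -size_poly_gt0 ltnW.
Qed.

(* [c_1] is a sum of [#|F|] signs, and [#|F|] is odd. *)
Lemma coefLambda_chi1_neq0 (P : {poly F}) g : (0 < g)%N ->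
  monic_irreducible_poly P -> size P = (2 * g).+2 -> coefLambda (chi P) 1 != 0.
Proof.
move=> g0 hP sP; have [-> E] := @coefLambda_chi_split F P 1 isT.
have w0 : prime_weight P 1 0 = 0%N.
  rewrite /prime_weight big_seq_cond big1 // => Q /andP[].
  rewrite mem_primes_le => /andP[/asboolP hQ _] /andP[dQ].
  rewrite expf_eq0 chi_prime // => /andP[_ l0].
  have QP : Q %| P by move: l0; rewrite /legendre; case: ifP => // _; case: ifP.
  have e : Q %= P by apply: hP.1.2; rewrite // gtn_eqF // hQ.1.1.
  by move: dQ; rewrite /deg_dvd (eqp_size e) sP dvdn1; lia.
move: E; rewrite w0 add0n expn1 => E; rewrite subr_eq0 eqr_nat; apply/eqP => ee.
by move: q_odd; rewrite -E ee addnn odd_double.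
Qed.

Lemma power_sum_real_of (D : {poly F}) (ws : seq R[i]) :
  (forall k, (0 < k)%N ->
     (coefLambda (chi D) k)%:~R = - (sq ^+ k)%:C * power_sum ws k) ->
  forall k, (0 < k)%N -> complex.Im (power_sum ws k) = 0.
Proof.
move=> hc k k0; have := congr1 (fun z : R[i] => complex.Im z) (hc k k0).
rewrite -(rmorph_int (real_complex R)) mulNr ImN Im_real_mul /= => /esym/eqP.
rewrite oppr_eq0 mulf_eq0 expf_eq0 [sq == 0]gt_eqF ?andbF //=; first by move/eqP.
exact: sqrt_qR_gt0.
Qed.

(** As B serves for all D of the given degree, an irreducible D may be chosen. Then either
    [turn_const] <= 4 pi B, or 1 <= |c_1| <= 2 pi B sqrt q, and the constant is read off from these
    two inequalities. *)
Lemma S_lower_bound : exists2 kappa : R, 0 < kappa & forall g (B : R), (0 < g)%N ->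
  (forall (D : {poly F}) (theta : R), hyperelliptic g D -> 0 <= theta <= 1 ->
     `|Sfun D theta| <= B) -> kappa <= B.
Proof.
have p0 := @pi_gt0 R; have s0 := sqrt_qR_gt0 R F; have t0 := turn_const_gt0 R.
exists (Num.min (turn_const R / 4) (1 / (2 * sq)) / pi).
  by rewrite divr_gt0 // lt_min !divr_gt0 // mulr_gt0.
move=> g B g0 SB.
have [|P [hP sP]] := @exists_irreducible F (2 * g).+1; first by [].
have hD := hyperelliptic_irreducible hP sP.
have [ws [_ ws1 Lp hc]] := L_structure R q_odd hD.
have psr := power_sum_real_of hc.
have Mle := total_arg_le_of_Sfun ws1 Lp psr (fun theta => SB P theta hD).
rewrite ler_pdivrMr // ge_min.
have [/hasP[w wws /eqP w1]|/hasPn nu] := boolP (has (fun w => nrm w == 1) ws).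
  by have := turn_le_of_unit ws1 Mle wws w1; rewrite ler_pdivrMr // mulrC => ->.
have ws1' w : w \in ws -> nrm w < 1 by move=> h; rewrite lt_neqAle nu // ws1.
have := first_coefficient_le ws1 psr Mle ws1'.
have := congr1 (@nrm R) (hc 1%N isT).
rewrite -(rmorph_int (real_complex R)) nrmM nrmN !nrmR expr1 (ger0_norm (ltW s0)) => e h.
apply/orP; right; rewrite ler_pdivrMr ?mulr_gt0 //.
have : 1 <= `|(coefLambda (chi P) 1)%:~R| :> R.
  rewrite -intr_norm ler1z -gtz0_ge1 normr_gt0.
  exact: coefLambda_chi1_neq0 hP sP.
by rewrite e; nra.
Qed.

End SLower.

(** * Zeros of [FK] *)

Section ZeroCount.
Variable R : realType.
Local Open Scope complex_scope.

Lemma counting_ge (T : choiceType) (A : set T) (m : nat) (s : 'I_m -> T) :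
  injective s -> (forall i, A (s i)) -> ((m%:R : R)%:E <= counting A)%E.
Proof.
move=> si sA; rewrite /counting; case: asboolP => [fA|_]; last by rewrite leey.
rewrite lee_fin ler_nat -[X in (X <= _)%N](card_ord m) cardE -(size_map s).
apply: uniq_leq_size; first by rewrite map_inj_uniq // enum_uniq.
by move=> x /mapP[i _ ->]; rewrite in_fset_set // inE.
Qed.

Variables (F : finFieldType) (D : {poly F}) (ws : seq R[i]) (g K : nat).
Local Notation qR := (qR R F).
Local Notation sq := (Num.sqrt qR).
Hypothesis Lambda_power_sum : forall k, (0 < k)%N ->
  (coefLambda (chi D) k)%:~R = - (sq ^+ k)%:C * power_sum ws k.
Implicit Types (theta y : R) (u : R[i]).

Let r k := complex.Re (power_sum ws k).

(** The argument of P_K at q^(-1/2) e(theta) for y = 2 pi theta, as the imaginary part of the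
    exponent. *)
Definition euler_arg y : R := - \sum_(1 <= k < K.+1) r k / k%:R * sin (k%:R * y).

Lemma power_sumE k : (0 < k)%N -> power_sum ws k = (r k)%:C.
Proof.
move=> k0; rewrite /r {1}[power_sum ws k]complexE (power_sum_real_of Lambda_power_sum) //.
by rewrite mulr0 addr0.
Qed.

Definition logPK u : R[i] := \sum_(1 <= k < K.+1) (coefLambda (chi D) k)%:~R * u ^+ k / k%:R.

Lemma PKE u : PK K D u = cexp (logPK u).
Proof.
rewrite /PK /logPK; congr cexp; apply: eq_bigr => k _.
rewrite /coefLambda rmorph_sum !mulr_suml -big_monics; apply: eq_bigr => h _.
by rewrite rmorphM rmorph_nat.
Qed.

Lemma logPK_conj u : logPK u^* = (logPK u)^*.
Proof.
rewrite /logPK rmorph_sum; apply: eq_bigr => k _.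
by rewrite !rmorphM /= fmorphV rmorphXn /= rmorph_int conjc_nat.
Qed.

Lemma Im_logPK theta : complex.Im (logPK (critical_point F theta)) = euler_arg (2 * pi * theta).
Proof.
rewrite /logPK Im_sum /euler_arg -sumrN big_nat [RHS]big_nat.
apply: eq_bigr => k /andP[k0 _].
have -> : (coefLambda (chi D) k)%:~R * critical_point F theta ^+ k / k%:R
   = (- (r k / k%:R))%:C * cis (k%:R * (2 * pi * theta)).
  rewrite Lambda_power_sum // power_sumE // -cisX -(sq_scaled_critical F) [in RHS]exprMn.
  have kE : (k%:R : R)%:C = k%:R := rmorph_nat (real_complex R) k.
  rewrite [in RHS]rmorphN [in RHS]rmorphM [in RHS]fmorphV /= kE rmorphXn /=.
  by move: (sq%:C ^+ k) (critical_point F theta ^+ k) => a b; ring.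
by rewrite Im_real_mul /= mulNr.
Qed.

Lemma euler_argE y : euler_arg y =
  - \sum_(w <- ws) \sum_(1 <= k < K.+1) complex.Im ((w * cis y) ^+ k) / k%:R.
Proof.
rewrite exchange_big /= /euler_arg [in LHS]big_nat [in RHS]big_nat; congr (- _).
apply: eq_bigr => k /andP[k0 _].
rewrite -mulr_suml -Im_sum (_ : \sum_(w <- ws) (w * cis y) ^+ k = power_sum ws k * cis (k%:R * y)).
  by rewrite power_sumE // Im_real_mul /= mulrAC.
by rewrite /power_sum mulr_suml; apply: eq_bigr => w _; rewrite exprMn cisX.
Qed.

(** The exponent of P_K has real coefficients, so the two terms of F_K have equal modulus and phases
    E and 4 pi g theta - E. They cancel when these differ by an odd multiple of pi. *)
Lemma FK_eq0 theta (i : nat) :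
  (2 * g)%:R * theta - euler_arg (2 * pi * theta) / pi = i%:R + 1 / 2 ->
  FK g K D (critical_point F theta) = 0.
Proof.
move=> h; rewrite /FK !PKE logPK_conj.
set W := logPK _; have WE : complex.Im W = euler_arg (2 * pi * theta) by exact: Im_logPK.
have -> : qR%:C * critical_point F theta ^+ 2 = cis (2 * (2 * pi * theta)).
  rewrite -cisX -(sq_scaled_critical F) [in RHS]exprMn -rmorphXn /= sqr_sqrtr //.
rewrite cisX /cexp.
have -> : complex.Re W^* = complex.Re W by case: (W).
have -> : complex.Im W^* = - complex.Im W by case: (W).
rewrite mulrCA -mulrDr -cisD WE.
set e := euler_arg _ in h *.
have -> : g%:R * (2 * (2 * pi * theta)) - e = e + (pi + i%:R * (2 * pi)).
  have p0 : pi != 0 :> R by rewrite gt_eqF ?pi_gt0.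
  have -> : g%:R * (2 * (2 * pi * theta)) = 2 * pi * ((2 * g)%:R * theta) by rewrite natrM; ring.
  have -> : (2 * g)%:R * theta = e / pi + (i%:R + 1 / 2) by rewrite -h addrC subrK.
  by move: (e) (pi : R) p0 => a p p0; field.
rewrite !(cisD e) cisD -(cisX (2 * pi) i) (_ : cis (2 * pi) = 1) ?expr1n ?mulr1; last first.
  by rewrite [2 * _]mulr_natl /cis cos2pi sin2pi.
have -> : cis pi = -1 :> R[i] by rewrite /cis cospi sinpi complexr0 rmorphN1.
by rewrite mulrN1 subrr !mulr0.
Qed.

Lemma euler_arg_continuous : continuous (fun theta => euler_arg (2 * pi * theta)).
Proof.
move=> t; rewrite /euler_arg; apply: cvgN.
apply: (@cvg_big R^o _ _ _ _ add_continuous) => k _.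
apply: cvgM; first exact: cvg_cst.
apply: (@continuous_comp _ _ _ (fun x => k%:R * (2 * pi * x)) (@sin R)).
  apply: cvgM; first exact: cvg_cst.
  by apply: cvgM; [exact: cvg_cst|exact: cvg_id].
exact: continuous_sin.
Qed.

Lemma NK_ge0 theta : (0 <= NK g K D theta :> \bar R)%E.
Proof.
have : ((0%:R : R)%:E <= NK g K D theta)%E by apply: (@counting_ge _ _ 0 (fun=> 0)) => -[].
exact.
Qed.

(** The function f starts at 0 and takes every value i + 1/2 up to f(x0); different values occur at
    different points of [0, 1), hence at different u. A separate [x0] is allowed because the
    argument is controlled only at regular points. *)
Lemma NK_ge x0 theta : 0 <= x0 -> x0 <= theta -> theta < 1 ->
  (((2 * g)%:R * x0 - euler_arg (2 * pi * x0) / pi - 1 / 2)%:E <= NK g K D theta)%E.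
Proof.
move=> t0 x0t t1.
pose f x : R := (2 * g)%:R * x - euler_arg (2 * pi * x) / pi.
rewrite -/(f x0); have [neg|pos] := leP (f x0 - 1 / 2) 0.
  apply: (@le_trans _ _ 0%E); first by rewrite lee_fin.
  exact: NK_ge0.
have cf : {within `[0, x0], continuous f}.
  apply: continuous_subspaceT => x; apply: cvgB.
    by apply: cvgM; [exact: cvg_cst|exact: cvg_id].
  by apply: cvgM; [exact: euler_arg_continuous|exact: cvg_cst].
have f0 : f 0 = 0.
  rewrite /f mulr0 mulr0 /euler_arg big1 => [|k _]; last by rewrite mulr0 sin0 mulr0.
  by rewrite oppr0 mul0r subr0.
have fm : 0 <= f x0 + 1 / 2 by lra.
have [m mle mlt] : exists2 m : nat, m%:R <= f x0 + 1 / 2 & f x0 + 1 / 2 < m%:R + 1.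
  exists (Num.truncn (f x0 + 1 / 2)); first by rewrite truncn_le.
  by rewrite natr1; exact: truncnS_gt.
have sol (i : 'I_m) : exists x, [/\ 0 <= x, x <= x0 & f x = i%:R + 1 / 2].
  have im : i%:R + 1 <= m%:R :> R by rewrite natr1 ler_nat.
  have [|x] := @IVT R f 0 x0 (i%:R + 1 / 2) t0 cf; last first.
    by rewrite in_itv /= => /andP[? ?] ?; exists x.
  rewrite f0 ge_min le_max; have i0 : 0 <= i%:R :> R by [].
  apply/andP; split; apply/orP; [left|right].
    by move: (i%:R) i0 => a a0; lra.
  by move: (i%:R) (m%:R) (f x0) im mle => a b c ? ?; lra.
have [x xP] := choice sol.
apply: (@le_trans _ _ (m%:R)%:E).
  by rewrite lee_fin; move: (f x0) (m%:R) mlt => a b ?; lra.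
apply: (@counting_ge _ _ m (fun i => critical_point F (x i))).
  move=> i j e; have [xi0 xi1 fi] := xP i; have [xj0 xj1 fj] := xP j.
  have p0 := @pi_gt0 R.
  have : cis (2 * pi * x i) = cis (2 * pi * x j) by rewrite -!(sq_scaled_critical F) e.
  move=> /cis_inj E; have {}E : 2 * pi * x i = 2 * pi * x j.
    by apply: E; rewrite -mulrBr; move: (x i) (x j) xi0 xi1 xj0 xj1 => a b ? ? ? ?; apply/andP; split; nra.
  have xe : x i = x j by apply: (mulfI (_ : 2 * pi != 0)) E; rewrite mulf_neq0 // gt_eqF.
  by apply/val_inj/eqP; rewrite -(eqr_nat R); apply/eqP/(addIr (1 / 2)); rewrite -fi -fj xe.
move=> i; have [xi0 xi1 fi] := xP i; split.
  by exists (x i); rewrite ?xi0 ?(le_trans xi1).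
exact: FK_eq0 fi.
Qed.

End ZeroCount.

(** * Choice of the scale and conclusion *)

Section MainBound.
Variables (R : realType) (F : finFieldType).
Hypothesis q_odd : odd #|F|.

Lemma NK_lower_bound (g K I : nat) (D : {poly F}) (B h theta : R) :
  hyperelliptic g D -> (0 < g)%N -> 0 < h -> 2 <= 2 ^+ I * h ->
  (forall theta : R, 0 <= theta <= 1 -> `|Sfun D theta| <= B) -> 0 <= theta < 1 ->
  (((2 * g)%:R * theta - 3 / 2 - (B * pi + count_const R * (3 * ((2 * g)%:R * h + B * pi)
      + (4 * (2 * g)%:R * I%:R + 4 * (B * pi) / h) / K.+1%:R)))%:E <= NK g K D theta)%E.
Proof.
move=> hD g0 h0 hI SB /andP[t0 t1].
have p0 := @pi_gt0 R; have p2 := @pi_ge2 R; have c0 := count_const_gt0 R.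
have [ws [sws ws1 Lprod Lam]] := L_structure R q_odd hD.
have B0 : 0 <= B by apply: le_trans (SB 0 _); rewrite ?lexx ?ler01.
have tal := total_arg_le_of_Sfun ws1 Lprod (power_sum_real_of Lam) SB.
have G0 : 0 < (2 * g)%:R :> R by rewrite ltr0n muln_gt0.
set bd := B * pi + _.
have k0 : 0 < K.+1%:R :> R by rewrite ltr0n.
have bd0 : 0 <= bd.
  have [p0' h0' c0'] := And3 (ltW p0) (ltW h0) (ltW c0).
  have i0 : 0 <= h^-1 by rewrite invr_ge0.
  have K0 : 0 <= K.+1%:R^-1 :> R by rewrite invr_ge0 ltW.
  have Bp : 0 <= B * pi by exact: mulr_ge0.
  by rewrite /bd addr_ge0 // mulr_ge0 // addr_ge0 // ?mulr_ge0 // addr_ge0 // ?mulr_ge0 //.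
have pb y : regular ws y -> `|euler_arg ws K y| <= bd.
  move=> ry; rewrite (euler_argE K Lam) normrN.
  apply: le_trans (partial_sum_le ws1 tal K ry h0 hI) _.
  rewrite lerD2l ler_pM2l //; apply: lerD.
    by rewrite ler_pM2l // lerD2r ler_pM2r // ler_nat.
  by rewrite ler_pM2r ?invr_gt0 // lerD2r ler_wpM2r // ler_pM2l // ler_nat.
(* If 2 g theta <= 1 the lower bound is negative. Otherwise a regular point within 1 / (2g) below
   theta loses at most 1, which together with the 1/2 of [NK_ge] makes 3/2. *)
have [small|big] := leP ((2 * g)%:R * theta) 1.
  apply: (le_trans _ (NK_ge0 D g K theta)); rewrite lee_fin; move: (_ * theta) (bd) small bd0 => a b; lra.
pose u := theta - 1 / (2 * g)%:R.
have u0 : 0 < u by rewrite subr_gt0 ltr_pdivrMr // mulrC.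
have ut : u < theta by rewrite gtrBl divr_gt0.
have [y [uy yt ry]] : exists y, [/\ 2 * pi * u < y, y < 2 * pi * theta & regular ws y].
  apply: exists_regular; first by rewrite ltr_pM2l ?mulr_gt0.
  by rewrite -mulrBr gtr_pMr ?mulr_gt0 //; move: u0 t1; lra.
pose x := y / (2 * pi).
have yx : y = 2 * pi * x by rewrite /x mulrC divfK // mulf_neq0 // gt_eqF.
have ux : u < x by move: uy; rewrite yx ltr_pM2l ?mulr_gt0.
have xt : x < theta by move: yt; rewrite yx ltr_pM2l ?mulr_gt0.
apply: le_trans (NK_ge g K Lam (ltW (lt_trans u0 ux)) (ltW xt) t1).
rewrite lee_fin -yx.
have e1 : euler_arg ws K y / pi <= bd.
  rewrite ler_pdivrMr //; apply: le_trans (ler_norm _) _; apply: le_trans (pb _ ry) _.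
  by rewrite ler_peMr //; move: p2; lra.
have e2 : (2 * g)%:R * theta - 1 <= (2 * g)%:R * x.
  rewrite lerBlDl -lerBlDr -mulrBr -ler_pdivlMl // mulr1.
  by move: ux; rewrite /u div1r; lra.
by move: (_ / pi) (_ * x) (_ * theta) e1 e2 => a b c; lra.
Qed.

Lemma theorem15_bound (Phi : nat -> R) (A kappa : R) : 0 < kappa -> 0 < A ->
  exists C : R, forall (g : nat) (D : {poly F}) (K : nat) (theta : R),
  hyperelliptic g D -> (0 < g)%N -> 1 <= ln g%:R :> R -> kappa <= Phi g ->
  (forall theta : R, 0 <= theta <= 1 -> `|Sfun D theta| <= A * Phi g) ->
  g%:R * ln g%:R / Phi g <= K%:R -> 0 <= theta < 1 ->
  (((2 * g)%:R * theta - C * Phi g)%:E <= NK g K D theta)%E.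
Proof.
move=> k0 A0; have p0 := @pi_gt0 R; have c0 := count_const_gt0 R.
have l20 : 0 < ln 2 :> R by rewrite ln_gt0 // ltr1n.
(* As Phi(g) >= kappa, 2^I0 Phi(g) >= 2, so I0 + O(log g) doublings lead from h = Phi(g) / g past
   2. *)
pose I0 := Num.bound (2 / kappa).
have I0P : 2 / kappa <= 2 ^+ I0.
  apply: le_trans (ltW (archi_boundP _)) _; first by rewrite divr_ge0 // ltW.
  by rewrite -natrX ler_nat ltnW // ltn_expl.
pose c := (ln 2)^-1 + 1 + I0%:R : R.
(* Each term is compared with Phi(g): the constant 3/2 through kappa, the finest scale through g h =
   Phi(g), and the remaining scales through I <= c log g and g log g <= Phi(g) (K + 1). *)
exists (3 / 2 / kappa + (A * pi + count_const R * (3 * (2 + A * pi) + (8 * c + 4 * A * pi)))).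
move=> g D K theta hD g0 lg kP SB hK ht.
have P0 : 0 < Phi g by exact: lt_le_trans kP.
set P := Phi g in kP SB hK P0 *.
have G0 : 0 < g%:R :> R by rewrite ltr0n.
pose I := ((trunc_log 2 g).+1 + I0)%N.
have hI : 2 <= 2 ^+ I * (P / g%:R).
  have h1 : g%:R <= 2 ^+ (trunc_log 2 g).+1 :> R.
    by rewrite -natrX ler_nat ltnW // trunc_log_ltn.
  have h2 : 2 <= 2 ^+ I0 * P.
    apply: le_trans (_ : 2 ^+ I0 * kappa <= _); first by rewrite -ler_pdivrMr.
    by rewrite ler_pM2l // exprn_gt0.
  rewrite mulrA ler_pdivlMr // /I exprD -mulrA [X in X <= _]mulrC.
  by apply: ler_pM => //; exact: ltW.
have IE : I%:R <= c * ln g%:R.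
  have tl : (trunc_log 2 g)%:R <= (ln 2)^-1 * ln g%:R :> R.
    rewrite mulrC ler_pdivlMr // mulr_natl -lnXn // ler_ln ?posrE ?exprn_gt0 //.
    by rewrite -natrX ler_nat trunc_logP.
  rewrite /I natrD -addn1 natrD /c !mulrDl mul1r; apply: lerD; first exact: lerD.
  by rewrite ler_peMr.
have K0 : 0 < K.+1%:R :> R by rewrite ltr0n.
have gK : g%:R * ln g%:R <= P * K.+1%:R.
  by rewrite -ler_pdivrMl // mulrC; apply: le_trans hK _; rewrite ler_nat.
have gK1 : g%:R <= P * K.+1%:R by apply: le_trans gK; rewrite ler_peMr // ltW.
apply: le_trans (NK_lower_bound K hD g0 (divr_gt0 P0 G0) hI SB ht).
rewrite lee_fin -[X in _ <= X]addrA lerD2l -opprD lerN2 [X in _ <= X]mulrDl.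
apply: lerD; first by rewrite mulrAC ler_pdivlMr // ler_pM2l.
rewrite [X in _ <= X]mulrDl; apply: lerD; first by rewrite mulrAC.
rewrite -[X in _ <= X]mulrA ler_pM2l // [X in _ <= X]mulrDl; apply: lerD.
  have -> : (2 * g)%:R * (P / g%:R) = 2 * P by rewrite natrM; field; rewrite gt_eqF.
  by rewrite le_eqVlt; apply/orP; left; apply/eqP; ring.
rewrite ler_pdivrMr // -[X in _ <= X]mulrA [X in _ <= X]mulrDl.
have pos : 0 <= 8 * c by rewrite mulr_ge0 // !addr_ge0 // invr_ge0 ltW.
apply: lerD.
  rewrite (_ : 4 * (2 * g)%:R * I%:R = 8 * (g%:R * I%:R)); last by rewrite natrM; ring.
  apply: (@le_trans _ _ (8 * (g%:R * (c * ln g%:R)))); first by rewrite ler_pM2l // ler_pM2l.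
  rewrite (_ : 8 * (g%:R * (c * ln g%:R)) = 8 * c * (g%:R * ln g%:R)); last by ring.
  exact: ler_wpM2l.
rewrite (_ : 4 * (A * P * pi) / (P / g%:R) = 4 * A * pi * g%:R); last first.
  by field; rewrite !gt_eqF.
by rewrite ler_wpM2l // !mulr_ge0 // ltW.
Qed.

End MainBound.

Theorem theorem15 (R : realType) (F : finFieldType) (q_odd : odd #|F|)
    (Phi : nat -> R) (Phi_gt0 : forall g : nat, 0 < Phi g)
    (S_bound : exists A : R, \forall g \near \oo,
       forall (D : {poly F}) (theta : R),
         hyperelliptic g D -> 0 <= theta <= 1 ->
         `|Sfun D theta| <= A * Phi g) :
  exists C : R, \forall g \near \oo,
    forall (D : {poly F}) (K : nat) (theta : R),
      hyperelliptic g D ->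
      g%:R * ln g%:R / Phi g <= K%:R ->
      0 <= theta < 1 ->
      (((2 * g)%:R * theta - C * Phi g)%:E <= NK g K D theta)%E.
Proof.
have [A [N0 _ SA]] := S_bound.
have [kappa k0 kP] := S_lower_bound R q_odd.
(* The given A carries no sign; |A| + 1 is positive and can divide kappa. *)
have A0 : 0 < `|A| + 1 by rewrite ltr_wpDl.
have SB g (D : {poly F}) (theta : R) : (N0 <= g)%N -> hyperelliptic g D -> 0 <= theta <= 1 ->
    `|Sfun D theta| <= (`|A| + 1) * Phi g :> R.
  move=> Ng hD ht; have h : `|Sfun D theta| <= A * Phi g := SA g Ng D theta hD ht.
  apply: le_trans h _.
  by rewrite ler_pM2r // ler_wpDr // ler_norm.
have [C hC] := theorem15_bound q_odd Phi (divr_gt0 k0 A0) A0.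
(* Beyond e one has log g >= 1, which absorbs the terms without a logarithm. *)
exists C, (maxn N0 (Num.bound (expR 1 : R)).+1) => // g /=.
rewrite geq_max => /andP[Ng eg] D K theta hD hK ht.
have g0 : (0 < g)%N by exact: leq_trans eg.
apply: hC => //.
- rewrite -ler_expR lnK ?posrE ?ltr0n //.
  apply: le_trans (ltW (archi_boundP (expR_ge0 _))) _; rewrite ler_nat; exact: ltnW.
- rewrite ler_pdivrMr // mulrC; apply: (kP g) => // D' theta'; exact: SB.
- by move=> theta'; exact: SB.
Qed.
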